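(* Let $N\ge 1$ and $k\ge 0$ be integers. The graded $\mathbb{C}$-algebra $(V^{\mathrm{diff}})^{(k)}$ of differentially homogeneous polynomials in $(N+1)$ variables of order at most $k$ is finitely generated: it is generated by the explicit finite set $\mathcal{G}_1\cup\mathcal{G}_2\cup\dots\cup\mathcal{G}_{k+1}$, where $\mathcal{G}_1$ consists of $N+1$ generators of degree $1$ and order $0$, and, for every $2\le i\le k+1$, $\mathcal{G}_i$ consists of $\frac{N(N+1)}{2}\,(N+1)^{i-2}$ generators of degree $i$ and order $i-1$. Furthermore, this set of generators is minimal (no proper subset of it generates the algebra).
   Context: Fix $N\ge 1$. Consider formal variables $X_i^{(j)}$, $0\le i\le N$, $j\in\mathbb{N}$, and the algebra of differential polynomials $V=\mathbb{C}[X_i^{(j)}: 0\le i\le N,\ j\ge 0]$, graded by giving each variable degree $1$; $V_d$ is the degree-$d$ component. For $k\in\mathbb{N}$ put $V^{(k)}=\mathbb{C}[X_i^{(j)}: 0\le i\le N,\ 0\le j\le k]$. An element of $V^{(k)}$ has order at most $k$; it has order $k$ if moreover it is not in $V^{(k-1)}$ (with $V^{(-1)}=\mathbb{C}$). The group $\mathbb{C}[[T]]^{\times}$ of invertible formal power series acts on $V$ by algebra automorphisms: for $\alpha\in\mathbb{C}[[T]]^\times$, $\alpha\cdot P$ is obtained from $P$ by substituting $X_i^{(m)}\mapsto\sum_{j=0}^m\binom{m}{j}\alpha^{(m-j)}(0)X_i^{(j)}$, where $\alpha^{(s)}$ is the $s$-th formal derivative. $P\in V$ is differentially homogeneous of degree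 $d$ if $\alpha\cdot P=\alpha(0)^dP$ for all $\alpha\in\mathbb{C}[[T]]^\times$. Let $V_d^{\mathrm{diff}}\subset V_d$ be the space of such polynomials, $V^{\mathrm{diff}}=\bigoplus_{d}V_d^{\mathrm{diff}}$, and $(V^{\mathrm{diff}})^{(k)}=V^{\mathrm{diff}}\cap V^{(k)}$. The sets $\mathcal{G}_d$ ($d\ge 1$). Let $\overline{\Sigma_d}$ be the set of sequences $\boldsymbol\alpha=(\boldsymbol\alpha_0,\dots,\boldsymbol\alpha_N)$ such that: (1) each $\boldsymbol\alpha_i=(\alpha_{i,1},\dots,\alpha_{i,r_i})$ is a finite (possibly empty, $r_i=0$) sequence of natural numbers; (2) whenever $r_i\ge 1$, $0\le\alpha_{i,1}<\dots<\alpha_{i,r_i}<r_0+\dots+r_i$; (3) $r_0+\dots+r_N=d$; (4) there is an index $0\le i\le N$ with $r_i\geq 1$ such that $\alpha_{i,1}=0$; if $r_i>1$ then $\alpha_{i,r_i}<r_0+\dots+r_i-1$; and for every $j>i$ with $r_j\ge1$, $\alpha_{j,r_j}<r_0+\dots+r_j-1$. For $\boldsymbol\alpha\in\overline{\Sigma_d}$, let $W_{\boldsymbol\alpha}^{\mathrm{subs}}$ be the determinant of the $d\times d$ matrix whose columns are, in this order, $c_0(\alpha_{0,1}),\dots,c_0(\alpha_{0,r_0}),\dots,c_N(\alpha_{N,1}),\dots,c_N(\alpha_{N,r_N})$, where $c_i(a)$ is the column with entries, for $j=0,\dots,d-1$, equal to $\frac{j!}{(j-a)!}X_i^{(j-a)}$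 if $j\ge a$ and $0$ if $j<a$. (Equivalently, $c_i(a)=J^a\cdot(X_i^{(0)},\dots,X_i^{(d-1)})^{\intercal}$, where $J$ acts entrywise by $J X_i^{(j)}=jX_i^{(j-1)}$ and $JX_i^{(0)}=0$.) Set $\mathcal{G}_d=\{W^{\mathrm{subs}}_{\boldsymbol\alpha}:\boldsymbol\alpha\in\overline{\Sigma_d}\}$; in particular $\mathcal{G}_1=\{X_0^{(0)},\dots,X_N^{(0)}\}$. *)

(* Defs.v *)
From HB Require Import structures.
From mathcomp Require Import all_boot all_order all_algebra.
From mathcomp Require Import finmap monalg complex.
From mathcomp Require Import boolp classical_sets functions cardinality reals.

Set Implicit Arguments.
Unset Strict Implicit.
Unset Printing Implicit Defensive.

Import GRing.Theory.

Local Open Scope classical_set_scope.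
Local Open Scope ring_scope.

(* A formal power series is its sequence of coefficients:
   a stands for \sum_n a n * T^n. *)
Section PowerSeries.
Variable K : fieldType.
Implicit Types a b : nat -> K.

Definition fps_one : nat -> K := fun n => (n == 0)%:R.

Definition fps_mul a b : nat -> K :=
  fun n => \sum_(i < n.+1) a i * b (n - i)%N.

Definition fps_unit a : Prop := exists b, fps_mul a b = fps_one.

Definition fps_deriv a : nat -> K := fun n => a n.+1 *+ n.+1.

Definition fps_at0 a : K := a 0%N.

End PowerSeries.

(* The variable X_i^(j) is indexed by the pair (i, j). *)
Notation diffpoly R N := {malg R[i][{cmonom ('I_N.+1 * nat)%type}]}.

Section DifferentialPolynomials.
Variables (R : realType) (N : nat).

Local Notation V := (diffpoly R N).

Definition X (i : 'I_N.+1) (j : nat) : V := << ucm (i, j) >>.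

Definition subalg_gen (S : set V) : set V :=
  smallest (fun A : set V => GRing.subalg_closed [in A]) S.

Definition homog (d : nat) : set V :=
  [set P : V | forall m, m \in msupp P -> mdeg m = d].

Definition order_le (k : nat) : set V :=
  subalg_gen [set P | exists i j, (j <= k)%N /\ P = X i j].

Definition constants : set V := range (@malgC _ R[i]).

Definition order_eq (k : nat) : set V :=
  order_le k `\` (if k is k'.+1 then order_le k' else constants).

Definition act_var (a : nat -> R[i]) (i : 'I_N.+1) (m : nat) : V :=
  \sum_(j < m.+1)
    ('C(m, j)%:R * fps_at0 (iter (m - j) (@fps_deriv _) a)) *: X i j.

Definition act (a : nat -> R[i]) (P : V) : V :=
  mmap malgC
    (fun m : {cmonom ('I_N.+1 * nat)%type} =>
       \prod_(x <- finsupp m) act_var a x.1 x.2 ^+ m x)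
    P.

Definition diff_homog (d : nat) : set V :=
  [set P | forall a, fps_unit a -> act a P = fps_at0 a ^+ d *: P].

Definition Vdiff : set V :=
  [set P | exists n (p : nat -> V),
     (forall d, diff_homog d (p d)) /\ P = \sum_(d < n) p d].

Definition Vdiff_order_le (k : nat) : set V := Vdiff `&` order_le k.

(* r_0 + ... + r_i, where r_j is the length of the sequence alpha_j. *)
Definition partial_size (alpha : 'I_N.+1 -> seq nat) (i : 'I_N.+1) : nat :=
  (\sum_(j < N.+1 | (j <= i)%N) size (alpha j))%N.

(* For a nonempty sequence s of naturals, head 0 s and last 0 s are its first
   and last terms. *)
Definition Sigma_bar (d : nat) : set ('I_N.+1 -> seq nat) :=
  [set alpha |
    [/\ forall i, (0 < size (alpha i))%N ->
          sorted ltn (alpha i) /\ (last 0 (alpha i) < partial_size alpha i)%N,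
        (\sum_(i < N.+1) size (alpha i))%N = d
      & exists i, [/\ (0 < size (alpha i))%N,
          head 0%N (alpha i) = 0%N,
          (1 < size (alpha i))%N ->
            (last 0 (alpha i) < (partial_size alpha i).-1)%N
        & forall j : 'I_N.+1, (i < j)%N -> (0 < size (alpha j))%N ->
            (last 0 (alpha j) < (partial_size alpha j).-1)%N]]].

(* The j-th entry of the column c_i(a); the falling factorial j ^_ a is
   j! / (j - a)! when a <= j. *)
Definition column (i : 'I_N.+1) (a j : nat) : V :=
  if (a <= j)%N then X i (j - a) *+ j ^_ a else 0.

Definition columns (alpha : 'I_N.+1 -> seq nat) : seq ('I_N.+1 * nat) :=
  [seq (i, a) | i <- enum 'I_N.+1, a <- alpha i].

(* For alpha in Sigma_bar d the list columns alpha has length d, so the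
   default value of nth is never used. *)
Definition Wsubs (d : nat) (alpha : 'I_N.+1 -> seq nat) : V :=
  \det (\matrix_(j < d, l < d)
    let c := nth (ord0, 0%N) (columns alpha) l in column c.1 c.2 j).

Definition G (d : nat) : set V := [set Wsubs d alpha | alpha in Sigma_bar d].

Definition generators (k : nat) : set V :=
  \bigcup_(d in [set d | (1 <= d <= k.+1)%N]) G d.

End DifferentialPolynomials.

Arguments homog R N d _ : clear implicits.
Arguments order_le R N k _ : clear implicits.
Arguments constants R N _ : clear implicits.
Arguments order_eq R N k _ : clear implicits.
Arguments diff_homog R N d _ : clear implicits.
Arguments Vdiff R N _ : clear implicits.
Arguments Vdiff_order_le R N k _ : clear implicits.
Arguments G R N d _ : clear implicits.
Arguments generators R N k _ : clear implicits.

(* Main.v *)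
(* In the variables X_i^(j) / j!, an invariant polynomial P polarizes into
   coefficient lists annihilated by all complete homogeneous polynomials in the
   shift operators, that is, into harmonic polynomials. Harmonic polynomials
   whose exponents are at most k are orthogonal to the Tanisaki ideal of the
   shape with columns k + 1, ..., k + 1, r, hence are combinations of products
   of derivatives of Vandermonde determinants in at most k + 1 variables
   (Garsia-Procesi, De Concini-Procesi). Restitution turns these determinants
   into the W_alpha for the alpha satisfying (1)-(3), called standard below; so
   the W_alpha of degree at most k + 1 generate.

   For a suitable weight, a standard W_alpha has a unique monomial of maximal
   weight, and this monomial determines alpha. When alpha violates (4), it is
   X_j^(0) times the leading monomial of a standard minor of lower degree, so
   induction reduces the generators to those of G_1, ..., G_(k+1).

   Deriving a combination of degree d = n + 1 of elements of G_d by X_f^(n),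
   where f is the largest letter carrying the exponent 0, yields a combination
   of distinct standard minors of degree n: the elements of G_d are independent
   modulo polynomials of order below n. Products of generators of lower degrees
   have order below n in degree n + 1, whence the minimality.

   Standard sequences of size d correspond to words of length d, and (4) says
   that d = 1 or that the first letter exceeds the last one, whence the count. *)

Require Import Defs.
From HB Require Import structures.
From mathcomp Require Import all_boot all_order all_algebra.
From mathcomp Require Import finmap monalg complex.
From mathcomp Require Import boolp classical_sets functions cardinality reals.
From mathcomp Require Import fingroup perm zify ring.

Set Implicit Arguments.
Unset Strict Implicit.
Unset Printing Implicit Defensive.

Import Order.TTheory GRing.Theory Num.Theory.

Local Open Scope ring_scope.

(** * Harmonic coefficient lists and Vandermonde determinants *)

(** Testing with the complete homogeneous polynomials of every subset C of the n positions makes the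
    order bound usable: harmonicity kills the degrees above n - |C|, exponents at most k kill those
    above k |C|, and the shape with columns of height k + 1 is where these two bounds meet. That
    such tests characterize products of Vandermonde derivatives is proved by an elementary double
    induction on the number of variables and on the degree in the first one, without dimension
    counts.

    No explicit quadratic relation among the minors is written down. The difference between a minor
    violating (4) and a multiple of X_j^(0) W_beta is again invariant, so the spanning theorem for
    one single column rewrites it in standard minors, and the weights show that these are smaller.

    Of the invariance, the generation argument uses only the units 1 / (1 - c T), which give
    harmonicity, and the constant 2, which gives homogeneity.

    For minimality, constant terms prevent a plain argument on products; the proof exhibits a
    subalgebra containing all the generators but one, defined by its monomials of order n in degree
    n + 1. *)

Section Shifts.
Variable K : comNzRingType.
Implicit Types (f g : seq nat -> K) (C M : seq bool) (s t : seq nat).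

(* The complete homogeneous polynomial of degree r in the shift operators of the
   positions selected by the mask C, applied to f at s. *)
Fixpoint hsum C (r : nat) f s : K :=
  match C, s with
  | true :: C', x :: s' =>
      \sum_(l < r.+1) hsum C' (r - l) (fun t => f ((x + l)%N :: t)) s'
  | false :: C', x :: s' => hsum C' r (fun t => f (x :: t)) s'
  | _, _ => if r == 0%N then f s else 0
  end.

Lemma hsum_ext C r f g s : size C = size s ->
  (forall t, size t = size s -> f t = g t) -> hsum C r f s = hsum C r g s.
Proof.
elim: C s r f g => [|b C IH] [|x s] r f g //=; first by move=> _ ->.
move=> [sC] fg; case: b.
  by apply: eq_bigr => l _; apply: IH => // t st; apply: fg; rewrite /= st.
by apply: IH => // t st; apply: fg; rewrite /= st.
Qed.

Lemma hsumZ C r (c : K) f s : hsum C r (fun t => c * f t) s = c * hsum C r f s.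
Proof.
elim: C s r f => [|b C IH] [|x s] r f /=;
  try by case: eqP => // _; rewrite mulr0.
  by case: b; case: eqP => // _; rewrite mulr0.
case: b; last exact: IH.
by rewrite mulr_sumr; apply: eq_bigr => l _; exact: IH.
Qed.

Lemma hsumD C r f g s : hsum C r (fun t => f t + g t) s = hsum C r f s + hsum C r g s.
Proof.
elim: C s r f g => [|b C IH] [|x s] r f g /=;
  try by case: eqP => // _; rewrite addr0.
  by case: b; case: eqP => // _; rewrite addr0.
case: b; last exact: IH.
by rewrite -big_split /=; apply: eq_bigr => l _; exact: IH.
Qed.

Lemma hsum_fun0 C r s : hsum C r (fun=> 0) s = 0.
Proof.
elim: C s r => [|b C IH] [|x s] r /=; try by case: eqP.
  by case: b; case: eqP.
case: b => //; by rewrite big1.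
Qed.

Lemma hsum_sum (I : Type) (w : seq I) C r (F : I -> seq nat -> K) s :
  hsum C r (fun t => \sum_(i <- w) F i t) s = \sum_(i <- w) hsum C r (F i) s.
Proof.
elim: w => [|i w IH].
  rewrite big_nil -[RHS](hsum_fun0 C r s).
  by congr (hsum _ _ _ _); apply: functional_extensionality_dep => t; rewrite big_nil.
rewrite big_cons -IH -hsumD.
by congr (hsum _ _ _ _); apply: functional_extensionality_dep => t; rewrite big_cons.
Qed.

Lemma hsum_eq0 C r f s : size C = size s ->
  (forall t, size t = size s -> f t = 0) -> hsum C r f s = 0.
Proof. by move=> sC f0; rewrite (hsum_ext _ sC f0) hsum_fun0. Qed.

Lemma hsum0 C f s : size C = size s -> hsum C 0 f s = f s.
Proof.
elim: C s f => [|b C IH] [|x s] f //= [sC]; case: b; last exact: IH.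
by rewrite big_ord1 IH // addn0.
Qed.

Lemma hsum_count0 C r f s : size C = size s -> count id C = 0%N ->
  hsum C r f s = if r == 0%N then f s else 0.
Proof. by elim: C s f => [|[] C IH] [|x s] f //= [sC]; rewrite ?add0n; apply: IH. Qed.

(** Both sides run over the triples of sum [r]; the right one groups the first two indices by their
    sum [L]. *)
Lemma sum_triangle (r : nat) (F : nat -> nat -> nat -> K) :
  \sum_(l < r.+1) \sum_(m < (r - l).+1) F l m (r - l - m)%N =
  \sum_(L < r.+1) \sum_(l < L.+1) F l (L - l)%N (r - L)%N.
Proof.
elim: r F => [|r IH] F; first by rewrite !big_ord1.
rewrite big_ord_recl subn0.
under [X in _ + X]eq_bigr do rewrite lift0 subSS.
rewrite (IH (fun l => F l.+1)).
under [RHS]eq_bigr do rewrite big_ord_recl subn0.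
rewrite big_split /=; congr (_ + _).
rewrite [RHS]big_ord_recl big_ord0 add0r; apply: eq_bigr => L _.
by rewrite lift0; apply: eq_bigr => l _; rewrite /bump add1n !subSS.
Qed.

(** The complete homogeneous polynomial of a disjoint union of variables is the convolution of those
    of the parts. Here the parts are those of [C] inside and outside [M], and each factor sees only
    one of them. *)
Lemma hsum_mask M C r f g s : size M = size s -> size C = size s ->
  hsum C r (fun t => f (mask M t) * g (mask (map negb M) t)) s =
  \sum_(l < r.+1) hsum (mask M C) l f (mask M s) *
    hsum (mask (map negb M) C) (r - l) g (mask (map negb M) s).
Proof.
elim: M C s r f g => [|m M IH] [|b C] [|x s] r f g //=.
  move=> _ _; rewrite (big_ord_recl r) big1 ?addr0 /= ?subn0; last first.
    by move=> i _; rewrite mul0r.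
  by case: eqP => // _; rewrite mulr0.
move=> [sM] [sC]; case: m; case: b => /=.
- under eq_bigr do rewrite (IH _ _ _ (fun t => f (_ :: t)) g) //.
  rewrite (sum_triangle _ (fun l m n => hsum (mask M C) m
     (fun t => f ((x + l)%N :: t)) (mask M s) *
     hsum (mask (map negb M) C) n g (mask (map negb M) s))).
  by apply: eq_bigr => L _; rewrite mulr_suml.
- by rewrite (IH _ _ _ (fun t => f (x :: t)) g).
- under eq_bigr do rewrite (IH _ _ _ f (fun t => g (_ :: t))) //.
  under [RHS]eq_bigr do rewrite mulr_sumr.
  pose F l m n := hsum (mask M C) m f (mask M s) *
     hsum (mask (map negb M) C) n (fun t => g ((x + l)%N :: t))
        (mask (map negb M) s).
  rewrite (sum_triangle _ F).
  have -> : \sum_(i < r.+1) \sum_(i0 < (r - i).+1) hsum (mask M C) i f (mask M s) *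
      hsum (mask (map negb M) C) (r - i - i0) (fun t => g ((x + i0)%N :: t))
        (mask (map negb M) s) =
     \sum_(i < r.+1) \sum_(i0 < (r - i).+1) F i0 i (r - i - i0)%N by [].
  rewrite (sum_triangle _ (fun a b => F b a)).
  apply: eq_bigr => L _.
  rewrite [RHS](reindex_inj rev_ord_inj) /=; apply: eq_bigr => l _.
  by rewrite subSS subKn // -ltnS.
- by rewrite (IH _ _ _ f (fun t => g (x :: t))).
Qed.

(** On coefficient lists, shifting the exponents by [al] is the derivative of multi-order [al] up to
    factorials. *)
Definition addl (al s : seq nat) : seq nat := [seq (p.1 + p.2)%N | p <- zip al s].

Lemma size_addl al s : size al = size s -> size (addl al s) = size s.
Proof. by move=> h; rewrite size_map size_zip h minnn. Qed.

Lemma hsum_addl al C r f s : size al = size s -> size C = size s ->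
  hsum C r (fun t => f (addl al t)) s = hsum C r f (addl al s).
Proof.
elim: C al s r f => [|b C IH] [|a al] [|x s] r f //= [sa] [sC].
case: b; last by rewrite -(IH al s).
by apply: eq_bigr => l _; rewrite -(IH al s) //=; congr hsum; rewrite /addl /= addnA.
Qed.

(** The identity h_{r+1}(C, y) = h_{r+1}(C) + y h_r(C, y), where y is the shift operator at the
    marked position. *)
Lemma hsum_add_mask C1 C2 r f s1 x s2 : size C1 = size s1 -> size C2 = size s2 ->
  hsum (C1 ++ true :: C2) r.+1 f (s1 ++ x :: s2) =
  hsum (C1 ++ false :: C2) r.+1 f (s1 ++ x :: s2) +
  hsum (C1 ++ true :: C2) r f (s1 ++ x.+1 :: s2).
Proof.
elim: C1 s1 r f => [|b C1 IH] [|y s1] r f //= => [_ sC2|[sC1] sC2].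
  rewrite big_ord_recl addn0 subn0; congr (_ + _); apply: eq_bigr => l _.
  by rewrite lift0 subSS addnS addSn.
case: b; last exact: IH.
rewrite big_ord_recr /= subnn hsum0; last by rewrite !size_cat /= sC1 sC2.
rewrite [in X in _ = X + _]big_ord_recr /= subnn hsum0; last first.
  by rewrite !size_cat /= sC1 sC2.
rewrite addrAC; congr (_ + _); rewrite -big_split /=; apply: eq_bigr => l _.
by rewrite subSn ?IH // -ltnS.
Qed.

(** [hsum_add_mask] expresses h_r(C) by h_r and h_{r-1} of a set with one more position. The
    condition r > n - |C| survives in both terms, and at the full set all positive degrees
    vanish. *)
Lemma hsum_descend n f :
  (forall r s, size s = n -> hsum (nseq n true) r.+1 f s = 0) ->
  forall C r s, size C = n -> size s = n ->
    (0 < count id C)%N -> (n < r + count id C)%N -> hsum C r f s = 0.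
Proof.
move=> full C r s sC.
have [k] := ubnP (n - count id C); elim: k C r s sC => // k IH C r s sC hk ss c0 hr.
have cle : (count id C <= n)%N by rewrite -sC count_size.
have [|] := boolP (false \in C); last first.
  move=> nF; have defC : C = nseq n true.
    by rewrite -sC; apply/all_pred1P/allP => -[] // /(negP nF).
  case: r hr => [|r] hr; last by rewrite defC; apply: full.
  by move: hr; rewrite add0n ltnNge cle.
move=> mC; have [C1 [C2 defC]] : exists C1 C2 : seq bool, C = C1 ++ false :: C2.
  by case/splitPr: mC => C1 C2; exists C1, C2.
rewrite {C mC}defC in sC hk c0 hr cle *.
have sC' : size (C1 ++ true :: C2) = n by rewrite -sC !size_cat.
have cC' : count id (C1 ++ true :: C2) = (count id (C1 ++ false :: C2)).+1.
  by rewrite !count_cat /= addnS.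
have ltC : (count id (C1 ++ true :: C2) <= n)%N by rewrite -sC' count_size.
rewrite cC' in ltC.
case: r hr => [|r] hr; first lia.
have ss1 : (size C1 < size s)%N by rewrite ss -sC size_cat /= addnS ltnS leq_addr.
rewrite -(cat_take_drop (size C1) s) (drop_nth 0%N ss1).
set s1 := take _ s; set x := nth _ _ _; set s2 := drop _ s.
have s1E : size C1 = size s1 by rewrite size_take ss1.
have s2E : size C2 = size s2.
  by rewrite size_drop ss -sC size_cat /=; lia.
have sE y : size (s1 ++ y :: s2) = n by rewrite -sC !size_cat /= s1E s2E.
have := hsum_add_mask r f x s1E s2E.
rewrite IH ?cC' //; try lia.
rewrite (IH _ r) ?cC' //; try lia.
by rewrite addr0 => <-.
Qed.

(** A monomial of degree above k |C| in the shifts of [C] raises some position by more than [k]. *)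
Lemma hsum_bounded k C r f s : size C = size s ->
  (forall t, size t = size s -> has (ltn k) t -> f t = 0) ->
  (k * count id C < r)%N -> hsum C r f s = 0.
Proof.
elim: C s r f => [|b C IH] [|x s] r f //=.
  by move=> _ _; rewrite muln0; case: r.
move=> [sC] f0; case: b => /= hr; last first.
  apply: IH => // t st ht; apply: f0; rewrite /= ?st //.
  by rewrite ht orbT.
rewrite big1 // => l _; have [le|gt] := leqP l k.
  apply: IH => // [t st ht|]; last by lia.
  by apply: f0; rewrite /= ?st // ht orbT.
apply: hsum_eq0 => // t st; apply: f0; rewrite /= ?st //.
by rewrite (leq_trans gt) ?leq_addl.
Qed.

(* The coefficient of the monomial of exponents s in a Vandermonde determinant.
   The top exponent is row 0, so that a largest head is removed without a sign. *)
Definition vd s : K :=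
  \det (\matrix_(i < size s, j < size s) (nth 0%N s j == (size s).-1 - i)%N%:R).

Definition delnth (p : nat) s := take p s ++ drop p.+1 s.

Lemma size_delnth p s : (p < size s)%N -> size (delnth p s) = (size s).-1.
Proof. by move=> h; rewrite size_cat size_take h size_drop; lia. Qed.

Lemma nth_delnth p s j : (p < size s)%N -> nth 0%N (delnth p s) j = nth 0%N s (bump p j).
Proof.
move=> h; rewrite nth_cat size_take h /bump; case: leqP => hj.
  by rewrite nth_drop; congr nth; lia.
by rewrite nth_take.
Qed.

(* The expansion of vd along its first row, with the value v instead of the
   top value; it vanishes for the other values, being a determinant with two
   equal rows or a zero row. *)
Definition vrow (v : nat) s : K :=
  \sum_(p < size s) (-1) ^+ p * (nth 0%N s p == v)%:R * vd (delnth p s).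

Lemma vrowE n v s (ss : size s = n.+1) : vrow v s =
  \det (\matrix_(i < n.+1, j < n.+1)
    (nth 0%N s j == if i == 0%N :> nat then v else n - i)%N%:R).
Proof.
rewrite (expand_det_row _ ord0) /vrow ss; apply: eq_bigr => p _.
rewrite !mxE eqxx /= /cofactor add0n -!mulrA mulrCA; congr (_ * (_ * _)).
have sd : size (delnth p s) = n by rewrite size_delnth ss.
rewrite /vd sd; congr (\det _); apply/matrixP => i j; rewrite !mxE nth_delnth ?ss //=.
congr ((_ == _)%:R); rewrite ?/bump /=; lia.
Qed.

Lemma vrow_top s : (0 < size s)%N -> vrow (size s).-1 s = vd s.
Proof.
move ss: (size s) => m; case: m ss => // n ss _; rewrite (vrowE _ ss) /vd ss /=.
congr (\det _); apply/matrixP => i j; rewrite !mxE; congr ((_ == _)%N%:R).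
by case: eqP => // ->; rewrite subn0.
Qed.

Lemma vrow_other v s : (v < (size s).-1)%N -> vrow v s = 0.
Proof.
move ss: (size s) => m; case: m ss => // n ss /= hv; rewrite (vrowE _ ss).
have lt : (n - v < n.+1)%N by lia.
apply: (@determinant_alternate _ _ _ ord0 (Ordinal lt)).
  by apply/eqP => /(congr1 val) /=; lia.
move=> j; rewrite !mxE /= ifN; last by rewrite -lt0n subn_gt0.
by congr ((_ == _)%N%:R); rewrite subKn // ltnW.
Qed.

Lemma vd_ge v s : v \in s -> (size s <= v)%N -> vd s = 0.
Proof.
move=> vs hv; have lt : (index v s < size s)%N by rewrite index_mem.
rewrite /vd (expand_det_col _ (Ordinal lt)) big1 // => i _.
rewrite !mxE /= nth_index //; case: eqP => [|_]; last by rewrite mul0r.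
by have := ltn_ord i; lia.
Qed.

Lemma vd_nil : vd [::] = 1.
Proof. by rewrite /vd det_mx00. Qed.

Lemma vd_cons_top s : vd (size s :: s) = vd s.
Proof.
have [allv|] := boolP (all (gtn (size s)) s).
  rewrite -vrow_top //= /vrow big_ord_recl /= eqxx expr0 !mul1r big1 ?addr0; last first.
    move=> p _; have /= := allP allv (nth 0%N s p) (mem_nth _ (ltn_ord p)).
    by rewrite ltn_neqAle => /andP [/negbTE -> _]; rewrite mulr0 mul0r.
  by rewrite /delnth take0 /= drop0.
(* An entry [v] that is too large kills the right side. It kills the left side as well: as too large
   an exponent or, if it equals [size s], as a repetition of the head. *)
rewrite -has_predC => /hasP [v vs /=]; rewrite -leqNgt => hv.
rewrite (vd_ge vs) //; have [E|nv] := eqVneq v (size s); last first.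
  by apply: (@vd_ge v); rewrite ?inE ?vs ?orbT //= ltn_neqAle eq_sym nv.
rewrite {}E {v hv} in vs.
have lt : (index (size s) s < size s)%N by rewrite index_mem.
rewrite /vd -det_tr.
apply: (@determinant_alternate _ _ _ ord0 (lift ord0 (Ordinal lt))) => //.
by move=> j; rewrite !mxE /= nth_index.
Qed.

(** The indicator fixes the shift of position [p]; the remaining degree goes to the other
    positions. *)
Lemma hsum_delnth n p s r v f : size s = n -> (p < n)%N ->
  hsum (nseq n true) r
    (fun t => (nth 0%N t p == v)%:R * f (delnth p t)) s =
  if (nth 0%N s p <= v)%N && (v - nth 0%N s p <= r)%N then
    hsum (nseq n.-1 true) (r - (v - nth 0%N s p)) f (delnth p s) else 0.
Proof.
move=> <- {n}.
elim: s p r f => // x s IH [|p] r f /= hp.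
  under eq_bigr => l _.
    rewrite (@hsum_ext _ _ _ (fun t => ((x + l)%N == v)%:R * f t)); first over.
      by rewrite size_nseq.
    by move=> t _; rewrite /delnth take0 /= drop0.
  under eq_bigr do rewrite hsumZ.
  rewrite /delnth /= ?take0 ?drop0 /=.
  have [lev|gtv] /= := leqP x v; last first.
    by rewrite big1 // => l _; case: eqP => [|_]; [lia|rewrite mul0r].
  have [ler|gtr] := leqP (v - x) r; last first.
    by rewrite big1 // => l _; case: eqP => [|_]; [have := ltn_ord l; lia|rewrite mul0r].
  have lt : (v - x < r.+1)%N by [].
  rewrite (bigD1 (Ordinal lt)) //= subnKC // eqxx mul1r big1 ?addr0 // => l.
  rewrite -val_eqE /= => nl; case: eqP => [|_]; last by rewrite mul0r.
  by move=> E; case/negP: nl; apply/eqP; lia.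
under eq_bigr do rewrite (IH _ _ (fun t => f (_ :: t)) hp).
case: (leqP (nth 0%N s p) v) => [lev|gtv] /=; last by rewrite big1.
set a := (v - _)%N.
have sE : nseq (size s) true = true :: nseq (size s).-1 true by case: (size s) hp.
have [ler|gtr] := leqP a r; last first.
  by rewrite big1 // => l _; case: ifP => // h; move: gtr h; lia.
rewrite sE /delnth /= (big_ord_widen_cond r.+1 xpredT (fun l => hsum (nseq (size s).-1 true)
  (r - a - l) (fun t => f ((x + l)%N :: t)) (take p s ++ drop p.+1 s))); last by lia.
rewrite [RHS]big_mkcond /=; apply: eq_bigr => l _.
have -> : (a <= r - l)%N = (l < (r - a).+1)%N by have := ltn_ord l; lia.
by case: ifP => // _; congr hsum; lia.
Qed.

(** Expansion along the first row and induction on [n]: the minors are killed by positive degrees,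
    so the whole degree r + 1 is spent on the expanded position. This lowers the exponent required
    there from n - 1 to a smaller one, and what remains is zero or expands a determinant with two
    equal rows. *)
Lemma vd_harmonic n r s : size s = n -> hsum (nseq n true) r.+1 vd s = 0.
Proof.
elim: n r s => [|n IH] r s ss; first by case: s ss.
have IH0 m t : size t = n -> hsum (nseq n true) m vd t = if m == 0%N then vd t else 0.
  case: m => [|m] st; last exact: IH.
  by rewrite hsum0 // size_nseq st.
rewrite (@hsum_ext _ _ _ (fun t => \sum_(p < n.+1)
   (-1) ^+ p * ((nth 0%N t p == n)%:R * vd (delnth p t)))); last first.
- move=> t; rewrite ss => st; rewrite -vrow_top ?st // /vrow st.
  by apply: eq_bigr => p _; rewrite mulrA.
- by rewrite size_nseq.
rewrite hsum_sum.
under eq_bigr => p _ do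
  rewrite hsumZ (hsum_delnth _ _ _ ss) // IH0 ?size_delnth ?ss //.
transitivity (\sum_(p < n.+1) (-1) ^+ p * ((nth 0%N s p + r.+1 == n)%N%:R * vd (delnth p s))).
  apply: eq_bigr => p _; congr (_ * _).
  case: (nth 0%N s p + r.+1 =P n)%N => E.
    have -> : (n - nth 0%N s p = r.+1)%N by lia.
    by rewrite mul1r leqnn subnn andbT ifT //; lia.
  by rewrite mul0r; case: ifP => // /andP [h1 h2]; case: eqP => // h3; exfalso; lia.
have [lt|ge] := ltnP r n; last first.
  rewrite big1 // => p _; case: eqP => [|_]; first by lia.
  by rewrite mul0r mulr0.
transitivity (vrow (n - r.+1) s); last by rewrite vrow_other // ss /=; lia.
rewrite /vrow ss; apply: eq_bigr => p _; rewrite -mulrA; congr (_ * (_%:R * _)).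
by congr nat_of_bool; apply/eqP/eqP; lia.
Qed.

Lemma hsum_vd C r s : size C = size s -> (0 < count id C)%N ->
  (size s < r + count id C)%N -> hsum C r vd s = 0.
Proof. by move=> sC; apply: (hsum_descend (n := size s)) => // r' s'; apply: vd_harmonic. Qed.

(** The exponents of Artin's monomials: derivatives of these orders suffice, and for a word with
    decreasing letters the bound becomes condition (2), see [stair_bound]. *)
Fixpoint stair (al : seq nat) : bool :=
  if al is a :: al' then (a <= size al')%N && stair al' else true.

(* Up to factorials, the coefficients of products of derivatives of Vandermonde
   determinants in disjoint sets of variables, whose sizes are listed in h. *)
Inductive isprod : seq nat -> (seq nat -> K) -> Prop :=
| isprod_nil : isprod [::] (fun=> 1)
| isprod_cons m h al M F : size al = m -> stair al -> size M = (m + sumn h)%N ->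
    count id M = m -> isprod h F ->
    isprod (m :: h)
      (fun t => vd (addl al (mask M t)) * F (mask (map negb M) t)).

Lemma size_mask_negb (T : Type) M (s : seq T) : size M = size s ->
  size (mask (map negb M) s) = (size s - count id M)%N.
Proof.
move=> sM; rewrite size_mask ?size_map // -sM -(count_predC id M) addKn count_map.
by apply: eq_count.
Qed.

Lemma isprod_consP m h F : isprod (m :: h) F -> exists al M F0,
  [/\ [/\ size al = m, stair al, size M = (m + sumn h)%N & count id M = m],
      isprod h F0
    & F = (fun t => vd (addl al (mask M t)) * F0 (mask (map negb M) t))].
Proof.
move defh : (m :: h) => h' hF; case: h' F / hF defh => [//|m' h' al M F0 sal st sM cM hF0 [-> ->]].
by exists al, M, F0; split.
Qed.

(** The new head variable joins the determinant of size [m], derived m - i times in it. Its exponent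
    is then at most [i], and the coefficient at [i] is the old determinant, by [vd_cons_top]. *)
Lemma isprod_extend h1 m h2 F i : isprod (h1 ++ m :: h2) F -> (i <= m)%N ->
  exists F', [/\ isprod (h1 ++ m.+1 :: h2) F',
    forall s, size s = sumn (h1 ++ m :: h2) -> F' (i :: s) = F s
    & forall x s, size s = sumn (h1 ++ m :: h2) -> (i < x)%N -> F' (x :: s) = 0].
Proof.
elim: h1 F => [|n h1 IH] F /= /isprod_consP [al [M [F0 [[sal st sM cM] hF0 ->]]]] im.
  exists (fun t => vd (addl ((m - i)%N :: al) (mask (true :: M) t))
                    * F0 (mask (map negb (true :: M)) t)).
  have sz s : size s = (m + sumn h2)%N -> size (addl al (mask M s)) = m.
    by move=> ss; rewrite size_addl size_mask ?cM ?sM ?sal.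
  split=> [|s ss|x s ss ix] /=.
  - by apply: isprod_cons; rewrite //= ?sal ?leq_subr ?sM ?cM.
  - have -> : addl ((m - i)%N :: al) (i :: mask M s) = m :: addl al (mask M s).
      by rewrite /addl /= subnK.
    by rewrite -{1}(sz s ss) vd_cons_top.
  - rewrite (@vd_ge (m - i + x)%N) ?mul0r ?inE ?eqxx //= -/(addl _ _) sz //; lia.
have [F' [hF' F'1 F'2]] := IH _ hF0 im.
exists (fun t => vd (addl al (mask (false :: M) t)) * F' (mask (map negb (false :: M)) t)).
have sz s : size s = (n + sumn (h1 ++ m :: h2))%N ->
    size (mask (map negb M) s) = sumn (h1 ++ m :: h2).
  by move=> ss; rewrite size_mask_negb ?ss ?sM // cM addKn.
split=> [|s ss|x s ss ix] /=.
- by apply: isprod_cons; rewrite //= sM !sumn_cat /=; lia.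
- by rewrite F'1 ?sz.
- by rewrite F'2 ?mulr0 ?sz.
Qed.

(** Distribute the degree over the blocks. A block missed by [C] can only receive degree 0; a block
    of size m met in c positions kills degrees above m - c. The mask [B] records the blocks that are
    met. *)
Lemma isprod_vanish h F : isprod h F -> forall C r s, size C = sumn h ->
  size s = sumn h ->
  (forall B, size B = size h -> (count id B <= count id C)%N ->
     (sumn (mask B h) < r + count id C)%N) ->
  hsum C r F s = 0.
Proof.
elim=> [|m {}h al M {}F sal st sM cM _ IH] C r s sC ss /= hB.
  by case: C s sC ss hB => // -[] // _ _ /(_ [::]); case: r => // /(_ erefl erefl).
rewrite (hsum_mask r (fun u => vd (addl al u)) F) ?sM ?sC ?ss // big1 // => l _.
have sMC : size M = size C by rewrite sM sC.
have cE : count id C = (count id (mask M C) + count id (mask (map negb M) C))%N.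
  elim: (M) (C) sMC => [|b M' IHM] [|c C'] //= [/IHM->].
  by case: b => /=; lia.
have sMs : size (mask M s) = m by rewrite size_mask ?cM ?sM ?ss.
have sMC' : size (mask M C) = m by rewrite size_mask ?cM ?sM ?sC.
have sMs' : size (mask (map negb M) s) = sumn h.
  by rewrite size_mask_negb ?sM ?ss //= cM addKn.
have sMC'' : size (mask (map negb M) C) = sumn h.
  by rewrite size_mask_negb ?sM ?sC //= cM addKn.
have [c0|c0] := posnP (count id (mask M C)).
  rewrite hsum_count0 ?sMC' ?sMs //; case: eqP => [l0|_]; last by rewrite mul0r.
  rewrite IH ?mulr0 // => B sB cB.
  have /= := hB (false :: B); rewrite add0n sB => /(_ erefl).
  by rewrite cE c0 add0n l0 subn0 => ->.
have [lt|ge] := ltnP m (l + count id (mask M C)).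
  rewrite hsum_addl ?sMC' ?sMs // hsum_vd ?mul0r // size_addl ?sMs //.
rewrite IH ?mulr0 // => B sB cB.
have /= := hB (true :: B); rewrite sB => /(_ erefl).
have := ltn_ord l; rewrite cE; lia.
Qed.

(* Orthogonality to the Tanisaki ideal of the shape with columns h, in the
   presentation by complete homogeneous polynomials. *)
Definition vanish (h : seq nat) f := forall C r s, size C = sumn h ->
  size s = sumn h -> (sumn (take (count id C) h) < r + count id C)%N ->
  hsum C r f s = 0.

Lemma sumn_mask_sorted (h : seq nat) (B : seq bool) (c : nat) : sorted geq h ->
  size B = size h -> (count id B <= c)%N -> (sumn (mask B h) <= sumn (take c h))%N.
Proof.
elim: h B c => [|x h IH] [|b B] c //= ph [sB] cB.
have sh := path_sorted ph.
case: b cB => /= cB.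
  by case: c cB => // c cB; rewrite /= leq_add2l IH.
case: c cB => [|c] cB /=.
  have -> : mask B h = [::]; last by [].
  by elim: (B) (h) cB => [|[] B' IHB] [|y h'] //= hc; apply: IHB.
have [cB'|cB'] := leqP (count id B) c.
  by apply: leq_trans (IH _ _ sh sB cB') _; rewrite leq_addl.
apply: leq_trans (IH _ _ sh sB cB) _.
have {cB cB' sB B IH} : all (geq x) h by apply: order_path_min ph => a b d /= ? ?; lia.
elim: h c {ph sh} => [|y h IH] [|c] //= /andP [xy xh].
  by rewrite take0 /= !addn0.
by rewrite addnCA leq_add2l; have := IH c xh; lia.
Qed.

Lemma isprodP h F : sorted geq h -> isprod h F -> vanish h F.
Proof.
move=> sh hF C r s sC ss lt; apply: (isprod_vanish hF) => // B sB cB.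
exact: leq_ltn_trans (sumn_mask_sorted sh sB cB) lt.
Qed.

(** Only the values on lists of length [sumn h] carry meaning, so equalities are imposed there
    alone. *)
Inductive pspan h : (seq nat -> K) -> Prop :=
| pspan_zero f : (forall s, size s = sumn h -> f s = 0) -> pspan h f
| pspan_add c F g f : isprod h F -> pspan h g ->
    (forall s, size s = sumn h -> f s = c * F s + g s) -> pspan h f.

Lemma pspan_ext h f g : (forall s, size s = sumn h -> f s = g s) ->
  pspan h f -> pspan h g.
Proof.
move=> fg pf; case: pf fg => {f} [f f0|c F k f hF pk fE] fg.
  by apply: pspan_zero => s ss; rewrite -fg ?f0.
by apply: (pspan_add (c := c) hF pk) => s ss; rewrite -fg ?fE.
Qed.

Lemma pspanD h f g : pspan h f -> pspan h g -> pspan h (fun s => f s + g s).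
Proof.
move=> pf pg; elim: pf => {f} [f f0|c F k f hF _ IH fE].
  by apply: pspan_ext pg => s ss; rewrite f0 ?add0r.
by apply: (pspan_add (c := c) hF IH) => s ss; rewrite fE // addrA.
Qed.

Lemma vanishD h f g : vanish h f -> vanish h g -> vanish h (fun s => f s + g s).
Proof. by move=> vf vg C r s *; rewrite hsumD vf ?vg ?addr0. Qed.

Lemma vanishZ h c f : vanish h f -> vanish h (fun s => c * f s).
Proof. by move=> vf C r s *; rewrite hsumZ vf ?mulr0. Qed.

Lemma pspan_extend h1 m h2 q i : sorted geq (h1 ++ m.+1 :: h2) ->
  (i <= m)%N -> pspan (h1 ++ m :: h2) q ->
  exists g, [/\ pspan (h1 ++ m.+1 :: h2) g, vanish (h1 ++ m.+1 :: h2) g,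
    forall s, size s = sumn (h1 ++ m :: h2) -> g (i :: s) = q s
    & forall x s, size s = sumn (h1 ++ m :: h2) -> (i < x)%N -> g (x :: s) = 0].
Proof.
move=> sh im; elim=> {q} [q q0|c F k q hF _ [g [pg vg g1 g2]] qE].
  exists (fun=> 0); split=> //; first exact: pspan_zero.
    by move=> C r s _ _ _; rewrite hsum_fun0.
  by move=> s ss; rewrite q0.
have [F' [hF' F'1 F'2]] := isprod_extend hF im.
exists (fun s => c * F' s + g s); split=> [||s ss|x s ss ix].
- exact: (pspan_add hF' pg).
- by apply: vanishD => //; apply/vanishZ/isprodP.
- by rewrite F'1 // g1 // qE.
- by rewrite F'2 // g2 // mulr0 addr0.
Qed.

Lemma pspan_nil h f : sumn h = 0%N -> pspan h f.
Proof.
move=> h0; have [F hF F1] : exists2 F, isprod h F & F [::] = 1.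
  elim: h h0 => [_|m h IH /= /eqP]; first by exists (fun=> 1) => //; constructor.
  rewrite addn_eq0 => /andP [/eqP -> /eqP h0]; have [F hF F1] := IH h0.
  exists (fun t => vd (addl [::] (mask [::] t)) * F (mask (map negb [::]) t)).
    by apply: isprod_cons; rewrite // h0.
  by rewrite /= vd_nil mul1r.
apply: (pspan_add (c := f [::]) (g := fun=> 0) hF); first exact: pspan_zero.
by move=> s; rewrite h0 => /size0nil ->; rewrite F1 mulr1 addr0.
Qed.

(** Starting from head exponent 0, a degree [l] spent on the head selects the coefficient at [l].
    The hypotheses kill every [l] except [i], the top one. *)
Lemma hsum_head C r f s (i : nat) : size C = size s ->
  (forall x t, size t = size s -> (i < x)%N -> f (x :: t) = 0) ->
  (forall l, (l < i)%N -> hsum C (r + i - l) (fun t => f (l :: t)) s = 0) ->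
  hsum (true :: C) (r + i) f (0%N :: s) = hsum C r (fun t => f (i :: t)) s.
Proof.
move=> sC fi fl /=.
have lt : (i < (r + i).+1)%N by rewrite ltnS leq_addl.
rewrite (bigD1 (Ordinal lt)) //= add0n addnK big1 ?addr0 // => l.
rewrite -val_eqE neq_ltn /= add0n => /orP [/fl //|il].
by apply: hsum_eq0 => // t st; apply: fi.
Qed.

(** Picks the last column higher than [i]; shortening it by one keeps the heights sorted. *)
Lemma sorted_geq_split (h : seq nat) (i : nat) : sorted geq h -> (i < head 0%N h)%N ->
  exists h1 m h2, [/\ h = h1 ++ m.+1 :: h2, (i <= m)%N & all (geq i) h2].
Proof.
elim: h => // x h IH /= ph ix; have [lt|ge] := ltnP i (head 0%N h).
  have [h1 [m [h2 [-> im ah2]]]] := IH (path_sorted ph) lt.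
  by exists (x :: h1), m, h2.
case: x ix ph => // x ix ph; exists [::], x, h; split=> //.
case: h ph ge {IH} => //= y h /andP [_ ph] yi; rewrite yi /=.
have /allP ah : all (geq y) h by apply: order_path_min ph => a b d /= ? ?; lia.
by apply/allP => z /ah /=; lia.
Qed.

(** Test with the head position alone: the degrees from the height of the first column on vanish. *)
Lemma vanish_head h f x s : vanish h f -> sumn h = (size s).+1 ->
  (head 0%N h <= x)%N -> f (x :: s) = 0.
Proof.
move=> vf sumh hx; set n := size s in sumh.
have c0 : count id (nseq n false) = 0%N by rewrite count_nseq.
suff <- : hsum (true :: nseq n false) x f (0%N :: s) = f (x :: s).
  apply: vf; rewrite /= ?sumh ?size_nseq // c0.
  by case: (h) hx => [|y h'] /= yx; rewrite ?take0 /=; lia.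
rewrite /= (bigD1 ord_max) //= subnn hsum0 ?size_nseq // big1 ?addr0 // => l.
rewrite -val_eqE /= => lx; rewrite hsum_count0 ?size_nseq //.
by case: eqP => // lx0; have := ltn_ord l; move/eqP: lx; lia.
Qed.

(* The leading coefficient of f in the head variable vanishes for the heights
   obtained by shortening the last column that is high enough. *)
Theorem vanish_pspan h f : sorted geq h -> vanish h f -> pspan h f.
Proof.
move defn : (sumn h) => n; elim: n h f defn => [|n IHn] h f sumh sh vf.
  exact: pspan_nil.
(* Second induction, on a strict bound for the exponent of the head variable. *)
suff main i g : vanish h g -> (forall x s, size s = n -> (i <= x)%N -> g (x :: s) = 0) ->
    pspan h g.
  by apply: (main (head 0%N h)) => // x s ss hx; apply: (vanish_head vf); rewrite ?sumh ?ss.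
elim: i g => [|i IHi] g vg gi.
  by apply: pspan_zero => -[|x s]; rewrite sumh // => -[ss]; apply: gi.
have [hi|ih] := leqP (head 0%N h) i.
  apply: IHi => // x s ss; rewrite leq_eqVlt => /orP [/eqP <-|]; last exact: gi.
  by apply: (vanish_head vg); rewrite ?sumh ?ss.
have [h1 [m [h2 [hE im ah2]]]] := sorted_geq_split sh ih.
pose h' := h1 ++ m :: h2.
have sumh' : sumn h' = n by move: sumh; rewrite hE /h' !sumn_cat /=; lia.
have sh' : sorted geq h'.
  have am : all (geq m) h2 by apply: sub_all ah2 => z /= ?; lia.
  move: sh; rewrite hE /h'; case: (h1) => [|y h1'] /=.
    by move/path_sorted; case: (h2) am => //= z h2' /andP [-> _].
  rewrite !cat_path /= => /and3P [-> lt ph]; apply/and3P; split=> //; first by lia.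
  by move/path_sorted: ph; case: (h2) am => //= z h2' /andP [-> _].
have takeh c : (c <= size h1)%N -> take c h' = take c h.
  by rewrite hE /h' !take_cat; case: ltngtP => // -> _; rewrite subnn !take0.
have takeh2 c : (size h1 < c)%N -> sumn (take c h) = (sumn (take c h')).+1.
  move=> lt; rewrite hE /h' !take_cat !ifN -?leqNgt 1?ltnW //.
  by have -> : (c - size h1 = (c - size h1).-1.+1)%N; [lia|rewrite !sumn_cat /=; lia].
have takeS c : (size h1 < c)%N -> (sumn (take c.+1 h) <= sumn (take c h) + i)%N.
  move=> lt; rewrite hE !take_cat !ifN -?leqNgt; try lia.
  have [d ->] : exists d, c = (size h1 + d.+1)%N by exists (c - size h1).-1; lia.
  rewrite -addnS !addKn !sumn_cat /= -!addnA !leq_add2l.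
  elim: (h2) (d) ah2 => [|z h2' IH] [|d'] //= /andP [zi ah].
    by rewrite take0 /= addn0 add0n.
  by have := IH d' ah; lia.
have vq : vanish h' (fun t => g (i :: t)).
  move=> C r s; rewrite sumh' => sC ss lt.
  have vF r' l : (sumn (take (count id C) h) < r' + count id C)%N ->
      hsum C r' (fun t => g (l :: t)) s = 0.
    by move=> lt'; have := vg (false :: C) r' (l :: s); rewrite /= sumh sC ss; apply.
  have [le|gt] := leqP (count id C) (size h1); first by apply: vF; rewrite -takeh.
  rewrite -hsum_head ?sC ?ss //.
  - apply: vg => /=; rewrite ?sumh ?sC ?ss // add1n.
    apply: leq_ltn_trans (takeS _ gt) _; rewrite takeh2 //; lia.
  - move=> l li; apply: vF; rewrite takeh2 //; lia.
have pq := IHn _ _ sumh' sh' vq.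
have [k [pk vk k1 k2]] := pspan_extend (eq_ind _ (sorted geq) sh _ hE) im pq.
rewrite -hE sumh' in pk vk k1 k2.
(* Subtracting the lift of the leading coefficient lowers the bound on the head exponent. *)
have pd : pspan h (fun s => g s + (-1) * k s).
  apply: IHi; first by apply: vanishD => //; apply: vanishZ.
  move=> x s ss; rewrite leq_eqVlt => /orP [/eqP <-|ix].
    by rewrite k1 // mulN1r subrr.
  by rewrite gi // k2 // mulr0 addr0.
by apply: pspan_ext (pspanD pd pk) => s _; rewrite mulN1r subrK.
Qed.

Definition col_heights k n := rcons (nseq (n %/ k.+1)%N k.+1) (n %% k.+1)%N.

Lemma sumn_col_heights k n : sumn (col_heights k n) = n.
Proof. by rewrite /col_heights sumn_rcons sumn_nseq mulnC -divn_eq. Qed.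

Lemma col_heights_sorted k n : sorted geq (col_heights k n).
Proof.
rewrite /col_heights; have := ltn_pmod n (ltn0Sn k).
elim: (n %/ k.+1)%N => //= q IH lt; case: q IH => [|q] /= IH; first by rewrite ltnW.
by rewrite leqnn IH.
Qed.

(** While |C| is at most the number of full columns, the bound asks for r > k |C| and [hsum_bounded]
    applies. Beyond, all boxes are counted, the bound asks for r > n - |C|, and [hsum_descend]
    applies. *)
Lemma harmonic_vanish k n f :
  (forall r s, size s = n -> hsum (nseq n true) r.+1 f s = 0) ->
  (forall s, size s = n -> has (ltn k) s -> f s = 0) -> vanish (col_heights k n) f.
Proof.
move=> full fk C r s; rewrite sumn_col_heights => sC ss lt.
have [c0|c0] := posnP (count id C).
  by rewrite hsum_count0 ?sC ?ss //; move: lt; rewrite c0 take0 /=; case: r.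
have [le|gt] := leqP (count id C) (n %/ k.+1)%N; last first.
  apply: (hsum_descend full) => //; move: lt; rewrite take_oversize ?sumn_col_heights //.
  by rewrite size_rcons size_nseq.
apply: (@hsum_bounded k); rewrite ?sC ?ss //.
move: lt; rewrite /col_heights -cats1 takel_cat ?size_nseq //.
rewrite take_nseq // sumn_nseq; lia.
Qed.

End Shifts.

Local Notation "1" := (@mone _) : monom_scope.
Local Notation "x * y" := (mmul x y) : monom_scope.

(* Locked: conversion would otherwise unfold monomials down to finite maps. *)
HB.lock Definition mmon (I : choiceType) (K : comNzRingType) (m : {cmonom I}) :
  {malg K[{cmonom I}]} := << m >>.

HB.lock Definition mcoef (I : choiceType) (K : comNzRingType) (m : {cmonom I})
  (P : {malg K[{cmonom I}]}) : K := P@_m.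

HB.lock Definition cmul (I : choiceType) (m1 m2 : {cmonom I}) : {cmonom I} := (m1 * m2)%M.
HB.lock Definition cone (I : choiceType) : {cmonom I} := 1%M.
HB.lock Definition cvar (I : choiceType) (i : I) : {cmonom I} := ucm i.
HB.lock Definition cdiv (I : choiceType) (m : {cmonom I}) (i : I) : {cmonom I} :=
  divcm m (ucm i).

Arguments mmon {I K} m.
Arguments cone {I}.

(** * Monomials through the locked operations, and the abstract polynomial algebra *)

Section Monomials.
Variable I : choiceType.
Implicit Types (m : {cmonom I}) (i j : I).

Lemma cmulE m1 m2 i : cmul m1 m2 i = (m1 i + m2 i)%N.
Proof. by rewrite cmul.unlock cmM. Qed.

Lemma coneE i : (cone : {cmonom I}) i = 0%N.
Proof. by rewrite cone.unlock cm1. Qed.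

Lemma cvarE i j : cvar i j = (i == j) :> nat.
Proof. by rewrite cvar.unlock cmU. Qed.

Lemma cdivE m i j : cdiv m i j = (m j - (i == j))%N.
Proof. by rewrite cdiv.unlock divcmE cmU. Qed.

Definition cmonomE := (cmulE, coneE, cvarE, cdivE).

Lemma cmonomP m1 m2 : (forall i, m1 i = m2 i) -> m1 = m2.
Proof. by move=> h; apply/eqP/cmP. Qed.

Lemma cdivK i m : cdiv (cmul (cvar i) m) i = m.
Proof. by apply: cmonomP => j; rewrite !cmonomE addKn. Qed.

Lemma cvarM_div i m : (0 < m i)%N -> cmul (cvar i) (cdiv m i) = m.
Proof.
move=> mi; apply: cmonomP => j; rewrite !cmonomE.
by case: (eqVneq i j) => [<-|_]; lia.
Qed.

Lemma cmul_inj m : injective (cmul m).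
Proof.
move=> m1 m2 h; apply: cmonomP => i; apply: (@addnI (m i)).
by rewrite -!cmulE h.
Qed.

Lemma mdeg_cone : mdeg (cone : {cmonom I}) = 0%N.
Proof. by rewrite cone.unlock mdeg1. Qed.

Lemma mdeg_cvar i : mdeg (cvar i) = 1%N.
Proof. by rewrite cvar.unlock mdegU. Qed.

Lemma mdeg_cmul m1 m2 : mdeg (cmul m1 m2) = (mdeg m1 + mdeg m2)%N.
Proof. by rewrite cmul.unlock mdegM. Qed.

Lemma mdeg_eq0_cone m : mdeg m = 0%N -> m = cone.
Proof. by rewrite cone.unlock; exact: mdeg_eq0I. Qed.

Lemma cmonom_split m : m != cone -> exists i m', m = cmul (cvar i) m'.
Proof.
rewrite cone.unlock -mdeg_eq0 => m1; have [i im] : exists i, i \in finsupp m.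
  have [f0|[i im]] := fset_0Vmem (finsupp m); last by exists i.
  by rewrite mdegE f0 big_seq_fset0 eqxx in m1.
by exists i, (cdiv m i); rewrite cvarM_div // lt0n cmE_neq0.
Qed.

Lemma cmonom_ind (T : {cmonom I} -> Prop) :
  T cone -> (forall i m, T m -> T (cmul (cvar i) m)) -> forall m, T m.
Proof.
move=> T1 TM m; have [n] := ubnP (mdeg m); elim: n m => // n IH m.
have [->//|/cmonom_split [i [m' ->]]] := eqVneq m cone.
by rewrite mdeg_cmul mdeg_cvar => lt; apply/TM/IH.
Qed.

End Monomials.

Section MonomialEvaluation.
Variables (I : choiceType) (S : comNzRingType) (g : I -> S).

Definition mon_eval (m : {cmonom I}) : S := \prod_(x <- finsupp m) g x ^+ m x.

Lemma mon_evalEw (m : {cmonom I}) (d : {fset I}) : (finsupp m `<=` d)%fset ->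
  mon_eval m = \prod_(x <- d) g x ^+ m x.
Proof.
move=> le; rewrite /mon_eval (big_fset_incl _ le) //= => x _ nx.
by rewrite fsfun_dflt.
Qed.

Fact mon_eval_morphism : mmorphism mon_eval.
Proof.
split=> [m1 m2|]; last by rewrite /mon_eval mdom1 big_seq_fset0.
have le1 : (finsupp m1 `<=` finsupp (m1 * m2)%M)%fset by rewrite mdomD fsubsetUl.
have le2 : (finsupp m2 `<=` finsupp (m1 * m2)%M)%fset by rewrite mdomD fsubsetUr.
rewrite (mon_evalEw le1) (mon_evalEw le2) -big_split /=.
by apply: eq_bigr => x _; rewrite cmM exprD.
Qed.

Lemma mon_eval_one : mon_eval cone = 1.
Proof. by rewrite cone.unlock; case: mon_eval_morphism. Qed.

Lemma mon_eval_mul m1 m2 : mon_eval (cmul m1 m2) = mon_eval m1 * mon_eval m2.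
Proof. by rewrite cmul.unlock; case: mon_eval_morphism. Qed.

Lemma mon_eval_var i : mon_eval (cvar i) = g i.
Proof. by rewrite cvar.unlock /mon_eval mdomU big_seq_fset1 cmUU expr1. Qed.

End MonomialEvaluation.

(* An abstract presentation of {malg K[{cmonom I}]}: failing conversion problems
   on the concrete type do not terminate in practice. *)
Record polyAlg (I : choiceType) (K : comNzRingType) := PolyAlg {
  polyAlg_sort :> comAlgType K;
  mon : {cmonom I} -> polyAlg_sort;
  coef : {cmonom I} -> polyAlg_sort -> K;
  supp : polyAlg_sort -> seq {cmonom I};
  mon_one : mon cone = 1;
  mon_mul m1 m2 : mon (cmul m1 m2) = mon m1 * mon m2;
  coef_linear m c P Q : coef m (c *: P + Q) = c * coef m P + coef m Q;
  coef_mon m m' : coef m (mon m') = (m' == m)%:R;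
  supp_uniq P : uniq (supp P);
  supp_mem m P : (m \in supp P) = (coef m P != 0);
  supp_sum P : P = \sum_(m <- supp P) coef m P *: mon m
}.

Arguments mon {I K p} m.
Arguments coef {I K p} m P.
Arguments supp {I K p} P.

(** Transparent, so that on this instance the abstract operations compute to the concrete ones. *)
Definition malg_polyAlg (I : choiceType) (K : comNzRingType) : polyAlg I K.
Proof.
refine (@PolyAlg I K {malg K[{cmonom I}]} (@mmon I K) (@mcoef I K) (fun P => msupp P)
  _ _ _ _ _ _ _).
- by rewrite mmon.unlock cone.unlock; reflexivity.
- by move=> m1 m2; rewrite cmul.unlock mmon.unlock malgM_def fgmulUU mulr1.
- by move=> m c P Q; rewrite mcoef.unlock mcoeffD mcoeffZ.
- by move=> m m'; rewrite mcoef.unlock mmon.unlock; exact: mcoeffU1.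
- by move=> P; exact: fset_uniq.
- by move=> m P; rewrite mcoef.unlock mcoeff_neq0.
- move=> P; rewrite {1}[P]monalgE; apply: eq_bigr => m _; rewrite mcoef.unlock mmon.unlock.
  by rewrite -mul_malgC malgM_def fgmulUU mulr1 mul1m.
Defined.

(** * Polynomials in abstract form *)

Section PolynomialAlgebra.
Variables (I : choiceType) (K : comNzRingType) (V : polyAlg I K).
Local Notation Xv i := (mon (cvar i)).
Implicit Types (P Q : V) (m : {cmonom I}) (v : I).

Lemma coefm0 m : coef m (0 : V) = 0.
Proof. by have := coef_linear m (-1) (0 : V) 0; rewrite scaleN1r oppr0 addr0 mulN1r addNr. Qed.

Lemma coefmD m P Q : coef m (P + Q) = coef m P + coef m Q.
Proof. by rewrite -[P]scale1r coef_linear scale1r mul1r. Qed.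

Lemma coefmZ m c P : coef m (c *: P) = c * coef m P.
Proof. by rewrite -[c *: P]addr0 coef_linear coefm0 addr0. Qed.

Lemma coefm_sum m (J : Type) (r : seq J) (p : pred J) (F : J -> V) :
  coef m (\sum_(j <- r | p j) F j) = \sum_(j <- r | p j) coef m (F j).
Proof. by elim/big_rec2: _ => [|j x y _ <-]; rewrite ?coefm0 ?coefmD. Qed.

Lemma coefm_ext P Q : (forall m, coef m P = coef m Q) -> P = Q.
Proof.
move=> h; rewrite (supp_sum P) (supp_sum Q).
rewrite (perm_big (supp Q)); first by apply: eq_bigr => m _; rewrite h.
by apply: uniq_perm; rewrite ?supp_uniq // => m; rewrite !supp_mem h.
Qed.

Lemma malg_lin_ind (T : V -> Prop) : T 0 ->
  (forall c m P, T P -> T (c *: mon m + P)) -> forall P, T P.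
Proof.
move=> T0 TL P; rewrite (supp_sum P).
elim: (supp P) => [|m s IH]; first by rewrite big_nil.
by rewrite big_cons; apply: TL.
Qed.

Lemma malg_ind (T : V -> Prop) : T 1 -> (forall i P, T P -> T (Xv i * P)) ->
  (forall c P Q, T P -> T Q -> T (c *: P + Q)) -> forall P, T P.
Proof.
move=> T1 TX TL P.
have T0 : T 0 by have := TL (-1) _ _ T1 T1; rewrite scaleN1r addNr.
have TU m : T (mon m).
  elim/cmonom_ind: m => [|i m Tm]; first by rewrite mon_one.
  by rewrite mon_mul; apply: TX.
by apply: (malg_lin_ind T0) => c m Q TQ; apply: TL.
Qed.

Section Support.
Variable T : {cmonom I} -> Prop.

(** Homogeneity, order bounds and [graded_low] all are conditions on the monomials that occur, so
    they share the closure lemmas of this section. *)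
Definition supported P := forall m, coef m P != 0 -> T m.

Lemma supported_linear c P Q : supported P -> supported Q -> supported (c *: P + Q).
Proof.
move=> hP hQ m; rewrite coefmD coefmZ; have [->|/hP//] := eqVneq (coef m P) 0.
by rewrite mulr0 add0r => /hQ.
Qed.

Lemma supported_mon m : T m -> supported (mon m : V).
Proof. by move=> Tm m'; rewrite coef_mon; case: (m =P m') => [<-//|_]; rewrite eqxx. Qed.

Lemma supported0 : supported 0.
Proof. by move=> m; rewrite coefm0 eqxx. Qed.

Lemma supportedZ c P : supported P -> supported (c *: P).
Proof. by move=> hP; rewrite -[c *: P]addr0; apply: supported_linear => //; exact: supported0. Qed.

Lemma supportedD P Q : supported P -> supported Q -> supported (P + Q).
Proof. by move=> hP hQ; rewrite -[P]scale1r; apply: supported_linear. Qed.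

Lemma supported_sum (J : Type) (r : seq J) (p : pred J) (F : J -> V) :
  (forall j, p j -> supported (F j)) -> supported (\sum_(j <- r | p j) F j).
Proof.
move=> h; apply: big_rec => [|j x pj hx]; first exact: supported0.
by apply: supportedD => //; apply: h.
Qed.

End Support.

Lemma coefmM m P Q : coef m (P * Q) != 0 ->
  exists m1 m2, [/\ coef m1 P != 0, coef m2 Q != 0 & m = cmul m1 m2].
Proof.
rewrite {1}(supp_sum P) {1}(supp_sum Q) mulr_suml coefm_sum => h.
apply: contrapT => hn; case/eqP: h; rewrite big_seq big1 // => m1 sm1.
rewrite mulr_sumr coefm_sum big_seq big1 // => m2 sm2.
rewrite -scalerAl -scalerAr !coefmZ -mon_mul coef_mon.
case: (cmul m1 m2 =P m) => [e|_]; last by rewrite !mulr0.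
by case: hn; exists m1, m2; rewrite -!supp_mem.
Qed.

Lemma supportedM (T1 T2 T3 : {cmonom I} -> Prop) P Q :
  (forall m1 m2, T1 m1 -> T2 m2 -> T3 (cmul m1 m2)) ->
  supported T1 P -> supported T2 Q -> supported T3 (P * Q).
Proof.
by move=> h hP hQ m /coefmM [m1 [m2 [/hP ? /hQ ? ->]]]; apply: h.
Qed.

Lemma coefmXM i m P : coef (cmul (cvar i) m) (Xv i * P) = coef m P.
Proof.
elim/malg_lin_ind: P => [|c m' P IH]; first by rewrite mulr0 !coefm0.
rewrite mulrDr !coefmD IH -scalerAr !coefmZ -mon_mul !coef_mon.
by rewrite (inj_eq (@cmul_inj _ _)).
Qed.

Definition der v P : V := \sum_(m <- supp P) coef m P *: ((m v)%:R *: mon (cdiv m v)).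

Lemma coef_der v m P : coef m (der v P) = (m v).+1%:R * coef (cmul (cvar v) m) P.
Proof.
set m' := cmul _ _; have m'v : m' v = (m v).+1 by rewrite cmulE cvarE eqxx.
have E u : coef m (coef u P *: ((u v)%:R *: mon (cdiv u v)) : V) =
    if u == m' then (m v).+1%:R * coef m' P else 0.
  rewrite !coefmZ coef_mon; have [->|ne] := eqVneq u m'.
    by rewrite cdivK eqxx mulr1 m'v mulrC.
  have [uv|uv] := posnP (u v); first by rewrite uv mul0r mulr0.
  case: (cdiv u v =P m) => [e|_]; last by rewrite !mulr0.
  by case/eqP: ne; rewrite /m' -e cvarM_div.
rewrite /der coefm_sum (eq_bigr _ (fun u _ => E u)) -big_mkcond /=.
have [ms|nms] := boolP (m' \in supp P).
  by rewrite (big_rem _ ms) /= eqxx big1_seq ?addr0 // => u /andP [/eqP ->];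
     rewrite mem_rem_uniq ?supp_uniq // !inE eqxx.
rewrite big1_seq => [|u /andP [/eqP -> h]]; last by rewrite h in nms.
by move: nms; rewrite supp_mem negbK => /eqP ->; rewrite mulr0.
Qed.

Lemma der_linear v c P Q : der v (c *: P + Q) = c *: der v P + der v Q.
Proof. by apply: coefm_ext => m; rewrite !(coef_linear, coef_der) mulrDr mulrCA. Qed.

Lemma derD v P Q : der v (P + Q) = der v P + der v Q.
Proof. by apply: coefm_ext => m; rewrite !(coefmD, coef_der) mulrDr. Qed.

Lemma der0 v : der v (0 : V) = 0.
Proof. by apply: coefm_ext => m; rewrite coef_der !coefm0 mulr0. Qed.

Lemma derZ v c P : der v (c *: P) = c *: der v P.
Proof. by apply: coefm_ext => m; rewrite !(coefmZ, coef_der) mulrCA. Qed.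

Lemma der_mon v m : der v (mon m : V) = (m v)%:R *: mon (cdiv m v).
Proof.
apply: coefm_ext => u; rewrite coef_der coefmZ !coef_mon.
have [e|ne] := eqVneq m (cmul (cvar v) u).
  by rewrite e cdivK eqxx cmulE cvarE eqxx.
have [mv|mv] := posnP (m v); first by rewrite mv mul0r mulr0.
case: (cdiv m v =P u) => [e|_]; last by rewrite !mulr0.
by case/eqP: ne; rewrite -e cvarM_div.
Qed.

Lemma der1 v : der v (1 : V) = 0.
Proof. by rewrite -mon_one der_mon coneE scale0r. Qed.

Lemma derXM v i P : der v (Xv i * P) = (i == v)%:R *: P + Xv i * der v P.
Proof.
have DU m : der v (Xv i * mon m : V) = (i == v)%:R *: mon m + Xv i * der v (mon m).
  rewrite -mon_mul !der_mon -scalerAr -mon_mul cmulE cvarE.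
  have [->|niv] := eqVneq i v.
    rewrite cdivK; have [mv|mv] := posnP (m v); first by rewrite mv scale0r addr0.
    by rewrite cvarM_div // -scalerDl -natrD.
  rewrite scale0r add0r add0n; have [mv|mv] := posnP (m v); first by rewrite mv !scale0r.
  congr (_ *: mon _); apply: cmonomP => j; rewrite !cmonomE.
  by case: (eqVneq v j) => [<-|]; rewrite ?(negbTE niv); lia.
elim/malg_lin_ind: P => [|c m P IH].
  by rewrite mulr0 der0 scaler0 mulr0 addr0.
rewrite mulrDr !derD mulrDr IH -scalerAr !derZ DU !scalerDr -scalerAr.
by rewrite !scalerA mulrC addrACA.
Qed.

Lemma der_sum v (J : Type) (r : seq J) (p : pred J) (F : J -> V) :
  der v (\sum_(j <- r | p j) F j) = \sum_(j <- r | p j) der v (F j).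
Proof. by elim/big_rec2: _ => [|j x y _ <-]; rewrite ?der0 ?derD. Qed.

Section Evaluation.
Variables (S : comAlgType K) (g : I -> S).

Definition aev P : S := \sum_(m <- supp P) coef m P *: mon_eval g m.

Lemma aevEw (s : seq {cmonom I}) P : uniq s -> {subset supp P <= s} ->
  aev P = \sum_(m <- s) coef m P *: mon_eval g m.
Proof.
move=> us sub; rewrite /aev [RHS](bigID (mem (supp P))) /= [X in _ + X]big1 ?addr0.
  rewrite -[RHS]big_filter; apply: perm_big; apply: uniq_perm; rewrite ?filter_uniq ?supp_uniq //.
  by move=> m; rewrite mem_filter; case: (boolP (m \in supp P)) => // /sub ->.
by move=> m; rewrite supp_mem negbK => /eqP ->; rewrite scale0r.
Qed.

Lemma aev_linear c P Q : aev (c *: P + Q) = c *: aev P + aev Q.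
Proof.
(* A common list of monomials on which the three evaluations compare termwise. *)
pose s := undup (supp P ++ supp Q ++ supp (c *: P + Q)).
have us : uniq s by rewrite undup_uniq.
have sub Q' : Q' \in [:: P; Q; c *: P + Q] -> {subset supp Q' <= s}.
  rewrite !inE => /or3P [] /eqP -> m mQ; rewrite mem_undup !mem_cat mQ ?orbT //.
rewrite !(aevEw us); try by apply: sub; rewrite !inE eqxx ?orbT.
rewrite scaler_sumr -big_split /=; apply: eq_bigr => m _.
by rewrite coef_linear scalerDl scalerA.
Qed.

Lemma aev_mon m : aev (mon m) = mon_eval g m.
Proof.
have sm : {subset supp (mon m : V) <= [:: m]}.
  move=> u; rewrite supp_mem coef_mon inE (eq_sym u).
  by case: (m =P u) => // _; rewrite eqxx.
by rewrite (aevEw _ sm) // big_seq1 coef_mon eqxx scale1r.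
Qed.

Lemma aev0 : aev 0 = 0.
Proof. by have := aev_linear (-1) 0 0; rewrite !scaleN1r oppr0 addr0 addNr. Qed.

Lemma aevB : {morph aev : P Q / P - Q}.
Proof.
by move=> P Q; rewrite addrC -scaleN1r aev_linear scaleN1r addrC.
Qed.

Lemma aevZ c P : aev (c *: P) = c *: aev P.
Proof. by rewrite -[c *: P]addr0 aev_linear aev0 addr0. Qed.

Lemma aevD : {morph aev : P Q / P + Q}.
Proof. by move=> P Q; rewrite -[P]scale1r aev_linear !scale1r. Qed.

Lemma aevX i : aev (Xv i) = g i.
Proof. by rewrite aev_mon mon_eval_var. Qed.

Lemma aevXM i P : aev (Xv i * P) = g i * aev P.
Proof.
elim/malg_lin_ind: P => [|c m P IH]; first by rewrite mulr0 aev0 mulr0.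
rewrite mulrDr aevD IH -scalerAr aevZ -mon_mul !aev_mon mon_eval_mul mon_eval_var.
by rewrite aev_linear aev_mon mulrDr scalerAr.
Qed.

Lemma aev_multiplicative : multiplicative aev.
Proof.
split=> [P Q|]; last by rewrite -mon_one aev_mon mon_eval_one.
elim/malg_ind: P => [|i P IH|c P P' IH IH'].
- by rewrite mul1r -mon_one aev_mon mon_eval_one mul1r.
- by rewrite -mulrA !aevXM IH mulrA.
- by rewrite mulrDl -scalerAl !aev_linear IH IH' mulrDl scalerAl.
Qed.

HB.instance Definition _ := GRing.isAdditive.Build V S aev aevB.
HB.instance Definition _ := GRing.isMultiplicative.Build V S aev aev_multiplicative.

End Evaluation.

End PolynomialAlgebra.

(** * The determinants W and the group action *)

Section Columns.
Variables (K : numFieldType) (N : nat).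
Local Notation Var := ('I_N.+1 * nat)%type.
Variable V : polyAlg Var K.
Implicit Types (P Q : V) (m : {cmonom Var}) (i : 'I_N.+1) (cs : seq Var).

Definition dX i (j : nat) : V := mon (cvar (i, j)).

Definition dcolumn i (a j : nat) : V := if (a <= j)%N then dX i (j - a) *+ j ^_ a else 0.

Definition Wcols cs : V :=
  \det (\matrix_(j < size cs, l < size cs)
    dcolumn (nth (ord0, 0%N) cs l).1 (nth (ord0, 0%N) cs l).2 j).

Definition dact_var (a : nat -> K) (x : Var) : V :=
  \sum_(j < x.2.+1) ('C(x.2, j)%:R * (a (x.2 - j)%N *+ (x.2 - j)`!)) *: dX x.1 j.

Definition dact (a : nat -> K) : V -> V := aev (dact_var a).

Lemma dact_X a i j : dact a (dX i j) = dact_var a (i, j).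
Proof. exact: aevX. Qed.

Lemma dactZ a c P : dact a (c *: P) = c *: dact a P.
Proof. exact: aevZ. Qed.

Lemma dactD a P Q : dact a (P + Q) = dact a P + dact a Q.
Proof. exact: aevD. Qed.

Lemma dactM a P Q : dact a (P * Q) = dact a P * dact a Q.
Proof. exact: rmorphM. Qed.

Lemma dact1 a : dact a 1 = 1.
Proof. exact: rmorph1. Qed.

Lemma fact_neq0 (n : nat) : n`!%:R != 0 :> K.
Proof. by rewrite pnatr_eq0 -lt0n fact_gt0. Qed.

Lemma ffact_bin_ratio (j b l : nat) : (b <= j)%N -> (l <= j - b)%N ->
  (j ^_ b)%:R * ('C(j - b, l)%:R * (j - b - l)`!%:R) =
  j`!%:R / (l + b)`!%:R * ((l + b) ^_ b)%:R :> K.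
Proof.
move=> bj lj; apply: (mulIf (fact_neq0 l)).
rewrite -!natrM -[RHS]mulrA -[X in _ = _ * X]natrM.
have -> : (j ^_ b * ('C(j - b, l) * (j - b - l)`!) * l`! = j`!)%N.
  rewrite -(ffact_fact bj) -(bin_fact lj); ring.
have -> : ((l + b) ^_ b * l`! = (l + b)`!)%N by rewrite -(ffact_fact (leq_addl l b)) addnK.
by rewrite divfK // fact_neq0.
Qed.

(** Multiplication by the series [a] on the sequence X^(j) / j!, rescaled by factorials. Since J
    commutes with the action, the same matrix serves all letters and all exponents of columns. *)
Definition lower_mx (a : nat -> K) (j j' : nat) : K :=
  if (j' <= j)%N then j`!%:R / j'`!%:R * a (j - j')%N else 0.

Lemma dact_column a i b d j : (j < d)%N ->
  dact a (dcolumn i b j) = \sum_(j' < d) (lower_mx a j j')%:A * dcolumn i b j'.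
Proof.
move=> jd; rewrite /dcolumn; case: leqP => [bj|jb]; last first.
  rewrite /dact aev0 big1 // => j' _; rewrite /lower_mx.
  case: (leqP j' j) => [j'j|_]; last by rewrite scale0r mul0r.
  by rewrite ifN ?mulr0 // -ltnNge (leq_ltn_trans j'j).
rewrite -scaler_nat dactZ dact_X /dact_var /=.
pose G j' := (j`!%:R / j'`!%:R * a (j - j')%N) *: (dX i (j' - b) *+ j' ^_ b).
transitivity (\sum_(0 <= l < (j - b).+1) G (l + b)%N).
  rewrite big_mkord scaler_sumr; apply: eq_bigr => l _.
  rewrite /G addnK -[dX i l *+ _]scaler_nat !scalerA; congr (_ *: _).
  rewrite [RHS]mulrAC -ffact_bin_ratio //; last by rewrite -ltnS.
  by rewrite -[a _ *+ _]mulr_natr subnAC -subnDA addnC; ring.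
rewrite -subSn // -(big_addn 0 j.+1 b xpredT G) add0n big_geq_mkord.
rewrite (big_ord_widen_cond d (fun j : nat => b <= j)%N G) // big_mkcond /=.
apply: eq_bigr => j' _; rewrite /lower_mx ltnS.
case: (leqP b j') => bj'; last by rewrite mulr0.
by case: (leqP j' j) => j'j; rewrite ?scale0r ?mul0r // /G -scalerAl mul1r.
Qed.

(** The action multiplies the whole matrix on the left by one triangular matrix with diagonal
    entries a(0). *)
Lemma dact_Wcols a cs : dact a (Wcols cs) = a 0%N ^+ size cs *: Wcols cs.
Proof.
rewrite /Wcols /dact -det_map_mx.
set M := \matrix_(_, _) _.
have -> : map_mx (aev (dact_var a)) M =
    (\matrix_(j, j') (lower_mx a j j')%:A) *m M.
  by apply/matrixP => j l; rewrite !mxE -/(dact _ _) (dact_column _ _ _ (ltn_ord j));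
     apply: eq_bigr => j' _; rewrite !mxE.
rewrite det_mulmx det_trig; last first.
  by apply/is_trig_mxP => j l jl; rewrite mxE /lower_mx leqNgt jl scale0r.
rewrite -mulr_algl; congr (_ * _).
under eq_bigr do rewrite mxE /lower_mx leqnn subnn divff ?fact_neq0 // mul1r.
by rewrite prodr_const card_ord -[RHS]/(in_alg V _) rmorphXn.
Qed.

Definition ordlt (n : nat) m : Prop := forall x, (0 < m x)%N -> (x.2 < n)%N.

Definition low (n : nat) P := supported (ordlt n) P.

Lemma ordlt_cmul n m1 m2 : ordlt n m1 -> ordlt n m2 -> ordlt n (cmul m1 m2).
Proof. by move=> h1 h2 x; rewrite cmulE addn_gt0 => /orP [/h1|/h2]. Qed.

Lemma ordlt_cone n : ordlt n cone.
Proof. by move=> x; rewrite coneE. Qed.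

Lemma ordlt_cvar n x : (x.2 < n)%N -> ordlt n (cvar x).
Proof. by move=> h y; rewrite cvarE; case: eqP => // <-. Qed.

Lemma lowM n P Q : low n P -> low n Q -> low n (P * Q).
Proof. by move=> hP hQ; apply: (supportedM _ hP hQ) => m1 m2; apply: ordlt_cmul. Qed.

Lemma low1 n : low n 1.
Proof. by rewrite -mon_one; apply: supported_mon; apply: ordlt_cone. Qed.

Lemma low_dX n i j : (j < n)%N -> low n (dX i j).
Proof. by move=> h; apply: supported_mon; apply: ordlt_cvar. Qed.

Lemma ordltW n n' m : (n <= n')%N -> ordlt n m -> ordlt n' m.
Proof. by move=> le h x /h lt; apply: leq_trans le. Qed.

Lemma lowW n n' P : (n <= n')%N -> low n P -> low n' P.
Proof. by move=> le h m /h; apply: ordltW. Qed.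

Definition homdeg (d : nat) P := supported (fun m => mdeg m = d) P.

Lemma hom1 : homdeg 0 1.
Proof. by rewrite -mon_one; apply: supported_mon; apply: mdeg_cone. Qed.

Lemma homM d e P Q : homdeg d P -> homdeg e Q -> homdeg (d + e) (P * Q).
Proof.
by move=> hP hQ; apply: (supportedM _ hP hQ) => m1 m2 <- <-; apply: mdeg_cmul.
Qed.

Lemma hom_dX i j : homdeg 1 (dX i j).
Proof. by apply: supported_mon; apply: mdeg_cvar. Qed.

Lemma hom_prod (J : Type) (r : seq J) (F : J -> V) : (forall j, homdeg 1 (F j)) ->
  homdeg (size r) (\prod_(j <- r) F j).
Proof.
move=> hF; elim: r => [|j r IH]; first by rewrite big_nil; apply: hom1.
by rewrite big_cons; apply: (@homM 1).
Qed.

Lemma dcolumn_hom i a j : homdeg 1 (dcolumn i a j).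
Proof.
rewrite /dcolumn; case: ifP => _; last exact: supported0.
by rewrite -scaler_nat; apply: supportedZ; apply: hom_dX.
Qed.

Lemma dcolumn_low i a j n : (j < n)%N -> low n (dcolumn i a j).
Proof.
move=> jn; rewrite /dcolumn; case: ifP => _; last exact: supported0.
by rewrite -scaler_nat; apply: supportedZ; apply: low_dX; lia.
Qed.

Lemma hom_det d (M : 'M[V]_d) : (forall j l, homdeg 1 (M j l)) -> homdeg d (\det M).
Proof.
move=> hM; rewrite /determinant; apply: supported_sum => s _.
have h : homdeg d (\prod_j M j (s j)).
  by rewrite -[X in homdeg X](size_enum_ord d) enumT; apply: hom_prod.
by rewrite -signr_odd mulr_sign; case: ifP => _ //; rewrite -scaleN1r; apply: supportedZ.
Qed.

Lemma Wcols_hom cs : homdeg (size cs) (Wcols cs).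
Proof. by apply: hom_det => j l; rewrite mxE; apply: dcolumn_hom. Qed.

Lemma low_prod n (J : Type) (r : seq J) (F : J -> V) : (forall j, low n (F j)) ->
  low n (\prod_(j <- r) F j).
Proof.
move=> hF; elim: r => [|j r IH]; first by rewrite big_nil; apply: low1.
by rewrite big_cons; apply: lowM.
Qed.

Lemma low_det n d (M : 'M[V]_d) : (forall j l, low n (M j l)) -> low n (\det M).
Proof.
move=> hM; rewrite /determinant; apply: supported_sum => s _.
rewrite -signr_odd mulr_sign; case: ifP => _; last exact: low_prod.
by rewrite -scaleN1r; apply: supportedZ; apply: low_prod.
Qed.

Lemma Wcols_low cs : low (size cs) (Wcols cs).
Proof. by apply: low_det => j l; rewrite mxE; apply: dcolumn_low. Qed.

End Columns.

(** * Polarization *)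

Section Leibniz.
Variables (I : choiceType) (K : comNzRingType) (V : polyAlg I K).

Lemma derM v (P Q : V) : der v (P * Q) = der v P * Q + P * der v Q.
Proof.
elim/malg_ind: P => [|i P IH|c P P' IH IH'].
- by rewrite !mul1r der1 mul0r add0r.
- by rewrite -mulrA !derXM IH mulrDl mulrDr -scalerAl !mulrA addrA.
- by rewrite mulrDl -scalerAl !der_linear IH IH' !mulrDl -!scalerAl scalerDr addrACA.
Qed.

Lemma supported_der0 v (P : V) : supported (fun m => m v = 0%N) P -> der v P = 0.
Proof.
move=> h; apply: coefm_ext => m; rewrite coef_der coefm0.
have [->|/h] := eqVneq (coef (cmul (cvar v) m) P) 0; first by rewrite mulr0.
by rewrite cmulE cvarE eqxx.
Qed.

End Leibniz.

Lemma poly_nat_roots (K : numFieldType) (p : {poly K}) :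
  (forall n : nat, p.[n%:R] = 0) -> p = 0.
Proof.
move=> h; apply/eqP; apply: contraT => p0.
have := max_poly_roots (rs := [seq n%:R | n <- iota 0 (size p)]) p0.
rewrite size_map size_iota ltnn => -> //.
  by apply/allP => x /mapP [n _ ->]; apply/rootP.
by rewrite map_inj_uniq ?iota_uniq //; exact: mulrIn (oner_neq0 K).
Qed.

Section ShiftPolynomial.
Variables (K : numFieldType) (n : nat).

(** The generating polynomial of the complete homogeneous polynomials in all the shifts. Cutting the
    shifts at [n] keeps it a polynomial, harmlessly when [f] vanishes on lists with an entry at
    least [n]. *)
Fixpoint hpoly (d : nat) (f : seq nat -> K) (s : seq nat) : {poly K} :=
  match d, s with
  | d'.+1, x :: s' =>
      \sum_(l < n) 'X^l * hpoly d' (fun t => f ((x + l)%N :: t)) s'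
  | _, _ => (f s)%:P
  end.

Lemma coef_hpoly d f s r : size s = d ->
  (forall t, size t = size s -> has (leq n) t -> f t = 0) ->
  (hpoly d f s)`_r = hsum (nseq d true) r f s.
Proof.
elim: d f s r => [|d IH] f [|x s] r //=; first by rewrite coefC.
move=> [ss] f0; rewrite coef_sum.
pose G (l : nat) := hsum (nseq d true) (r - l) (fun t => f ((x + l)%N :: t)) s.
have G0 l : (n <= l)%N -> G l = 0.
  move=> nl; apply: hsum_eq0; rewrite ?size_nseq ?ss // => t st; apply: f0.
    by rewrite /= st ss.
  by rewrite /= (leq_trans nl) ?leq_addl.
rewrite -/(\sum_(l < r.+1) G l).
have E (l : 'I_n) : ('X^l * hpoly d (fun t => f ((x + l)%N :: t)) s)`_r
    = if (r < l)%N then 0 else G l.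
  rewrite coefXnM IH // => t st ht; apply: f0; rewrite /= ?st //.
  by rewrite ht orbT.
rewrite (eq_bigr _ (fun l _ => E l)).
transitivity (\sum_(l < maxn n r.+1 | (l < n)%N) if (r < l)%N then 0 else G l).
  by rewrite (big_ord_widen _ (fun l => if (r < l)%N then 0 else G l) (leq_maxl n r.+1)).
rewrite (big_ord_widen _ G (leq_maxr n r.+1)).
rewrite big_mkcond [RHS]big_mkcond; apply: eq_bigr => l _.
rewrite ltnS; case: (ltnP l n) => ln; case: (leqP l r) => // lr.
by rewrite G0.
Qed.

End ShiftPolynomial.

Section Polarization.
Variables (K : numFieldType) (N : nat).
Local Notation Var := ('I_N.+1 * nat)%type.
Variable V : polyAlg Var K.
Implicit Types (P Q : V) (m : {cmonom Var}) (i : 'I_N.+1) (w : seq 'I_N.+1).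

(* The derivation in the normalized variable X_i^(b) / b!, on which the group
   acts without binomial coefficients. *)
Definition derN i (b : nat) P : V := b`!%:R *: der (i, b) P.

Lemma derN_linear i b c P Q : derN i b (c *: P + Q) = c *: derN i b P + derN i b Q.
Proof. by rewrite /derN der_linear scalerDr !scalerA mulrC. Qed.

Lemma low_derN0 n i b P : low n P -> (n <= b)%N -> derN i b P = 0.
Proof.
move=> lP nb; rewrite /derN supported_der0 ?scaler0 // => m /lP h.
by apply/eqP; rewrite eqn0Ngt; apply/negP => /h /=; rewrite ltnNge nb.
Qed.

Lemma low_derN n i b P : low n P -> low n (derN i b P).
Proof.
move=> lP; apply: supportedZ => m; rewrite coef_der mulf_eq0 negb_or => /andP [_ /lP h] x mx.
by apply: h; rewrite cmulE ltn_addl.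
Qed.

(* The unit 1 / (1 - c T); varying c, the invariance under these units gives one
   equation for each complete homogeneous polynomial. *)
Definition geo (c : K) (s : nat) : K := c ^+ s.

Lemma derN_dact_var c i b i' (k : nat) : derN i b (dact_var V (geo c) (i', k)) =
  if (i == i') && (b <= k)%N then (k`!%:R * c ^+ (k - b))%:A else 0.
Proof.
rewrite /derN /dact_var der_sum /=.
have E (j : 'I_k.+1) : der (i, b) (('C(k, j)%:R * (geo c (k - j) *+ (k - j)`!)) *: dX V i' j)
    = if (i == i') && (j == b :> nat) then ('C(k, j)%:R * (geo c (k - j) *+ (k - j)`!))%:A else 0.
  rewrite derZ /dX -[mon _]mulr1 derXM der1 mulr0 addr0 xpair_eqE (eq_sym i').
  by case: (_ && _); rewrite ?scale1r // scale0r scaler0.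
rewrite (eq_bigr _ (fun j _ => E j)).
case: eqP => [_|_] /=; last by rewrite big1 ?scaler0.
case: leqP => [bk|kb]; last first.
  rewrite big1 ?scaler0 // => j _; case: eqP => // jb.
  by have := ltn_ord j; rewrite jb ltnS leqNgt kb.
have bk' : (b < k.+1)%N by [].
rewrite (bigD1 (Ordinal bk')) //= eqxx big1 ?addr0 => [|j]; last first.
  by rewrite -val_eqE /= => /negbTE ->.
rewrite !scalerA; congr (_ *: _); rewrite /geo -[_ *+ (k - b)`!]mulr_natl.
have <- : ('C(k, b) * (b`! * (k - b)`!) = k`!)%N := bin_fact bk.
by rewrite !natrM; ring.
Qed.

(** The chain rule: in normalized variables the substitution sends x_k to the sum of the c^(k-j)
    x_j. The sum over [l] is finite only for each given [P], hence a bound found by induction;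
    [derN_dact] then replaces it by the order. *)
Lemma derN_dact_ex c P : exists n0, forall n i b, (n0 <= n)%N ->
  derN i b (dact (geo c) P) = \sum_(l < n) c ^+ l *: dact (geo c) (derN i (b + l) P).
Proof.
elim/malg_ind: P => [|[i' k] P [n0 IH]|d P Q [n1 IH1] [n2 IH2]].
- exists 0%N => n i b _; rewrite dact1 /derN der1 scaler0 big1 // => l _.
  by rewrite der1 scaler0 /dact aev0 scaler0.
- exists (maxn n0 k.+1) => n i b; rewrite geq_max => /andP [n0n kn].
  rewrite dactM -/(dX V i' k) dact_X -/(dX V i' k) {1}/derN derM scalerDr scalerAl [X in _ + X]scalerAr.
  rewrite -![_ *: der (i, b) _]/(derN i b _) derN_dact_var (IH n) //.
  have E (l : 'I_n) : c ^+ l *: dact (geo c) (derN i (b + l) (mon (cvar (i', k)) * P)) =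
      (c ^+ l * (b + l)`!%:R * ((i', k) == (i, (b + l)%N))%:R) *: dact (geo c) P +
      dact_var V (geo c) (i', k) * (c ^+ l *: dact (geo c) (derN i (b + l) P)).
    rewrite /derN derXM scalerDr dactD !dactZ dactM -/(dX V i' k) dact_X scalerDr !scalerA.
    by rewrite -!scalerAr !mulrA.
  rewrite [RHS](eq_bigr _ (fun l _ => E l)) big_split /= -mulr_sumr; congr (_ + _).
  case: ifP => [/andP [/eqP <- bk]|h]; last first.
    rewrite mul0r big1 // => l _; rewrite xpair_eqE eq_sym.
    case: eqP => [e|_]; last by rewrite mulr0 scale0r.
    case: eqP => [e'|_]; last by rewrite mulr0 scale0r.
    by move: h; rewrite e eqxx e' leq_addr.
  have lt : (k - b < n)%N by rewrite (leq_ltn_trans (leq_subr _ _)).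
  rewrite (bigD1 (Ordinal lt)) //= subnKC // eqxx mulr1 big1 ?addr0.
    by rewrite -scalerAl mul1r mulrC.
  move=> l; rewrite -val_eqE /= xpair_eqE eqxx /= => nl.
  case: eqP => [e|_]; last by rewrite mulr0 scale0r.
  by case/eqP: nl; rewrite e addKn.
- exists (maxn n1 n2) => n i b; rewrite geq_max => /andP [n1n n2n].
  rewrite dactD dactZ derN_linear (IH1 n) // (IH2 n) // scaler_sumr -big_split /=.
  apply: eq_bigr => l _; rewrite derN_linear dactD dactZ scalerDr !scalerA.
  by rewrite mulrC.
Qed.

Lemma derN_dact c P n i b : low n P ->
  derN i b (dact (geo c) P) = \sum_(l < n) c ^+ l *: dact (geo c) (derN i (b + l) P).
Proof.
move=> lP; have [n0 h] := derN_dact_ex c P.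
rewrite (h (maxn n n0)) ?leq_maxr //.
rewrite (big_ord_widen _ (fun l => c ^+ l *: dact (geo c) (derN i (b + l) P)) (leq_maxl n n0)).
rewrite [RHS]big_mkcond; apply: eq_bigr => l _; case: ltnP => // nl.
by rewrite (low_derN0 _ lP) ?(leq_trans nl) ?leq_addl // /dact aev0 scaler0.
Qed.

(** The coefficients of the complete polarization of [P], with one variable for each position of [w]
    and the orders [a] as its exponents. *)
Fixpoint Fd w (a : seq nat) P : K :=
  match w, a with
  | i :: w', b :: a' => Fd w' a' (derN i b P)
  | _, _ => coef cone P
  end.

Lemma Fd_linear w a c P Q : Fd w a (c *: P + Q) = c * Fd w a P + Fd w a Q.
Proof.
elim: w a P Q => [|i w IH] [|b a] P Q /=; rewrite ?coef_linear //.
by rewrite derN_linear IH.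
Qed.

Lemma Fd0 w a : Fd w a 0 = 0.
Proof. by have := Fd_linear w a (-1) 0 0; rewrite !scaleN1r oppr0 addr0 mulN1r addNr. Qed.

Lemma Fd_sum w a (J : Type) (r : seq J) (c : J -> K) (F : J -> V) :
  Fd w a (\sum_(j <- r) c j *: F j) = \sum_(j <- r) c j * Fd w a (F j).
Proof. by elim/big_rec2: _ => [|j x y _ <-]; rewrite ?Fd0 ?Fd_linear. Qed.

Lemma Fd_low n w a P : low n P -> size a = size w -> has (leq n) a -> Fd w a P = 0.
Proof.
elim: w a P => [|i w IH] [|b a] P //= lP [sa] /orP [nb|ha].
  by rewrite (low_derN0 _ lP) // Fd0.
by apply: IH => //; apply: low_derN.
Qed.

Lemma coef_cone_dact a P : coef cone (dact a P) = coef cone P.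
Proof.
elim/malg_ind: P => [|[i k] P IH|c P Q IHP IHQ].
- by rewrite dact1.
- have cone_var x m : cone <> cmul (cvar x) m :> {cmonom Var}.
    by move=> /(congr1 (fun m : {cmonom Var} => m x)); rewrite coneE cmulE cvarE eqxx.
  transitivity (0 : K); last apply/esym; apply/eqP; apply: contraT.
    rewrite dactM -/(dX V i k) dact_X => /coefmM [m1 [m2 [h1 _ h2]]]; case/eqP: h1.
    rewrite /dact_var coefm_sum big1 // => j _.
    rewrite coefmZ coef_mon; case: (cvar _ =P m1) => [e|_]; last by rewrite mulr0.
    by rewrite -e in h2; case: (cone_var _ _ h2).
  move=> /coefmM [m1 [m2 [h1 _ h2]]]; case/eqP: h1; rewrite coef_mon.
  by case: (cvar _ =P m1) => [e|//]; rewrite -e in h2; case: (cone_var _ _ h2).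
- by rewrite dactD dactZ coefmD coefmZ IHP IHQ coefmD coefmZ.
Qed.

(** Each derivation contributes one geometric sum of shifts by [derN_dact]; the final constant term
    ignores the action. *)
Lemma Fd_dact n c w a P : low n P -> size a = size w ->
  Fd w a (dact (geo c) P) = (hpoly n (size w) (fun t => Fd w t P) a).[c].
Proof.
elim: w a P => [|i w IH] [|b a] P //= lP; first by rewrite coef_cone_dact hornerC.
move=> [sa]; rewrite (derN_dact _ _ _ lP) Fd_sum horner_sum; apply: eq_bigr => l _.
rewrite hornerM hornerXn IH //; exact: low_derN.
Qed.

(** By invariance the generating polynomial has the same value at all natural numbers, so it is
    constant. *)
Lemma Fd_harmonic n w P : low n P -> (forall c, dact (geo c) P = P) ->
  forall r s, size s = size w -> hsum (nseq (size w) true) r.+1 (fun t => Fd w t P) s = 0.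
Proof.
move=> lP inv r s ss; rewrite -(@coef_hpoly _ n) //; last first.
  by move=> t st; apply: Fd_low; rewrite // st ss.
suff -> : hpoly n (size w) (fun t => Fd w t P) s = (Fd w s P)%:P by rewrite coefC.
apply/eqP; rewrite -subr_eq0; apply/eqP; apply: poly_nat_roots => k.
by rewrite hornerD hornerN hornerC -Fd_dact // inv subrr.
Qed.

(** Restitution: exponent [x] at a position of letter [i] becomes X_i^(x) / x!. Only exponents below
    [n] are summed. *)
Fixpoint rho n w (f : seq nat -> K) : V :=
  match w with
  | i :: w' => \sum_(x < n) (x`!%:R^-1 *: dX V i x) * rho n w' (fun t => f (nat_of_ord x :: t))
  | [::] => (f [::])%:A
  end.

Lemma rho_ext n w f g : (forall s, size s = size w -> f s = g s) -> rho n w f = rho n w g.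
Proof.
elim: w f g => [|i w IH] f g fg /=; first by rewrite fg.
by apply: eq_bigr => x _; congr (_ * _); apply: IH => s ss; apply: fg; rewrite /= ss.
Qed.

Lemma rho_linear n w c f g :
  rho n w (fun s => c * f s + g s) = c *: rho n w f + rho n w g.
Proof.
elim: w f g => [|i w IH] f g /=; first by rewrite scalerDl scalerA.
rewrite scaler_sumr -big_split /=; apply: eq_bigr => x _.
by rewrite IH mulrDr scalerAr.
Qed.

Lemma rho0 n w : rho n w (fun=> 0) = 0.
Proof.
have := rho_linear n w (-1) (fun=> 0) (fun=> 0); rewrite scaleN1r addNr => <-.
by apply: rho_ext => s _; rewrite mulr0 addr0.
Qed.

Lemma rhoZ n w c f : rho n w (fun s => c * f s) = c *: rho n w f.
Proof.
rewrite -[RHS]addr0 -(rho0 n w) -rho_linear; apply: rho_ext => s _.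
by rewrite addr0.
Qed.

Lemma rho_sum n w (J : Type) (r : seq J) (c : J -> K) (F : J -> seq nat -> K) :
  rho n w (fun s => \sum_(j <- r) c j * F j s) = \sum_(j <- r) c j *: rho n w (F j).
Proof.
elim: r => [|j r IH].
  by rewrite big_nil -(rho0 n w); apply: rho_ext => s _; rewrite big_nil.
rewrite big_cons -IH -rho_linear; apply: rho_ext => s _; exact: big_cons.
Qed.

Lemma rho_mask n w M f g : size M = size w ->
  rho n w (fun t => f (mask M t) * g (mask (map negb M) t)) =
  rho n (mask M w) f * rho n (mask (map negb M) w) g.
Proof.
elim: M w f g => [|b M IH] [|i w] f g //=.
  by move=> _; rewrite -scalerAl mul1r scalerA.
move=> [sM]; case: b => /=.
  rewrite mulr_suml; apply: eq_bigr => x _.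
  by rewrite (IH _ (fun t => f (nat_of_ord x :: t)) g) // mulrA.
rewrite mulr_sumr; apply: eq_bigr => x _.
by rewrite (IH _ f (fun t => g (nat_of_ord x :: t))) // mulrCA.
Qed.

Lemma rho_prod n w (u : nat -> nat -> K) :
  rho n w (fun s => \prod_(j < size w) u j (nth 0%N s j)) =
  \prod_(j < size w) \sum_(x < n) u j x *: (x`!%:R^-1 *: dX V (nth ord0 w j) x).
Proof.
elim: w u => [|i w IH] u /=; first by rewrite !big_ord0 scale1r.
rewrite big_ord_recl /= mulr_suml; apply: eq_bigr => x _.
rewrite -(IH (fun j => u j.+1)) -[RHS]scalerAl [RHS]scalerAr -rhoZ.
congr (_ * _); apply: rho_ext => s _.
by rewrite big_ord_recl.
Qed.

Lemma vd_sum (d : nat) : exists c : K, forall t : seq nat, size t = d ->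
  vd K t = \sum_(p : 'S_d) (c * (-1) ^+ p) * \prod_(j < d) (nth 0%N t j == p j)%N%:R.
Proof.
(* The sign of the reversal of the rows, since [vd] lists the exponents downwards. *)
exists ((-1) ^+ perm (@rev_ord_inj d)) => t st.
rewrite /vd st -det_tr; set A := trmx _.
have -> : A = col_perm (perm (@rev_ord_inj d))
     (\matrix_(j < d, v < d) (nth 0%N t j == v)%N%:R).
  by apply/matrixP => j i; rewrite !mxE permE; congr ((_ == _)%N%:R) => /=; lia.
rewrite col_permE det_mulmx det_perm mulrC odd_permV mulr_sumr; apply: eq_bigr => p _.
by rewrite mulrA; congr (_ * _); apply: eq_bigr => j _; rewrite mxE.
Qed.

Lemma Wcols_sum cs d : size cs = d -> Wcols V cs =
  \sum_(p : 'S_d) (-1) ^+ p * \prod_(j < d)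
    dcolumn V (nth (ord0, 0%N) cs j).1 (nth (ord0, 0%N) cs j).2 (p j).
Proof.
move=> <-; rewrite /Wcols -det_tr; apply: eq_bigr => p _; congr (_ * _).
by apply: eq_bigr => j _; rewrite !mxE.
Qed.

Lemma rho_vd n w al : size al = size w -> (size w <= n)%N ->
  exists c, rho n w (fun t => vd K (addl al t)) = c *: Wcols V (zip w al).
Proof.
move=> sal swn; have [c hc] := vd_sum (size w).
have szip : size (zip w al) = size w by rewrite size_zip sal minnn.
(* A column entry in row p is p! times the normalized variable X^(p-a) / (p-a)!. This factor depends
   on the row alone and leaves the determinant. *)
exists (c * \prod_(j < size w) j`!%:R^-1).
(* [rho_prod] wants a function of natural positions; [insub] recovers the ordinal on the positions
   of [w]. *)
rewrite (@rho_ext n w _ (fun t => \sum_(p : 'S_(size w)) (c * (-1) ^+ p) *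
    \prod_(j < size w) (nth 0%N al j + nth 0%N t j ==
       (if insub (nat_of_ord j) is Some j' then p j' else 0%N))%N%:R)); last first.
  move=> t st; rewrite hc; last by rewrite size_addl ?sal ?st.
  apply: eq_bigr => p _; congr (_ * _).
  apply: eq_bigr => j _; rewrite valK /addl (nth_map (0%N, 0%N)).
    by rewrite nth_zip ?sal ?st.
  by rewrite size_zip sal st minnn.
rewrite rho_sum (Wcols_sum szip) scaler_sumr; apply: eq_bigr => p _.
rewrite (@rho_prod n w (fun j x => (nth 0%N al j + x ==
  (if insub j is Some j' then p j' else 0%N))%N%:R)).
have E (j : 'I_(size w)) : \sum_(x < n) (nth 0%N al j + x ==
   (if insub (nat_of_ord j) is Some j' then p j' else 0%N))%N%:R *:
      ((x`!%:R^-1 : K) *: dX V (nth ord0 w j) x) =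
   ((p j)`!%:R^-1 : K) *: dcolumn V (nth (ord0, 0%N) (zip w al) j).1
       (nth (ord0, 0%N) (zip w al) j).2 (p j).
  rewrite valK nth_zip //= /dcolumn; case: leqP => [le|gt]; last first.
    rewrite scaler0 big1 // => x _; case: eqP => [e|_]; last by rewrite scale0r.
    by move: gt; rewrite -e ltnNge leq_addr.
  have lt : (p j - nth 0%N al j < n)%N.
    by rewrite (leq_ltn_trans (leq_subr _ _)) // (leq_trans (ltn_ord _)).
  rewrite (bigD1 (Ordinal lt)) //= subnKC // eqxx scale1r big1 ?addr0; last first.
    move=> x; rewrite -val_eqE /= => nx; case: eqP => [e|_]; last by rewrite scale0r.
    by case/eqP: nx; rewrite -e addKn.
  rewrite -[dX _ _ _ *+ _]scaler_nat scalerA; congr (_ *: _).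
  have -> : (p j)`! = ((p j) ^_ (nth 0%N al j) * (p j - nth 0%N al j)`!)%N by rewrite ffact_fact.
  rewrite natrM invfM mulrAC mulVf ?mul1r // pnatr_eq0 -lt0n ffact_gt0 //.
rewrite (eq_bigr _ (fun j _ => E j)) scaler_prod.
rewrite mulr_sign -scaler_sign !scalerA; congr (_ *: _).
rewrite mulrAC; congr (_ * _ * _).
by rewrite [RHS](reindex_inj (@perm_inj _ p)).
Qed.

Definition content n m i : nat := (\sum_(x < n) m (i, nat_of_ord x))%N.

(** The product of the factorials of the letter multiplicities of [w]. *)
Fixpoint kappa w : nat :=
  if w is i :: w' then ((count_mem i w').+1 * kappa w')%N else 1%N.

Definition same_content n w m : bool := [forall i, count_mem i w == content n m i].

Lemma content_cone n m : ordlt n m -> (forall i, content n m i = 0%N) -> m = cone.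
Proof.
move=> om h; apply: cmonomP => -[i x]; rewrite coneE.
have [xn|nx] := ltnP x n.
  by have /eqP := h i; rewrite sum_nat_eq0 => /forallP /(_ (Ordinal xn)) /eqP.
by apply/eqP; rewrite eqn0Ngt; apply/negP => /om /=; rewrite ltnNge nx.
Qed.

Lemma content_cvar n i x m j : (x < n)%N ->
  content n (cmul (cvar (i, x)) m) j = ((i == j) + content n m j)%N.
Proof.
move=> xn; rewrite /content (eq_bigr (fun y : 'I_n => ((i == j) && (x == y :> nat)) + m (j, nat_of_ord y)))%N.
  rewrite big_split /=; congr addn; rewrite (bigD1 (Ordinal xn)) //= eqxx andbT big1 ?addn0 //.
  by move=> y; rewrite -val_eqE /= eq_sym => /negbTE ->; rewrite andbF.
by move=> y _; rewrite cmulE cvarE xpair_eqE.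
Qed.

(** Iterated Euler identity: the sum over x of X_i^(x) times the derivative in X_i^(x) multiplies a
    monomial by its degree in the letter [i]. One letter of [w] is consumed at each step, and a
    monomial survives only if its content is that of [w]. *)
Lemma euler n w m : ordlt n m ->
  rho n w (fun a => Fd w a (mon m)) =
  (if same_content n w m then (kappa w)%:R else 0) *: mon m.
Proof.
elim: w m => [|i w IH] m om /=.
  rewrite coef_mon; have [->|ne] := eqVneq m cone.
    rewrite mon_one ifT //; apply/forallP => j /=; rewrite eq_sym /content big1 // => x _.
    by rewrite coneE.
  rewrite scale0r ifF ?scale0r //; apply: contraNF ne => /forallP h; apply/eqP.
  by apply: (content_cone om) => j; apply/esym/eqP/h.
have step (x : 'I_n) : (x`!%:R^-1 *: dX V i x) *
     rho n w (fun t => Fd w t (derN i x (mon m))) =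
   (if same_content n (i :: w) m then (m (i, nat_of_ord x) * kappa w)%:R else 0) *: mon m.
  have -> : derN i x (mon m) = (x`!%:R * (m (i, nat_of_ord x))%:R) *: mon (cdiv m (i, nat_of_ord x)).
    by rewrite /derN der_mon scalerA.
  rewrite (@rho_ext n w _ (fun t => (x`!%:R * (m (i, nat_of_ord x))%:R) *
     Fd w t (mon (cdiv m (i, nat_of_ord x))))); last first.
    by move=> t _; rewrite -[_ *: _]addr0 Fd_linear Fd0 addr0.
  rewrite rhoZ; have [m0|mp] := posnP (m (i, nat_of_ord x)).
    rewrite m0 mulr0 scale0r mulr0 mul0n.
    by case: ifP; rewrite scale0r.
  have om' : ordlt n (cdiv m (i, nat_of_ord x)).
    by move=> y; rewrite cdivE => h; apply: om; apply: leq_trans h (leq_subr _ _).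
  have sc : same_content n (i :: w) m = same_content n w (cdiv m (i, nat_of_ord x)).
    apply: eq_forallb => j /=; rewrite -{1}(cvarM_div mp) content_cvar //.
    by rewrite eqn_add2l.
  rewrite IH // -sc; case: ifP => _; last by rewrite scale0r scaler0 mulr0 scale0r.
  rewrite -scalerAl -!scalerAr -{4}(cvarM_div mp) mon_mul -/(dX V i x) !scalerA.
  congr (_ *: _); rewrite natrM.
  by rewrite !mulrA mulVf ?mul1r // fact_neq0.
rewrite (eq_bigr _ (fun x _ => step x)) -scaler_suml; congr (_ *: _).
case: ifP => [/forallP h|_]; last by rewrite big1.
rewrite -natr_sum -big_distrl /=; congr (_ * _)%:R.
by have /eqP /= := h i; rewrite eqxx add1n => ->.
Qed.

Lemma kappa_neq0 w : (kappa w)%:R != 0 :> K.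
Proof. by rewrite pnatr_eq0; elim: w => //= i w IH; rewrite muln_eq0. Qed.

(** The decreasing order of the letters is chosen for [stair_bound]. *)
Definition content_word n m : seq 'I_N.+1 :=
  flatten [seq nseq (content n m i) i | i <- rev (enum 'I_N.+1)].

Lemma count_content_word n m i : count_mem i (content_word n m) = content n m i.
Proof.
rewrite /content_word count_flatten -map_comp sumnE big_map.
rewrite (bigD1_seq i) ?mem_rev ?mem_enum ?rev_uniq ?enum_uniq //=.
rewrite count_nseq /= eqxx mul1n big1 ?addn0 // => j ji.
by rewrite count_nseq /= (negbTE ji).
Qed.

Lemma content_word_sorted n m : sorted (fun i j : 'I_N.+1 => j <= i)%N (content_word n m).
Proof.
rewrite /content_word.
have : sorted (fun i j : 'I_N.+1 => j <= i)%N (rev (enum 'I_N.+1)).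
  rewrite rev_sorted; have := iota_sorted 0 N.+1.
  by rewrite -val_enum_ord sorted_map; apply: sub_sorted.
elim: (rev _) => //= i s IH ps; have tr : transitive (fun i j : 'I_N.+1 => j <= i)%N.
  by move=> a b c ba ac; apply: leq_trans ac ba.
have ai : all (fun j : 'I_N.+1 => j <= i)%N s by apply: order_path_min ps.
elim: (content n m i) => [|k IHk] /=; first exact/IH/path_sorted/ps.
rewrite path_min_sorted // all_cat; apply/andP; split.
  by apply/allP => j /nseqP [-> _].
by apply/allP => j /flattenP [t /mapP [j' /(allP ai) jj' ->] /nseqP [-> _]].
Qed.

(** Up to [kappa w], polarization at [w] followed by restitution projects onto the monomials of the
    content of [w]; each content of the support is listed once. *)
Lemma polar_decomposition n P : low n P ->
  P = \sum_(w <- undup [seq content_word n m | m <- supp P])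
        ((kappa w)%:R^-1 : K) *: rho n w (fun a => Fd w a P).
Proof.
move=> lP; apply: coefm_ext => m; rewrite coefm_sum.
have E w : coef m (((kappa w)%:R^-1 : K) *: rho n w (fun a => Fd w a P)) =
   if same_content n w m then coef m P else 0.
  rewrite coefmZ (@rho_ext n w _ (fun a => \sum_(u <- supp P) coef u P * Fd w a (mon u))).
    rewrite rho_sum coefm_sum mulr_sumr.
    under eq_big_seq => u.
      rewrite supp_mem => /lP ou.
      rewrite (euler _ ou) coefmZ coefmZ coef_mon.
      over.
    have [mP|mP] := boolP (m \in supp P).
      rewrite (bigD1_seq m) ?supp_uniq //= eqxx mulr1 big1 ?addr0; last first.
        by move=> u /negbTE ->; rewrite !mulr0.
      case: ifP => _; last by rewrite !mulr0.
      by rewrite mulrCA mulVf ?mulr1 // kappa_neq0.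
    rewrite big1_seq; last first.
      move=> u /= uP; case: (u =P m) => [e|_]; last by rewrite !mulr0.
      by rewrite -e uP in mP.
    by move: mP; rewrite supp_mem negbK => /eqP ->; case: ifP.
  by move=> a _; rewrite {1}[P]supp_sum Fd_sum.
rewrite (eq_bigr _ (fun w _ => E w)).
have [m0|mP] := eqVneq (coef m P) 0; first by rewrite big1 // => w _; case: ifP.
have mS : content_word n m \in undup [seq content_word n m | m <- supp P].
  by rewrite mem_undup map_f // supp_mem.
rewrite (bigD1_seq (content_word n m)) ?undup_uniq //= ifT; last first.
  by apply/forallP => i; rewrite count_content_word.
rewrite big1_seq ?addr0 // => w /andP [nw]; rewrite mem_undup => /mapP [u _ wE].
case: ifP => // /forallP h; case/eqP: nw; rewrite wE /content_word.
congr flatten; apply: eq_map => i; congr nseq.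
by have /eqP <- := h i; rewrite wE count_content_word.
Qed.

End Polarization.

(** * Standard determinants *)

Section Straightening.
Variables (K : numFieldType) (N : nat).
Local Notation Var := ('I_N.+1 * nat)%type.
Variable V : polyAlg Var K.
Implicit Types (P Q : V) (m : {cmonom Var}) (i : 'I_N.+1) (w : seq 'I_N.+1).
Implicit Types (cs : seq Var) (alpha : 'I_N.+1 -> seq nat).

Lemma Wcols_dup cs : ~~ uniq cs -> Wcols V cs = 0.
Proof.
move=> /(uniqPn (ord0, 0%N)) [a [b [ab bs eab]]].
rewrite /Wcols -det_tr; have as' := ltn_trans ab bs.
apply: (@determinant_alternate _ _ _ (Ordinal as') (Ordinal bs)).
  by rewrite -val_eqE /= neq_ltn ab.
by move=> j; rewrite !mxE /= eab.
Qed.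

Lemma Wcols_perm cs cs' : perm_eq cs cs' ->
  exists b : bool, Wcols V cs = (-1) ^+ b *: Wcols V cs'.
Proof.
move=> pe; have /tuple_permP [p pE] : perm_eq cs (in_tuple cs') by [].
exists (odd_perm p); have ss := perm_size pe.
rewrite (Wcols_sum V ss) /Wcols scaler_sign -mulr_sign.
set M := \matrix_(_, _) _; have -> : (-1) ^+ p * \det M = \det (M *m perm_mx p^-1).
  by rewrite det_mulmx det_perm odd_permV mulrC.
rewrite -col_permE -det_tr; apply: eq_bigr => q _; congr (_ * _).
apply: eq_bigr => j _; rewrite !mxE pE.
have -> : nth (ord0, 0%N) [tuple tnth (in_tuple cs') (p i) | i < size cs'] j =
   nth (ord0, 0%N) cs' (p j) by rewrite -tnth_nth tnth_mktuple (tnth_nth (ord0, 0%N)).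
by [].
Qed.

Definition is_std (d : nat) alpha : Prop :=
  (forall i, (0 < size (alpha i))%N ->
     sorted ltn (alpha i) /\ (last 0%N (alpha i) < partial_size alpha i)%N) /\
  (\sum_(i < N.+1) size (alpha i))%N = d.

Definition col_fun cs : 'I_N.+1 -> seq nat :=
  fun i => sort leq [seq x.2 | x <- cs & x.1 == i].

Lemma mem_columns alpha i (a : nat) : ((i, a) \in columns alpha) = (a \in alpha i).
Proof.
apply/allpairsPdep/idP => [[j [b [_ bj [-> ->]]]] //|ai].
by exists i, a; rewrite mem_enum.
Qed.

Lemma size_columns alpha : size (columns alpha) = (\sum_(i < N.+1) size (alpha i))%N.
Proof. by rewrite /columns size_allpairs_dep sumnE big_map big_enum. Qed.

Lemma columns_uniq alpha : (forall i, uniq (alpha i)) -> uniq (columns alpha).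
Proof.
move=> ua; apply: allpairs_uniq_dep; rewrite ?enum_uniq //.
by move=> [i a] [j b] /= _ _ [-> ->].
Qed.

Lemma mem_col_fun cs i (a : nat) : (a \in col_fun cs i) = ((i, a) \in cs).
Proof.
rewrite mem_sort; apply/mapP/idP => [[[j b]]|h].
  by rewrite mem_filter /= => /andP [/eqP -> h] ->.
by exists (i, a); rewrite // mem_filter eqxx.
Qed.

Lemma col_fun_uniq cs i : uniq cs -> uniq (col_fun cs i).
Proof.
move=> u; rewrite sort_uniq map_inj_in_uniq ?filter_uniq //.
move=> [j a] [j' b]; rewrite !mem_filter /=.
by move=> /andP [/eqP -> _] /andP [/eqP -> _] ->.
Qed.

Lemma columns_col_fun cs : uniq cs -> perm_eq cs (columns (col_fun cs)).
Proof.
move=> u; apply: uniq_perm => //.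
  by apply: columns_uniq => i; apply: col_fun_uniq.
by move=> [i a]; rewrite mem_columns mem_col_fun.
Qed.

Lemma sum_count (p : pred 'I_N.+1) w : (\sum_(i < N.+1 | p i) count_mem i w)%N = count p w.
Proof.
elim: w => [|x w IH] /=; first by rewrite big1.
rewrite big_split /= IH; congr addn.
case: (boolP (p x)) => px.
  rewrite (bigD1 x) //= eqxx big1 // => i /andP [_ /negbTE].
  by rewrite eq_sym => ->.
by rewrite big1 // => i pi; case: eqP => // xi; rewrite xi pi in px.
Qed.

Lemma size_col_fun w (al : seq nat) i : size al = size w ->
  size (col_fun (zip w al) i) = count_mem i w.
Proof.
move=> sa; rewrite size_sort size_map size_filter -(count_map fst (pred1 i)).
by rewrite -/(unzip1 _) unzip1_zip // sa.
Qed.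

Definition descending w := sorted (fun i j : 'I_N.+1 => j <= i)%N w.

(** In a decreasing word all letters after a position are at most the letter there, and the
    staircase bounds the exponent by their number. *)
Lemma stair_bound w al i (a : nat) : descending w -> stair al -> size al = size w ->
  (i, a) \in zip w al -> (a < count (fun j : 'I_N.+1 => j <= i)%N w)%N.
Proof.
elim: w al => [|j w IH] [|b al] //= sw /andP [ba sal] [ss].
have tr : transitive (fun i j : 'I_N.+1 => j <= i)%N.
  by move=> x y z yx xz; apply: leq_trans xz yx.
have aj : all (fun l : 'I_N.+1 => l <= j)%N w by apply: order_path_min sw.
rewrite inE => /orP [/eqP [-> ->]|h].
  rewrite leqnn add1n ltnS; move: aj; rewrite all_count => /eqP ->.
  by rewrite -ss.
by apply: ltn_addl; apply: IH h => //; apply: path_sorted sw.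
Qed.

Lemma col_fun_std w al : descending w -> stair al -> size al = size w ->
  uniq (zip w al) -> is_std (size w) (col_fun (zip w al)).
Proof.
move=> dw sal ss u; split=> [i ci|]; last first.
  under eq_bigr do rewrite size_col_fun //.
  by rewrite sum_count count_predT.
split; first by rewrite ltn_sorted_uniq_leq col_fun_uniq //= sort_sorted //; exact: leq_total.
have -> : partial_size (col_fun (zip w al)) i = count (fun j : 'I_N.+1 => j <= i)%N w.
  by rewrite /partial_size; under eq_bigr do rewrite size_col_fun //; rewrite sum_count.
apply: (stair_bound dw sal ss); rewrite -mem_col_fun.
by case: (col_fun _ _) ci => //= a s _; apply: mem_last.
Qed.

Lemma Wcols_straight w al : descending w -> stair al -> size al = size w ->
  Wcols V (zip w al) = 0 \/
  exists c alpha, is_std (size w) alpha /\ Wcols V (zip w al) = c *: Wcols V (columns alpha).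
Proof.
move=> dw sal ss; have [u|nu] := boolP (uniq (zip w al)); last first.
  by left; apply: Wcols_dup.
right; have [b bE] := Wcols_perm (columns_col_fun u).
by exists ((-1) ^+ b), (col_fun (zip w al)); split=> //; apply: col_fun_std.
Qed.

Lemma pspan_rho (L : V -> Prop) n w h f :
  L 0 -> (forall c P Q, L P -> L Q -> L (c *: P + Q)) ->
  size w = sumn h -> (forall F, isprod h F -> L (rho V n w F)) ->
  pspan h f -> L (rho V n w f).
Proof.
move=> L0 LL sw LF; elim=> {f} [f f0|c F g f hF _ IH fE].
  by rewrite (@rho_ext _ _ V n w _ (fun=> 0)) ?rho0 // => s; rewrite sw; apply: f0.
rewrite (@rho_ext _ _ V n w _ (fun s => c * F s + g s)) ?rho_linear; last first.
  by move=> s; rewrite sw; apply: fE.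
by apply: LL => //; apply: LF.
Qed.

Lemma descending_mask w M : descending w -> descending (mask M w).
Proof.
apply: sorted_mask => x y z yx xz; apply: leq_trans xz yx.
Qed.

Lemma isprod_rho (A : V -> Prop) k n w h F :
  A 1 -> (forall c P Q, A P -> A Q -> A (c *: P + Q)) ->
  (forall P Q, A P -> A Q -> A (P * Q)) ->
  (forall d alpha, (d <= k)%N -> is_std d alpha -> A (Wcols V (columns alpha))) ->
  all (geq k) h -> (sumn h <= n)%N ->
  descending w -> size w = sumn h -> isprod h F -> A (rho V n w F).
Proof.
move=> A1 AL AM AW.
have A0 : A 0 by have := AL (-1) _ _ A1 A1; rewrite scaleN1r addNr.
have AZ c P : A P -> A (c *: P) by move=> AP; rewrite -[c *: P]addr0; apply: AL.
move=> hk hn dw sw hF; elim: hF w hk hn dw sw => {h F} [|d h al M F sal st sM cM _ IH] w /=.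
  by move=> _ _ _ /size0nil -> /=; apply: AZ.
move=> /andP [dk hk] hn dw sw.
rewrite (@rho_mask _ _ V n w M (fun t => vd K (addl al t)) F) ?sM ?sw //.
have swM : size (mask M w) = d by rewrite size_mask ?cM ?sM ?sw.
apply: AM; last first.
  apply: IH => //; first by apply: leq_trans hn; rewrite leq_addl.
    exact: descending_mask.
  by rewrite size_mask_negb ?sM ?sw // cM addKn.
have dwM := descending_mask M dw.
have [||c ->] := @rho_vd _ _ V n (mask M w) al; rewrite ?sal ?swM //.
  by apply: leq_trans hn; rewrite leq_addr.
apply: (AZ c); have [|->|[c' [alpha [sa ->]]]] := Wcols_straight dwM st; rewrite ?swM //.
by apply: AZ; apply: AW sa; rewrite swM.
Qed.

Lemma size_content_word n m : ordlt n m -> size (content_word n m) = mdeg m.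
Proof.
have -> : size (content_word n m) = (\sum_(i < N.+1) content n m i)%N.
  rewrite -count_predT -sum_count; apply: eq_bigr => i _; exact: count_content_word.
elim/cmonom_ind: m => [_|[i x] m IH om].
  rewrite mdeg_cone big1 // => i _; rewrite /content big1 // => x _.
  by rewrite coneE.
have xn : (x < n)%N by apply: (om (i, x)); rewrite cmulE cvarE eqxx.
under eq_bigr do rewrite content_cvar //.
rewrite big_split /= mdeg_cmul mdeg_cvar IH; last first.
  by move=> y ym; apply: om; rewrite cmulE ltn_addl.
by congr addn; rewrite (bigD1 i) //= eqxx big1 // => j /negbTE; rewrite eq_sym => ->.
Qed.

Lemma lincomb_closed (L : V -> Prop) : L 0 ->
  (forall c P Q, L P -> L Q -> L (c *: P + Q)) ->
  forall (J : eqType) (s : seq J) (c : J -> K) (F : J -> V),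
    (forall j, j \in s -> L (F j)) -> L (\sum_(j <- s) c j *: F j).
Proof.
move=> L0 LL J s c F; elim: s => [|j s IH] hs; first by rewrite big_nil.
rewrite big_cons; apply: LL; first by apply: hs; rewrite mem_head.
by apply: IH => v vs; apply: hs; rewrite inE vs orbT.
Qed.

(* If P is invariant under the geometric series, its polarizations are
   harmonic, hence combinations of products of derivatives of Vandermonde
   determinants in at most k + 1 variables each. *)
Lemma invariant_pspan k n w P : low k.+1 P -> (k < n)%N ->
  (forall c, dact (geo c) P = P) ->
  pspan (col_heights k (size w)) (fun a => Fd w a P).
Proof.
move=> lP kn inv; apply: vanish_pspan; first exact: col_heights_sorted.
apply: harmonic_vanish => [r s ss|s ss hs].
  exact: (Fd_harmonic (lowW kn lP)).
by apply: (Fd_low lP).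
Qed.

Theorem invariant_in_algebra (A : V -> Prop) k P :
  A 1 -> (forall c P Q, A P -> A Q -> A (c *: P + Q)) ->
  (forall P Q, A P -> A Q -> A (P * Q)) ->
  (forall d alpha, (d <= k.+1)%N -> is_std d alpha -> A (Wcols V (columns alpha))) ->
  low k.+1 P -> (forall c, dact (geo c) P = P) -> A P.
Proof.
move=> A1 AL AM AW lP inv.
have A0 : A 0 by have := AL (-1) _ _ A1 A1; rewrite scaleN1r addNr.
(* Above the order of [P], and at least the degree of each of its monomials, so that [rho_vd]
   applies to all determinants that occur. *)
pose n := (k.+1 + \sum_(m <- supp P) mdeg m)%N.
have lPn : low n P by apply: lowW lP; rewrite leq_addr.
rewrite (polar_decomposition lPn); apply: lincomb_closed => // w.
rewrite mem_undup => /mapP [m mP wE].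
have om : ordlt n m by apply: lPn; rewrite -supp_mem.
have sw : size w = mdeg m by rewrite wE size_content_word.
apply: (pspan_rho A0 AL _ _ (@invariant_pspan k n w P lP _ inv)); rewrite ?sumn_col_heights //.
  move=> F; apply: (isprod_rho A1 AL AM AW) => //; rewrite ?sumn_col_heights //.
  - rewrite /col_heights all_rcons; apply/andP; split; first by rewrite /= ltnW // ltn_pmod.
    by apply/allP => x /nseqP [-> _] /=; rewrite leqnn.
  - by rewrite sw /n (bigD1_seq m) ?supp_uniq //= addnCA leq_addr.
  - rewrite wE; exact: content_word_sorted.
by rewrite /n addSn ltnS leq_addr.
Qed.

Definition stdcols (d : nat) cs : Prop := exists2 alpha, is_std d alpha & cs = columns alpha.

Definition colspan (B : seq Var -> Prop) P : Prop := exists (S : seq (seq Var)) (c : seq Var -> K),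
  [/\ uniq S, forall cs, cs \in S -> B cs
    & P = \sum_(cs <- S) c cs *: Wcols V cs].

Lemma colspan0 B : colspan B 0.
Proof. by exists [::], (fun=> 0); split=> //; rewrite big_nil. Qed.

Lemma colspan_linear B c P Q : colspan B P -> colspan B Q -> colspan B (c *: P + Q).
Proof.
move=> [S [a [uS hS ->]]] [T [b [uT hT ->]]].
exists (undup (S ++ T)), (fun cs => (if cs \in S then c * a cs else 0) +
                                  (if cs \in T then b cs else 0)); split.
- exact: undup_uniq.
- by move=> cs; rewrite mem_undup mem_cat => /orP [/hS|/hT].
have aux (U : seq (seq Var)) (u : seq Var -> K) : uniq U -> {subset U <= undup (S ++ T)} ->
    \sum_(cs <- U) u cs *: Wcols V cs =
    \sum_(cs <- undup (S ++ T)) (if cs \in U then u cs else 0) *: Wcols V cs.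
  move=> uU sU; rewrite [RHS](bigID (mem U)) /= [X in _ + X]big1 ?addr0; last first.
    by move=> cs /negbTE ->; rewrite scale0r.
  rewrite -[RHS]big_filter [RHS]big_seq_cond.
  rewrite (perm_big [seq cs <- undup (S ++ T) | cs \in U]) /=.
    rewrite [LHS]big_seq_cond; apply: eq_bigr => cs /andP [+ _].
    by rewrite mem_filter => /andP [-> _].
  apply: uniq_perm; rewrite ?filter_uniq ?undup_uniq // => cs.
  by rewrite mem_filter; case: (boolP (cs \in U)) => // /sU ->.
rewrite (aux S a) // => [|cs csS]; last by rewrite mem_undup mem_cat csS.
rewrite (aux T b) // => [|cs csT]; last by rewrite mem_undup mem_cat csT orbT.
rewrite scaler_sumr -big_split /=; apply: eq_bigr => cs _.
by rewrite scalerDl scalerA; case: ifP; rewrite ?mulr0.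
Qed.

Lemma colspan_W (B : seq Var -> Prop) cs : B cs -> colspan B (Wcols V cs).
Proof.
move=> h; exists [:: cs], (fun=> 1); split=> // [cs'|].
  by rewrite inE => /eqP ->.
by rewrite big_seq1 scale1r.
Qed.

Theorem invariant_span d P : homdeg d P -> low d.+1 P ->
  (forall c, dact (geo c) P = P) -> colspan (stdcols d) P.
Proof.
move=> hP lP inv.
have L0 := colspan0 (stdcols d); have LL c Q Q' := @colspan_linear (stdcols d) c Q Q'.
have LZ c Q : colspan (stdcols d) Q -> colspan (stdcols d) (c *: Q).
  by move=> LQ; rewrite -[c *: Q]addr0; apply: LL.
rewrite (polar_decomposition lP); apply: lincomb_closed => // w.
rewrite mem_undup => /mapP [m mP wE].
have om : ordlt d.+1 m by apply: lP; rewrite -supp_mem.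
have sw : size w = d by rewrite wE size_content_word //; apply: hP; rewrite -supp_mem.
(* With exponent bound [d] the shape is a single column: one determinant and no products, so the
   conclusion is a linear span. *)
have hE : col_heights d (size w) = [:: d].
  by rewrite sw /col_heights divn_small // modn_small.
apply: (pspan_rho L0 LL _ _ (@invariant_pspan d d.+1 w P lP _ inv)); rewrite ?sumn_col_heights //.
rewrite hE => F /isprod_consP [al [M [F0 [[sal st sM cM] hF0 ->]]]].
rewrite /= addn0 in sM.
have aM : M = nseq (size w) true.
  by rewrite sw -sM; apply/all_pred1P; rewrite -[all _ _]/(all (pred1 true) M);
    move: cM; rewrite -sM => /eqP; rewrite -all_count; apply: sub_all => -[].
have sMw : size M = size w by rewrite sM.
rewrite (@rho_mask _ _ V d.+1 w M (fun t => vd K (addl al t)) F0) //.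
have -> : mask M w = w by rewrite aM mask_true.
have -> : mask (map negb M) w = [::] by rewrite aM map_nseq mask_false.
have [||c ->] := @rho_vd _ _ V d.+1 w al; rewrite ?sal ?sw //.
rewrite /= -scalerAr mulr1; apply/LZ/LZ.
have dw : descending w by rewrite wE; exact: content_word_sorted.
have [|->//|[c' [alpha [sa ->]]]] := Wcols_straight dw st; rewrite ?sal ?sw //.
by apply: LZ; apply: colspan_W; exists alpha; rewrite // -sw.
Qed.

End Straightening.

(** * Leading monomials *)

Section Rearrangement.
Variables (d : nat) (kap : 'I_d -> nat).
Hypothesis kap_lt : forall j l : 'I_d, (j < l)%N -> (kap j < kap l)%N.

Let wsum (p : 'S_d) := (\sum_j p j * kap j)%N.

(** Take the first moved point [j] and its preimage [l]: both [l] and [p j] lie beyond [j]. *)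
Lemma perm_inversion (p : 'S_d) : p != 1%g -> exists j l : 'I_d, (j < l)%N /\ (p l < p j)%N.
Proof.
move=> p1; have [j0 j0P] : exists j, p j != j.
  apply/existsP; rewrite -negb_forall; apply: contra p1 => /forallP h.
  by apply/eqP/permP => j; rewrite perm1; apply/eqP.
case: (arg_minnP (P := fun j => p j != j) (fun j => nat_of_ord j) j0P) => j pj jmin.
have fixlt (i : 'I_d) : (i < j)%N -> p i = i.
  by move=> ij; apply/eqP; apply: contraTT ij => /jmin; rewrite -leqNgt.
pose l := (p^-1)%g j; have pl : p l = j by rewrite permKV.
exists j, l; split.
  rewrite ltn_neqAle; apply/andP; split.
    by apply: contra pj => /eqP /val_inj e; rewrite {1}e pl.
  rewrite leqNgt; apply/negP => lj; move: (fixlt _ lj); rewrite pl => e.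
  by rewrite -e ltnn in lj.
rewrite pl ltn_neqAle; apply/andP; split.
  by apply: contra pj => /eqP e; apply/eqP/val_inj.
rewrite leqNgt; apply/negP => pjj; move: (fixlt _ pjj) => /perm_inj e.
by rewrite e ltnn in pjj.
Qed.

Lemma rearrangement_step (p : 'S_d) : p != 1%g -> exists q, (wsum p < wsum q)%N.
Proof.
move=> /perm_inversion [j [l [jl pl]]]; exists (tperm j l * p)%g.
have lj : l != j by rewrite -val_eqE /= neq_ltn jl orbT.
rewrite /wsum (bigD1 j) //= (bigD1 l) //= [X in (_ < X)%N](bigD1 j) //=.
rewrite [X in (_ < _ + X)%N](bigD1 l) //= !permM tpermL tpermR.
rewrite [X in (_ < _ + (_ + X))%N](eq_bigr (fun i => p i * kap i)%N); last first.
  by move=> i /andP [ij il]; rewrite permM tpermD // eq_sym.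
have := kap_lt jl; rewrite !addnA ltn_add2r; nia.
Qed.

Lemma rearrangement (p : 'S_d) : p != 1%g -> (wsum p < \sum_(j < d) j * kap j)%N.
Proof.
move=> p1; have w1 : wsum 1%g = (\sum_(j < d) j * kap j)%N.
  by apply: eq_bigr => j _; rewrite perm1.
rewrite -w1; case: (arg_maxnP (P := xpredT) wsum (i0 := p) isT) => q _ qmax.
have q1 : q = 1%g.
  apply/eqP; apply: contraT => /rearrangement_step [r lt].
  by have le : (wsum r <= wsum q)%N := qmax r isT; rewrite ltnNge le in lt.
have [r lt] := rearrangement_step p1.
by rewrite -q1; apply: leq_trans lt (qmax r isT).
Qed.

End Rearrangement.

Section Weights.
Variables (N D : nat).
Local Notation Var := ('I_N.+1 * nat)%type.
Implicit Types (m : {cmonom Var}) (cs : seq Var) (x : Var).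

(** Large enough for [kap] to grow with the letter whatever the exponents below [D], since 2 a < 2
    D. *)
Definition base := (2 * D).+1.

(* The dominant term favours placing the highest orders on the largest letters. *)
Definition om x : nat := (x.2 * (base ^ x.1.+1 - x.2))%N.

Definition Om m : nat := (\sum_(x <- finsupp m) m x * om x)%N.

Lemma OmEw m (s : {fset Var}) : (finsupp m `<=` s)%fset ->
  Om m = (\sum_(x <- s) m x * om x)%N.
Proof.
move=> le; rewrite /Om (big_fset_incl _ le) //= => x _ nx.
by rewrite fsfun_dflt.
Qed.

Lemma Om_cmul m1 m2 : Om (cmul m1 m2) = (Om m1 + Om m2)%N.
Proof.
have le1 : (finsupp m1 `<=` finsupp m1 `|` finsupp m2)%fset by rewrite fsubsetUl.
have le2 : (finsupp m2 `<=` finsupp m1 `|` finsupp m2)%fset by rewrite fsubsetUr.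
have le : (finsupp (cmul m1 m2) `<=` finsupp m1 `|` finsupp m2)%fset.
  apply/fsubsetP => x; rewrite -cmE_neq0 cmulE addn_eq0 negb_and !cmE_neq0.
  by rewrite in_fsetU.
rewrite (OmEw le1) (OmEw le2) (OmEw le) -big_split /=.
by apply: eq_bigr => x _; rewrite cmulE mulnDl.
Qed.

Lemma Om_cone : Om cone = 0%N.
Proof. by have := Om_cmul cone cone; rewrite cmul.unlock cone.unlock mul1m; lia. Qed.

Lemma Om_cvar x : Om (cvar x) = om x.
Proof. by rewrite /Om cvar.unlock mdomU big_seq_fset1 cmUU mul1n. Qed.

Definition monL (s : seq Var) : {cmonom Var} := foldr (fun x m => cmul (cvar x) m) cone s.

Lemma monLE s x : monL s x = count_mem x s.
Proof. by elim: s => [|y s IH] /=; rewrite ?coneE // cmulE cvarE IH. Qed.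

Lemma Om_monL s : Om (monL s) = (\sum_(x <- s) om x)%N.
Proof.
elim: s => [|y s IH] /=; first by rewrite big_nil Om_cone.
by rewrite Om_cmul Om_cvar IH big_cons.
Qed.

Lemma monL_perm s1 s2 : perm_eq s1 s2 -> monL s1 = monL s2.
Proof. by move=> /seq.permP h; apply: cmonomP => x; rewrite !monLE h. Qed.

Lemma monL_inj s1 s2 : monL s1 = monL s2 -> perm_eq s1 s2.
Proof. by move=> e; apply/allP => x _ /=; rewrite -!monLE e. Qed.

(** The variables on the diagonal of the minor, [o] being the row of the first listed column. *)
Fixpoint levels (o : nat) cs : seq Var :=
  if cs is x :: cs' then (x.1, o - x.2)%N :: levels o.+1 cs' else [::].

Lemma size_levels o cs : size (levels o cs) = size cs.
Proof. by elim: cs o => //= x cs IH o; rewrite IH. Qed.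

Lemma levels_cat o cs1 cs2 : levels o (cs1 ++ cs2) = levels o cs1 ++ levels (o + size cs1) cs2.
Proof. by elim: cs1 o => [|x cs IH] o /=; rewrite ?addn0 // IH addSnnS. Qed.

Lemma nth_levels x0 o cs (l : nat) : (l < size cs)%N ->
  nth x0 (levels o cs) l = ((nth x0 cs l).1, o + l - (nth x0 cs l).2)%N.
Proof.
elim: cs o l => //= x cs IH o [|l] /= h; first by rewrite addn0.
by rewrite IH // addSnnS.
Qed.

Definition mlead cs : {cmonom Var} := monL (levels 0 cs).

Definition lexlt : rel Var := fun x y => (x.1 < y.1)%N || ((x.1 == y.1) && (x.2 < y.2)%N).

Lemma lexlt_trans : transitive lexlt.
Proof.
move=> y x z; rewrite /lexlt => /orP [xy|/andP [/eqP <- xy]] /orP [yz|/andP [/eqP <- yz]].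
- by rewrite (ltn_trans xy yz).
- by rewrite xy.
- by rewrite yz.
- by rewrite eqxx (ltn_trans xy yz) orbT.
Qed.

(** The second condition makes the diagonal entries of the minor nonzero. *)
Definition staircase cs : Prop :=
  sorted lexlt cs /\ forall l, (l < size cs)%N -> ((nth (ord0, 0%N) cs l).2 <= l)%N.

(** For a column of exponent a with B = [base] ^ (i + 1), the weight (p - a)(B - (p - a)) equals p
    (B + 2 a) up to - p^2 and terms free of p; the sum of the p^2 does not depend on the
    permutation. *)
Definition kap cs (j : nat) : nat :=
  let x := nth (ord0, 0%N) cs j in (base ^ x.1.+1 + 2 * x.2)%N.

Lemma kap_lt cs (j l : nat) : staircase cs -> (size cs <= D)%N -> (j < l < size cs)%N ->
  (kap cs j < kap cs l)%N.
Proof.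
move=> [sc st] sD /andP [jl ls].
have := sorted_ltn_nth lexlt_trans (ord0, 0%N) sc.
move=> /(_ j l); rewrite !inE => /(_ (ltn_trans jl ls) ls jl).
rewrite /kap; have := st _ (ltn_trans jl ls); move: (nth _ cs j) (nth _ cs l) => x y xj.
rewrite /lexlt => /orP [lt|/andP [/eqP -> lt]]; last by rewrite ltn_add2l ltn_mul2l.
have le : (base ^ x.1.+2 <= base ^ y.1.+1)%N by rewrite leq_pexp2l.
have : (base <= base ^ x.1.+1)%N by rewrite -{1}(expn1 base) leq_pexp2l.
move: le; rewrite expnS; move: (base ^ x.1.+1)%N (base ^ y.1.+1)%N => a b.
have -> : base = (2 * D).+1 by [].
nia.
Qed.

(* The quadratic term of the weight turns it into a function of p linear up to
   a constant, to which the rearrangement inequality applies. *)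
Lemma Om_term cs d (p : 'S_d) : size cs = d -> (d <= D)%N ->
  (forall j : 'I_d, (nth (ord0, 0%N) cs j).2 <= p j)%N ->
  (Om (monL [seq ((nth (ord0, 0%N) cs j).1, p j - (nth (ord0, 0%N) cs j).2)%N | j : 'I_d <- enum 'I_d])
   + (\sum_(j < d) ((nth (ord0, 0%N) cs j).2 * base ^ (nth (ord0, 0%N) cs j).1.+1 +
       (nth (ord0, 0%N) cs j).2 ^ 2)
   + \sum_(j < d) j ^ 2) = \sum_(j < d) p j * kap cs j)%N.
Proof.
move=> sd dD hp; rewrite Om_monL big_map big_enum /=.
rewrite [X in (_ + (_ + X))%N](reindex_inj (@perm_inj _ p)) /= -!big_split /=.
apply: eq_bigr => j _; rewrite /om /kap /=; have := hp j.
set x := nth _ _ _; move=> xp.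
have le : (p j - x.2 <= base ^ x.1.+1)%N.
  apply: (@leq_trans base); last by rewrite -{1}(expn1 base) leq_pexp2l.
  by rewrite (leq_trans (leq_subr _ _)) // /base; have := ltn_ord (p j); lia.
move: (base ^ x.1.+1)%N le => B; move: xp; move: (nat_of_ord (p j)) (x.2) => P a aP PB.
have [b bE] : exists b, P = (a + b)%N by exists (P - a)%N; rewrite subnKC.
rewrite {P aP}bE addKn in PB *; have [e ->] : exists e, B = (b + e)%N by exists (B - b)%N; lia.
by rewrite addKn; ring.
Qed.

End Weights.

Section LeadingMonomials.
Variables (K : numFieldType) (N D : nat).
Local Notation Var := ('I_N.+1 * nat)%type.
Variable V : polyAlg Var K.
Local Notation Om := (@Om N D).
Implicit Types (P Q : V) (m : {cmonom Var}) (cs : seq Var) (alpha : 'I_N.+1 -> seq nat).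

Definition lead P m : Prop :=
  coef m P != 0 /\ forall m', coef m' P != 0 -> m' != m -> (Om m' < Om m)%N.

Lemma mon_monL (s : seq Var) : mon (monL s) = \prod_(x <- s) (mon (cvar x) : V).
Proof.
elim: s => [|x s IH] /=; first by rewrite big_nil mon_one.
by rewrite mon_mul IH big_cons.
Qed.

Lemma dcolumn_ffact i (a j : nat) : dcolumn V i a j = (j ^_ a)%:R *: dX V i (j - a).
Proof.
rewrite /dcolumn; case: leqP => [_|lt]; first by rewrite scaler_nat.
by rewrite ffact_small // scale0r.
Qed.

Definition term_coef cs d (p : 'S_d) : K :=
  (-1) ^+ p * \prod_(j < d) ((p j) ^_ (nth (ord0, 0%N) cs j).2)%:R.

Definition term_vars cs d (p : 'S_d) : seq Var :=
  [seq ((nth (ord0, 0%N) cs j).1, p j - (nth (ord0, 0%N) cs j).2)%N | j : 'I_d <- enum 'I_d].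

Lemma Wcols_terms cs d : size cs = d ->
  Wcols V cs = \sum_(p : 'S_d) term_coef cs p *: mon (monL (term_vars cs p)).
Proof.
move=> sd; rewrite (Wcols_sum V sd); apply: eq_bigr => p _.
rewrite (eq_bigr _ (fun j _ => dcolumn_ffact _ _ _)) scaler_prod mon_monL big_map big_enum /=.
by rewrite mulr_sign -scaler_sign scalerA.
Qed.

Lemma term_vars1 cs d : size cs = d -> term_vars cs (1%g : 'S_d) = levels 0 cs.
Proof.
move=> sd; apply: (@eq_from_nth _ (ord0, 0%N)).
  by rewrite size_map size_levels sd size_enum_ord.
move=> l; rewrite size_map size_enum_ord => ld.
rewrite nth_levels ?sd // (nth_map (Ordinal ld)) ?size_enum_ord // perm1.
by rewrite nth_enum_ord.
Qed.

Lemma term_coef_neq0 cs d (p : 'S_d) : (term_coef cs p != 0) ->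
  forall j : 'I_d, ((nth (ord0, 0%N) cs j).2 <= p j)%N.
Proof.
rewrite mulf_eq0 negb_or => /andP [_ /prodf_neq0 h] j.
by have := h j isT; rewrite pnatr_eq0 -lt0n ffact_gt0.
Qed.

Lemma term_Om_lt cs d (p : 'S_d) : size cs = d -> (d <= D)%N -> staircase cs ->
  term_coef cs p != 0 -> p != 1%g -> (Om (monL (term_vars cs p)) < Om (mlead cs))%N.
Proof.
move=> sd dD st /term_coef_neq0 hp p1.
have h1 (j : 'I_d) : ((nth (ord0, 0%N) cs j).2 <= (1%g : 'S_d) j)%N.
  by rewrite perm1; apply: st.2; rewrite sd.
have kl (j l : 'I_d) : (j < l)%N -> (kap D cs j < kap D cs l)%N.
  by move=> jl; apply: kap_lt; rewrite ?sd // jl /=.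
have := rearrangement kl p1; rewrite -(Om_term sd dD hp).
have -> : (\sum_(j < d) j * kap D cs j = \sum_(j < d) (1%g : 'S_d) j * kap D cs j)%N.
  by apply: eq_bigr => j _; rewrite perm1.
rewrite -(Om_term sd dD h1) !ltn_add2r.
by rewrite -/(term_vars cs p) -/(term_vars cs (1%g : 'S_d)) (term_vars1 sd).
Qed.

Lemma lead_Wcols cs : (size cs <= D)%N -> staircase cs -> lead (Wcols V cs) (mlead cs).
Proof.
move=> sD st; have sd : size cs = size cs by [].
have c1 : term_coef cs (1%g : 'S_(size cs)) != 0.
  rewrite /term_coef mulf_eq0 negb_or signr_eq0 /=; apply/prodf_neq0 => j _.
  by rewrite perm1 pnatr_eq0 -lt0n ffact_gt0; apply: st.2.
split.
  rewrite (Wcols_terms sd) coefm_sum (bigD1 1%g) //= big1 ?addr0.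
    by rewrite coefmZ coef_mon (term_vars1 sd) eqxx mulr1.
  move=> p p1; rewrite coefmZ coef_mon; have [->|c0] := eqVneq (term_coef cs p) 0.
    by rewrite mul0r.
  have := term_Om_lt sd sD st c0 p1.
  by case: eqP => [->|_]; rewrite ?ltnn ?mulr0.
move=> m' cm' nm'; rewrite (Wcols_terms sd) coefm_sum in cm'.
have [p [c0 e]] : exists p : 'S_(size cs), term_coef cs p != 0 /\ monL (term_vars cs p) = m'.
  apply: contrapT => hn; case/eqP: cm'; rewrite big1 // => p _.
  rewrite coefmZ coef_mon; have [->|c0] := eqVneq (term_coef cs p) 0; first by rewrite mul0r.
  case: eqP => [e|_]; last by rewrite mulr0.
  by case: hn; exists p.
rewrite -e; apply: term_Om_lt => //; apply: contra nm' => /eqP p1.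
by rewrite -e p1 (term_vars1 sd).
Qed.

Lemma lead_dXM i P m : lead P m -> lead (dX V i 0 * P) (cmul (cvar (i, 0%N)) m).
Proof.
move=> [c0 h]; split; first by rewrite coefmXM.
move=> m' /coefmM [m1 [m2 [c1 c2 ->]]] nm.
have e1 : m1 = cvar (i, 0%N).
  by move: c1; rewrite coef_mon; case: (cvar _ =P m1) => [<-//|_]; rewrite eqxx.
rewrite e1 !Om_cmul ltn_add2l; apply: h => //.
by apply: contra nm => /eqP ->; rewrite e1.
Qed.

(* o is the number of columns listed before those of the letters in s. *)
Fixpoint blocks (o : nat) (s : seq 'I_N.+1) alpha : Prop :=
  if s is i :: s' then
    [/\ sorted ltn (alpha i),
        forall p, (p < size (alpha i))%N -> (nth 0%N (alpha i) p <= o + p)%N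
      & blocks (o + size (alpha i)) s' alpha]
  else True.

Definition cols_on (s : seq 'I_N.+1) alpha : seq Var := [seq (i, a) | i <- s, a <- alpha i].

Lemma cols_on_cons i s alpha :
  cols_on (i :: s) alpha = [seq (i, a) | a <- alpha i] ++ cols_on s alpha.
Proof. by rewrite /cols_on allpairs_cons. Qed.

Lemma sorted_ltn_gap (t : seq nat) (p q : nat) : sorted ltn t -> (p <= q < size t)%N ->
  (nth 0%N t p + (q - p) <= nth 0%N t q)%N.
Proof.
move=> st /andP [pq qs]; rewrite -(subnKC pq) addKn.
have : (p + (q - p) < size t)%N by rewrite subnKC.
elim: (q - p)%N => [|n IH] lt; first by rewrite !addn0.
have lt' : (p + n < size t)%N by lia.
have := sorted_ltn_nth ltn_trans 0%N st; move=> /(_ (p + n)%N (p + n.+1)%N).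
by rewrite !inE => /(_ lt' lt); have := IH lt'; lia.
Qed.

(** Strict growth carries the bound on the last exponent of a block backwards to all its
    positions. *)
Lemma std_blocks d alpha : is_std d alpha -> blocks 0 (enum 'I_N.+1) alpha.
Proof.
move=> [std _].
have : forall s1 s2 o, enum 'I_N.+1 = s1 ++ s2 -> o = (\sum_(j <- s1) size (alpha j))%N ->
    blocks o s2 alpha; last by move=> /(_ [::] (enum 'I_N.+1) 0%N) h; apply: h; rewrite ?big_nil.
move=> s1 s2; elim: s2 s1 => //= i s2 IH s1 o es oE.
have so : sorted ltn [seq nat_of_ord j | j <- enum 'I_N.+1] by rewrite val_enum_ord iota_ltn_sorted.
have psz : partial_size alpha i = (o + size (alpha i))%N.
  have -> : partial_size alpha i =
      (\sum_(j <- enum 'I_N.+1 | (j <= i)%N) size (alpha j))%N by rewrite big_enum_cond.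
  rewrite es big_cat big_cons leqnn /=.
  move: so; rewrite es map_cat /= (sorted_pairwise ltn_trans) pairwise_cat.
  rewrite allrel_consr /= => /and3P [/andP [/allP s1i _] _ /andP [/allP s2i _]].
  rewrite [X in (_ + (_ + X))%N]big1_seq ?addn0; last first.
    move=> j /andP [ji js]; have := s2i j (map_f _ js); by rewrite ltnNge ji.
  rewrite oE big_seq_cond [in RHS]big_seq_cond; congr addn; apply: eq_bigl => j.
  by case: (boolP (j \in s1)) => //= js; rewrite ltnW //; apply: s1i; apply: map_f.
split.
- have [->//|c] := eqVneq (alpha i) [::]; apply: (std i _).1.
  by rewrite lt0n size_eq0.
- move=> p ps; have [sl la] := std i (leq_ltn_trans (leq0n _) ps).
  have := @sorted_ltn_gap _ p (size (alpha i)).-1 sl; rewrite nth_last.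
  by move: la; rewrite psz; lia.
- apply: (IH (rcons s1 i)); first by rewrite cat_rcons.
  by rewrite -cats1 big_cat big_seq1 oE.
Qed.

Lemma blocks_staircase o s alpha : sorted ltn [seq nat_of_ord j | j <- s] -> blocks o s alpha ->
  sorted (@lexlt N) (cols_on s alpha) /\
  forall l, (l < size (cols_on s alpha))%N ->
    ((nth (ord0, 0%N) (cols_on s alpha) l).2 <= o + l)%N.
Proof.
rewrite (sorted_pairwise (@lexlt_trans N)).
elim: s o => [|i s IH] o so //= [si bi hb]; have [ps hs] := IH _ (path_sorted so) hb.
rewrite cols_on_cons; split.
  rewrite pairwise_cat ps andbT pairwise_map; apply/andP; split.
    apply/allrelP => x y /mapP [a _ ->] /allpairsPdep [j [b [js _ ->]]].
    rewrite /lexlt /=; have /= /(order_path_min ltn_trans) /allP := so.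
    by move=> /(_ j (map_f _ js)) ->.
  move: si; rewrite (sorted_pairwise ltn_trans); apply: sub_pairwise => a b /= ab.
  by rewrite /lexlt eqxx ab orbT.
move=> l; rewrite size_cat size_map nth_cat size_map => ls.
case: ltnP => la; first by rewrite (nth_map 0%N) //; apply: bi.
by have := hs (l - size (alpha i))%N; rewrite ltn_subLR // => /(_ ls); lia.
Qed.

Lemma std_staircase d alpha : is_std d alpha -> staircase (columns alpha).
Proof.
move=> /std_blocks hb; have [|h1 h2] := blocks_staircase _ hb; last by split.
by rewrite val_enum_ord iota_ltn_sorted.
Qed.

Lemma levels_map o i (t : seq nat) :
  levels o [seq (i, a) | a <- t] = [seq (i, b) | b <- [seq x.2 | x <- levels o [seq (i, a) | a <- t]]]
  :> seq Var.
Proof. by elim: t o => //= a t IH o; rewrite -IH. Qed.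

Lemma levels_letters (o : nat) cs : [seq x.1 | x <- levels o cs] = [seq x.1 | x <- cs].
Proof. by elim: cs o => //= x cs IH o; rewrite IH. Qed.

Lemma filter_letter_out i cs : i \notin [seq x.1 | x <- cs] -> [seq x <- cs | x.1 == i] = [::].
Proof. by elim: cs => //= x cs IH; rewrite inE negb_or eq_sym => /andP [/negbTE -> /IH]. Qed.

Lemma letters_cols_on s alpha : {subset [seq x.1 | x <- cols_on s alpha] <= s}.
Proof. by move=> i /mapP [x /allpairsPdep [j [b [js _ ->]]] ->]. Qed.

(** The exponents grow at least as fast as the positions, so the levels of a block weakly decrease
    and are determined by their multiset. *)
Lemma block_levels_inj o i (t u : seq nat) : sorted ltn t -> sorted ltn u ->
  (forall p, (p < size t)%N -> (nth 0%N t p <= o + p)%N) ->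
  (forall p, (p < size u)%N -> (nth 0%N u p <= o + p)%N) ->
  perm_eq (levels o [seq (i, a) | a <- t]) (levels o [seq (i, a) | a <- u] : seq Var) -> t = u.
Proof.
move=> st su ht hu pe.
have szE : size t = size u.
  by have := perm_size pe; rewrite !size_levels !size_map.
pose lev (v : seq nat) := [seq x.2 | x <- levels o [seq (i, a) | a <- v]].
have slev v : size (lev v) = size v by rewrite size_map size_levels size_map.
have nlev v p : (p < size v)%N -> nth 0%N (lev v) p = (o + p - nth 0%N v p)%N.
  move=> pv; rewrite (nth_map (i, 0%N)) ?size_levels ?size_map //.
  by rewrite nth_levels ?size_map //= (nth_map 0%N).
have sorted_lev v : sorted ltn v -> (forall p, (p < size v)%N -> (nth 0%N v p <= o + p)%N) ->
    sorted geq (lev v).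
  move=> sv hv; apply: (@path_sorted _ _ (o + size v)%N); apply/(pathP 0%N) => p; rewrite slev => ps.
  case: p ps => [|p] ps /=; first by rewrite nlev //; lia.
  have ps' : (p < size v)%N by lia.
  rewrite !nlev //; have := sorted_ltn_nth ltn_trans 0%N sv; move=> /(_ p p.+1).
  by rewrite !inE => /(_ ps' ps (leqnn _)) /= lt; have := hv _ ps; have := hv _ ps'; lia.
have eqlev : lev t = lev u.
  apply: (sorted_eq (leT := geq)); try exact: sorted_lev.
  - by move=> x y z /= yx xz; apply: leq_trans xz yx.
  - by move=> x y /= /andP [xy yx]; apply/eqP; rewrite eqn_leq; apply/andP; split.
  - exact: perm_map.
apply: (@eq_from_nth _ 0%N) => // p pt; have pu : (p < size u)%N by rewrite -szE.
have := congr1 (fun v => nth 0%N v p) eqlev; rewrite !nlev //.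
by have := ht p pt; have := hu p pu; lia.
Qed.

(** The variables of the first letter determine its block, hence also the row where the next block
    starts. *)
Lemma blocks_levels_inj o s alpha beta : uniq s -> blocks o s alpha -> blocks o s beta ->
  perm_eq (levels o (cols_on s alpha)) (levels o (cols_on s beta)) ->
  cols_on s alpha = cols_on s beta.
Proof.
elim: s o => //= i s IH o /andP [nis us] [sa ha ba] [sb hb bb].
rewrite !cols_on_cons !levels_cat !size_map => pe.
have out gam o' : i \notin [seq x.1 | x <- levels o' (cols_on s gam)].
  by rewrite levels_letters; apply: contra nis => /letters_cols_on.
have fin t o' : [seq x <- levels o' [seq (i, a) | a <- t] | x.1 == i] =
    levels o' [seq (i, a) | a <- t].
  by apply/all_filterP/allP => x; rewrite levels_map => /mapP [b _ ->] /=.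
have eab : alpha i = beta i.
  apply: (block_levels_inj (i := i) sa sb ha hb).
  have := perm_filter (fun x : Var => x.1 == i) pe.
  by rewrite !filter_cat !fin !(filter_letter_out (out _ _)) !cats0.
move: pe bb; rewrite -eab perm_cat2l => pe bb.
by congr (_ ++ _); apply: (IH _ us ba bb pe).
Qed.

Lemma mlead_inj d cs cs' : stdcols d cs -> stdcols d cs' -> mlead cs = mlead cs' -> cs = cs'.
Proof.
move=> [alpha sa ->] [beta sb ->] /monL_inj pe.
exact: (blocks_levels_inj (enum_uniq _) (std_blocks sa) (std_blocks sb)).
Qed.

Lemma stdcols_size d cs : stdcols d cs -> size cs = d.
Proof. by move=> [alpha [_ sa] ->]; rewrite size_columns. Qed.

Lemma lead_std d cs : (d <= D)%N -> stdcols d cs -> lead (Wcols V cs) (mlead cs).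
Proof.
move=> dD sc; apply: lead_Wcols; first by rewrite (stdcols_size sc).
by case: sc => alpha /std_staircase sa ->.
Qed.

(** Choose a term of maximal leading weight. Its leading monomial is not that of another term, and
    any other monomial of a term weighs less, so it cannot cancel. *)
Lemma lead_combination d (S : seq (seq Var)) (c : seq Var -> K) : (d <= D)%N -> uniq S ->
  (forall cs, cs \in S -> stdcols d cs) ->
  (exists2 cs, cs \in S & c cs != 0) ->
  exists cs, [/\ cs \in S, c cs != 0,
    coef (mlead cs) (\sum_(cs' <- S) c cs' *: Wcols V cs') != 0
    & forall cs', cs' \in S -> c cs' != 0 -> (Om (mlead cs') <= Om (mlead cs))%N].
Proof.
move=> dD uS hS [cs0 cs0S c0].
have ex : exists n, [exists j : 'I_(size S), (c (nth [::] S j) != 0) && (Om (mlead (nth [::] S j)) == n)].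
  have lt : (index cs0 S < size S)%N by rewrite index_mem.
  exists (Om (mlead cs0)); apply/existsP; exists (Ordinal lt).
  by rewrite /= nth_index // c0 eqxx.
have bd n : [exists j : 'I_(size S), (c (nth [::] S j) != 0) && (Om (mlead (nth [::] S j)) == n)] ->
    (n <= \sum_(cs <- S) Om (mlead cs))%N.
  move=> /existsP [j /andP [_ /eqP <-]].
  by rewrite (bigD1_seq (nth [::] S j)) ?mem_nth //= leq_addr.
case: (ex_maxnP ex bd) => n /existsP [j /andP [cj /eqP Omj]] nmax.
have jS : nth [::] S j \in S by rewrite mem_nth.
have le cs' : cs' \in S -> c cs' != 0 -> (Om (mlead cs') <= n)%N.
  move=> csS c'; apply: nmax; have lt : (index cs' S < size S)%N by rewrite index_mem.
  by apply/existsP; exists (Ordinal lt); rewrite /= nth_index // c' eqxx.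
move: jS cj Omj; move: (nth _ _ _) => cs csS cc OmE.
exists cs; split=> //; last by move=> cs' h1 h2; rewrite OmE; apply: le.
rewrite coefm_sum (bigD1_seq cs) //= coefmZ big1_seq ?addr0.
  by rewrite mulf_neq0 //; have [] := lead_std dD (hS _ csS).
move=> cs' /andP [ne cs'S]; rewrite coefmZ.
have [->|c'] := eqVneq (c cs') 0; first by rewrite mul0r.
suff -> : coef (mlead cs) (Wcols V cs') = 0 by rewrite mulr0.
apply/eqP; apply: contraT => h; have [_ lt] := lead_std dD (hS _ cs'S).
have nm : mlead cs != mlead cs'.
  by apply: contra ne => /eqP e; rewrite (mlead_inj (hS _ csS) (hS _ cs'S) e).
by have := lt _ h nm; rewrite OmE ltnNge le.
Qed.

Theorem std_independent d (S : seq (seq Var)) (c : seq Var -> K) : (d <= D)%N -> uniq S ->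
  (forall cs, cs \in S -> stdcols d cs) ->
  \sum_(cs <- S) c cs *: Wcols V cs = 0 -> forall cs, cs \in S -> c cs = 0.
Proof.
move=> dD uS hS s0 cs csS; apply/eqP; apply: contraT => c0.
have [|cs' [_ _]] := @lead_combination d S c dD uS hS; first by exists cs.
by rewrite s0 coefm0 eqxx.
Qed.

End LeadingMonomials.

(** * Reduction to the sequences of Sigma_bar *)

Section Reduction.
Variables (K : numFieldType) (N : nat).
Local Notation Var := ('I_N.+1 * nat)%type.
Variable V : polyAlg Var K.
Implicit Types (P Q : V) (m : {cmonom Var}) (cs : seq Var) (alpha : 'I_N.+1 -> seq nat).

Definition top_zero alpha (f : 'I_N.+1) : Prop :=
  [/\ (0 < size (alpha f))%N, head 0%N (alpha f) = 0%N
    & forall j : 'I_N.+1, (f < j)%N -> 0%N \notin alpha j].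

Lemma sorted_mem0 (t : seq nat) : sorted ltn t -> (0%N \in t) = (0 < size t)%N && (head 0%N t == 0%N).
Proof.
case: t => //= a t /(order_path_min ltn_trans) /allP h; rewrite inE eq_sym.
by case: eqP => //= a0; apply/negP => /h; case: (a) a0.
Qed.

(** In the first nonempty block the partial size is the length of the block, so its exponents are
    forced to be 0, 1, 2, and so on. Some letter thus carries 0, and [f] is the largest one. *)
Lemma top_zero_exists d alpha : is_std d alpha -> (0 < d)%N -> exists f, top_zero alpha f.
Proof.
move=> [std sd] d0.
have std0 j : (0%N \in alpha j) = (0 < size (alpha j))%N && (head 0%N (alpha j) == 0%N).
  have [s0|s0] := posnP (size (alpha j)); first by rewrite (size0nil s0).
  by rewrite sorted_mem0 ?s0 //; apply: (std j s0).1.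
have [i1 i1P] : exists i, (0 < size (alpha i))%N.
  apply/existsP; apply: contraT; rewrite negb_exists => /forallP h.
  by move: d0; rewrite -sd big1 // => i _; apply/eqP; rewrite -leqn0 leqNgt; apply: h.
case: (arg_minnP (P := fun i => 0 < size (alpha i))%N (fun i => nat_of_ord i) i1P) => i0 i0P i0min.
have ps0 : partial_size alpha i0 = size (alpha i0).
  rewrite /partial_size (bigD1 i0) //= big1 ?addn0 // => j /andP [ji0 nj].
  apply/eqP; rewrite -leqn0 leqNgt; apply/negP => /i0min.
  by rewrite leqNgt ltn_neqAle ji0 andbT negbK => /eqP e; case/eqP: nj; apply/val_inj.
have [si0 li0] := std _ i0P.
have z0 : 0%N \in alpha i0.
  rewrite std0 i0P /=; have := @sorted_ltn_gap _ 0 (size (alpha i0)).-1 si0.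
  by rewrite nth_last -nth0; lia.
case: (arg_maxnP (P := fun i => 0%N \in alpha i) (fun i => nat_of_ord i) z0) => f zf fmax.
exists f; have := zf; rewrite std0 => /andP [sf /eqP hf]; split=> // j fj.
by apply: contraL fj => zj; rewrite -leqNgt; apply: fmax.
Qed.

Definition zero_last alpha (f : 'I_N.+1) : Prop :=
  ((1 < size (alpha f))%N -> (last 0%N (alpha f) < (partial_size alpha f).-1)%N) /\
  forall j : 'I_N.+1, (f < j)%N -> (0 < size (alpha j))%N ->
    (last 0%N (alpha j) < (partial_size alpha j).-1)%N.

(** The letter provided by (4) carries the exponent 0, so it is at most [f]; its inequalities then
    include those of [f]. *)
Lemma Sigma_barP d alpha f : is_std d alpha -> top_zero alpha f ->
  zero_last alpha f <-> Sigma_bar d alpha.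
Proof.
move=> [std sd] [sf hf nz]; split=> [[h1 h2]|[_ _ [i [si hi i1 i2]]]].
  by split=> //; exists f.
have zi : 0%N \in alpha i by rewrite sorted_mem0 ?si ?hi //; apply: (std i si).1.
have : (i <= f)%N by rewrite leqNgt; apply: contraL zi => /nz.
rewrite leq_eqVlt => /orP [/eqP/val_inj <-|fi]; split=> //.
  by move=> _; apply: i2.
by move=> j fj; apply: i2; apply: ltn_trans fj.
Qed.

Lemma cols_on_cat s1 s2 alpha : cols_on (s1 ++ s2) alpha = cols_on s1 alpha ++ cols_on s2 alpha.
Proof. by elim: s1 => //= i s1 IH; rewrite !cols_on_cons IH catA. Qed.

Lemma eq_cols_on s alpha beta : (forall i, i \in s -> alpha i = beta i) ->
  cols_on s alpha = cols_on s beta.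
Proof.
elim: s => // i s IH h; rewrite !cols_on_cons IH; last first.
  by move=> j js; apply: h; rewrite inE js orbT.
by rewrite (h i) ?mem_head.
Qed.

Lemma enum_split (i : 'I_N.+1) : exists s1 s2, [/\ enum 'I_N.+1 = s1 ++ i :: s2,
  forall j, (j \in s1) = (j < i)%N & forall j, (j \in s2) = (i < j)%N].
Proof.
have ie : i \in enum 'I_N.+1 by rewrite mem_enum.
have [s1 [s2 es]] : exists s1 s2, enum 'I_N.+1 = s1 ++ i :: s2.
  by case/splitPr: ie => s1 s2; exists s1, s2.
have so : sorted ltn [seq nat_of_ord j | j <- enum 'I_N.+1] by rewrite val_enum_ord iota_ltn_sorted.
move: so; rewrite es map_cat /= (sorted_pairwise ltn_trans) pairwise_cat.
rewrite allrel_consr /= => /and3P [/andP [/allP s1i _] _ /andP [/allP s2i _]].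
have h1 j : j \in s1 -> (j < i)%N by move=> /(map_f (@nat_of_ord _)) /s1i.
have h2 j : j \in s2 -> (i < j)%N by move=> /(map_f (@nat_of_ord _)) /s2i.
exists s1, s2; split=> // j; have : j \in s1 ++ i :: s2 by rewrite -es mem_enum.
  rewrite mem_cat inE => /orP [js|/orP [/eqP ->|js]]; first by rewrite js h1.
    by rewrite ltnn; apply/negbTE/negP => /h1; rewrite ltnn.
  rewrite ltnNge ltnW ?h2 //; apply/negbTE/negP => /h1.
  by rewrite ltnNge ltnW ?h2.
rewrite mem_cat inE => /orP [js|/orP [/eqP ->|js]].
- rewrite [RHS]ltnNge ltnW ?h1 //; apply/negbTE/negP => /h2.
  by rewrite ltnNge ltnW ?h1.
- by rewrite ltnn; apply/negbTE/negP => /h2; rewrite ltnn.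
- by rewrite js h2.
Qed.

Lemma partial_size_sub (alpha beta : 'I_N.+1 -> seq nat) j i :
  size (alpha j) = (size (beta j)).+1 ->
  (forall l, l != j -> size (alpha l) = size (beta l)) ->
  partial_size alpha i = ((j <= i) + partial_size beta i)%N.
Proof.
move=> sj sl; rewrite /partial_size; case: leqP => ji.
  rewrite (bigD1 j) //= [X in (_ = _ + X)%N](bigD1 j) //= sj; congr (_.+1 + _)%N.
  by apply: eq_bigr => l /andP [_ lj]; apply: sl.
apply: eq_bigr => l li; apply: sl; apply: contraTneq li => ->.
by rewrite -ltnNge.
Qed.

Lemma sum_size_sub (alpha beta : 'I_N.+1 -> seq nat) j :
  size (alpha j) = (size (beta j)).+1 ->
  (forall l, l != j -> size (alpha l) = size (beta l)) ->
  (\sum_(l < N.+1) size (alpha l) = (\sum_(l < N.+1) size (beta l)).+1)%N.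
Proof.
move=> sj sl; rewrite (bigD1 j) //= [X in (_ = X.+1)%N](bigD1 j) //= sj -addSn; congr addn.
by apply: eq_bigr => l lj; apply: sl.
Qed.

Lemma partial_size_cols s1 s2 j alpha : enum 'I_N.+1 = s1 ++ j :: s2 ->
  (forall i, (i \in s1) = (i < j)%N) -> (forall i, (i \in s2) = (j < i)%N) ->
  partial_size alpha j = (size (cols_on s1 alpha) + size (alpha j))%N.
Proof.
move=> es h1 h2; have -> : partial_size alpha j =
    (\sum_(i <- enum 'I_N.+1 | (i <= j)%N) size (alpha i))%N by rewrite big_enum_cond.
rewrite es big_cat big_cons leqnn /= [X in (_ + (_ + X))%N]big1_seq ?addn0; last first.
  by move=> i /andP [ij]; rewrite h2 ltnNge ij.
congr addn; rewrite size_allpairs_dep sumnE big_map big_seq_cond [RHS]big_seq_cond.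
by apply: eq_bigl => i; rewrite h1; case: ltnP => // ij; rewrite ltnW.
Qed.

(** Lowering the later exponents makes up for the shift of their columns by one position. *)
Definition drop_last alpha (j : 'I_N.+1) : 'I_N.+1 -> seq nat := fun i =>
  if (i < j)%N then alpha i
  else if i == j then take (size (alpha i)).-1 (alpha i) else map predn (alpha i).

Lemma sorted_pred (t : seq nat) : sorted ltn t -> 0%N \notin t -> sorted ltn (map predn t).
Proof.
move=> st nz; rewrite sorted_map; apply: (sub_in_sorted (P := [pred x | x != 0%N]) _ _ st).
  by move=> x y; rewrite !inE /=; case: x => // x; case: y => // y _ _ /=.
by apply/allP => x xt /=; apply: contraNneq nz => <-.
Qed.

(** The letters after [j] lie beyond [f], so they do not carry 0 and their exponents can all be
    lowered, as the smaller partial sizes require. *)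
Lemma drop_last_std n alpha f (j : 'I_N.+1) : is_std n.+1 alpha -> top_zero alpha f -> (f <= j)%N ->
  (0 < size (alpha j))%N -> last 0%N (alpha j) = (partial_size alpha j).-1 ->
  is_std n (drop_last alpha j).
Proof.
move=> [std sd] [sf hf nz] fj sj lj.
have szj : size (alpha j) = (size (drop_last alpha j j)).+1.
  by rewrite /drop_last ltnn eqxx size_takel ?leq_pred // prednK.
have szl l : l != j -> size (alpha l) = size (drop_last alpha j l).
  by rewrite /drop_last => /negbTE ->; case: ifP; rewrite ?size_map.
have psz i := partial_size_sub i szj szl.
split; last by apply: succn_inj; rewrite -(sum_size_sub szj szl).
move=> i; have := psz i; case: (ltngtP i j) => [ij|ji|/val_inj ->] pi.
- have -> : drop_last alpha j i = alpha i by rewrite /drop_last ij.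
  by rewrite add0n in pi; rewrite -pi; apply: std.
- have -> : drop_last alpha j i = map predn (alpha i).
    by rewrite /drop_last ltnNge ltnW //= ifN // -val_eqE /= neq_ltn ji orbT.
  rewrite size_map => si.
  have [st la] := std i si; have nzi := nz _ (leq_ltn_trans fj ji).
  split; first exact: sorted_pred.
  have -> : last 0%N (map predn (alpha i)) = (last 0%N (alpha i)).-1.
    exact: (last_map predn (alpha i) 0%N).
  have : last 0%N (alpha i) != 0%N.
    by apply: contraNneq nzi => <-; case: (alpha i) si => //= a s _; apply: mem_last.
  by move: la; rewrite pi; lia.
- have -> : drop_last alpha j j = take (size (alpha j)).-1 (alpha j).
    by rewrite /drop_last ltnn eqxx.
  rewrite size_takel ?leq_pred // => sj'.
  have [st la] := std j sj; split; first exact: take_sorted.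
  have := @sorted_ltn_gap (alpha j) (size (alpha j)).-2 (size (alpha j)).-1 st.
  have -> : last 0%N (take (size (alpha j)).-1 (alpha j)) = nth 0%N (alpha j) (size (alpha j)).-2.
    by rewrite -nth_last size_takel ?leq_pred // nth_take //; lia.
  by rewrite nth_last; move: la; rewrite pi; lia.
Qed.

Lemma levels_pred o s alpha beta : (forall i, i \in s -> 0%N \notin alpha i) ->
  (forall i, i \in s -> beta i = map predn (alpha i)) ->
  levels o.+1 (cols_on s alpha) = levels o (cols_on s beta).
Proof.
elim: s o => // i s IH o nz ab; rewrite !cols_on_cons !levels_cat !size_map ab ?mem_head //.
congr (_ ++ _); last first.
  rewrite size_map addSn; apply: IH => l ls; [apply: nz|apply: ab]; by rewrite inE ls orbT.
have := nz i (mem_head _ _); elim: (alpha i) o {IH} => //= a t IH o.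
by rewrite inE negb_or => /andP [a0 nt]; rewrite IH //; congr ((_, _) :: _); lia.
Qed.

Lemma levels_rcons o cs x : levels o (rcons cs x) = rcons (levels o cs) (x.1, o + size cs - x.2)%N.
Proof. by rewrite -!cats1 levels_cat. Qed.

(** The removed column has the exponent of its row, so its diagonal variable has order 0; the other
    diagonal variables are unchanged. *)
Lemma drop_last_lead n alpha f (j : 'I_N.+1) : is_std n.+1 alpha -> top_zero alpha f -> (f <= j)%N ->
  (0 < size (alpha j))%N -> last 0%N (alpha j) = (partial_size alpha j).-1 ->
  mlead (columns alpha) = cmul (cvar (j, 0%N)) (mlead (columns (drop_last alpha j))).
Proof.
move=> sa [sf hf nz] fj sj lj; have [s1 [s2 [es h1 h2]]] := enum_split j.
have cE gam : columns gam = cols_on s1 gam ++ [seq (j, a) | a <- gam j] ++ cols_on s2 gam.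
  by rewrite /columns -/(cols_on _ _) es cols_on_cat cols_on_cons.
rewrite !cE.
have -> : cols_on s1 (drop_last alpha j) = cols_on s1 alpha.
  by apply: eq_cols_on => i; rewrite h1 /drop_last => ->.
have aE : alpha j = rcons (drop_last alpha j j) (last 0%N (alpha j)).
  rewrite /drop_last ltnn eqxx; case/lastP: (alpha j) sj => // t a _.
  by rewrite last_rcons size_rcons /= -!cats1 take_size_cat.
rewrite {1}aE map_rcons /mlead !levels_cat levels_rcons size_rcons !size_map !add0n addnS.
rewrite (levels_pred _ (beta := drop_last alpha j)); last first.
- move=> i; rewrite h2 => ji.
  by rewrite /drop_last ltnNge ltnW //= ifN // -val_eqE /= neq_ltn ji orbT.
- by move=> i; rewrite h2 => ji; apply: nz; apply: leq_ltn_trans ji.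
have -> : (size (cols_on s1 alpha) + size (drop_last alpha j j) - last 0%N (alpha j) = 0)%N.
  by rewrite lj (partial_size_cols alpha es h1 h2); have := congr1 size aE; rewrite size_rcons; lia.
rewrite -[RHS]/(monL ((j, 0%N) :: _)); apply: monL_perm.
set A := levels 0 _; set B := levels (size _) _.
have -> : (size (cols_on s1 alpha) + size (drop_last alpha j j))%N =
  (size (cols_on s1 alpha) + size [seq (j, a) | a <- drop_last alpha j j])%N by rewrite size_map.
set C := levels _ _; rewrite -cats1 -catA /= catA -cat1s.
by rewrite perm_catCA /= -catA.
Qed.

Lemma dact_geo_W c cs : dact (geo c) (Wcols V cs) = Wcols V cs.
Proof. by rewrite dact_Wcols /geo expr0 expr1n scale1r. Qed.

Lemma dact_geo_dX0 c i : dact (geo c) (dX V i 0) = dX V i 0.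
Proof.
by rewrite dact_X /dact_var /= big_ord1 bin0 subnn /geo expr0 mulr1n mul1r scale1r.
Qed.

(* A standard sequence outside Sigma_bar has the leading monomial of
   X_j^(0) W_beta for some standard beta, which allows subduction. *)
Theorem std_in_algebra (A : V -> Prop) n :
  A 1 -> (forall c P Q, A P -> A Q -> A (c *: P + Q)) ->
  (forall P Q, A P -> A Q -> A (P * Q)) ->
  (forall d alpha, (1 <= d <= n)%N -> Sigma_bar d alpha -> A (Wcols V (columns alpha))) ->
  (forall i, A (dX V i 0)) ->
  forall d alpha, (d <= n)%N -> is_std d alpha -> A (Wcols V (columns alpha)).
Proof.
move=> A1 AL AM AG AX.
have A0 : A 0 by have := AL (-1) _ _ A1 A1; rewrite scaleN1r addNr.
have AZ c P : A P -> A (c *: P) by move=> AP; rewrite -[c *: P]addr0; apply: AL.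
elim=> [|d IHd] alpha dn sa.
  have /size0nil -> : size (columns alpha) = 0%N by rewrite size_columns; case: sa.
  by rewrite /Wcols det_mx00.
(* Second induction, on the weight of the leading monomial. *)
have [b] := ubnP (Om d.+1 (mlead (columns alpha))).
elim: b alpha sa => // b IHb alpha sa; rewrite ltnS => Omb.
have [f tf] := top_zero_exists sa (ltn0Sn d).
have [bar|nbar] := pselect (Sigma_bar d.+1 alpha); first by apply: AG bar.
have [j [fj sj lj]] : exists j : 'I_N.+1, [/\ (f <= j)%N, (0 < size (alpha j))%N
    & last 0%N (alpha j) = (partial_size alpha j).-1].
  apply: contrapT => hn; apply: nbar; apply/(Sigma_barP sa tf).
  have h (j : 'I_N.+1) : (f <= j)%N -> (0 < size (alpha j))%N ->
      (last 0%N (alpha j) < (partial_size alpha j).-1)%N.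
    move=> fj sj; have [_ la] := sa.1 j sj.
    rewrite ltn_neqAle; apply/andP; split; last by move: la; lia.
    by apply/eqP => lj; apply: hn; exists j.
  split=> [sf|j fj]; first by apply: h => //; case: tf.
  exact/h/ltnW.
set beta := drop_last alpha j.
have sb : is_std d beta := drop_last_std sa tf fj sj lj.
set W := Wcols V (columns alpha); pose E := dX V j 0 * Wcols V (columns beta).
have AE : A E by apply: AM; [exact: AX|apply: IHd => //; exact: ltnW].
have [cW ltW] : lead d.+1 W (mlead (columns alpha)).
  by apply: (lead_std V (leqnn _)); exists alpha.
have [cE ltE] : lead d.+1 E (mlead (columns alpha)).
  rewrite (drop_last_lead sa tf fj sj lj); apply: lead_dXM.
  by apply: (lead_std V (leqnSn _)); exists beta.
move: cW ltW cE ltE Omb; set m := mlead _ => cW ltW cE ltE Omb.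
pose r := coef m W / coef m E; pose P := (- r) *: E + W.
have -> : W = r *: E + P by rewrite /P addrA -scalerDl subrr scale0r add0r.
apply: (AL) => //.
have szW : size (columns alpha) = d.+1 by rewrite size_columns; case: sa.
have szb : size (columns beta) = d by rewrite size_columns; case: sb.
have Pm m' : coef m' P != 0 -> (Om d.+1 m' < Om d.+1 m)%N.
  have [->|nm] := eqVneq m' m.
    by rewrite coef_linear /r mulNr divfK // addNr eqxx.
  rewrite coef_linear; have [e|c'] := eqVneq (coef m' E) 0.
    by rewrite e mulr0 add0r => /ltW; apply.
  by move=> _; apply: ltE.
(* Being invariant of degree d + 1, [P] is a combination of standard minors. The heaviest leading
   monomial among them occurs in [P], so it weighs less than [m] and the induction covers them
   all. *)
have [S [c [uS hS PE]]] : colspan (stdcols d.+1) P.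
  apply: invariant_span.
  - apply: supported_linear; last by have := @Wcols_hom _ _ V (columns alpha); rewrite szW.
    have hE : homdeg (1 + d) E.
      by apply: homM; [exact: hom_dX|have := @Wcols_hom _ _ V (columns beta); rewrite szb].
    exact: hE.
  - apply: supported_linear; last by have := @Wcols_low _ _ V (columns alpha); rewrite szW; apply: lowW.
    apply: lowM; first exact: low_dX.
    by have := @Wcols_low _ _ V (columns beta); rewrite szb; apply: lowW; rewrite ltnW.
  - by move=> c; rewrite dactD dactZ dactM !dact_geo_W dact_geo_dX0.
rewrite PE; have [ex|nex] := pselect (exists2 cs, cs \in S & c cs != 0); last first.
  rewrite big1_seq // => cs /= csS; have [->|c0] := eqVneq (c cs) 0; first by rewrite scale0r.
  by case: nex; exists cs.
have [cs0 [_ _ c0 le0]] := lead_combination (D := d.+1) V (leqnn _) uS hS ex.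
rewrite -PE in c0; have lt0 := Pm _ c0.
have hW cs : cs \in S -> A (c cs *: Wcols V cs).
  move=> csS; have [->|cn] := eqVneq (c cs) 0; first by rewrite scale0r.
  apply: AZ; have [gam sg csE] := hS _ csS; rewrite csE; apply: IHb => //.
  rewrite -csE; apply: leq_ltn_trans (le0 _ csS cn) _.
  exact: leq_trans lt0 Omb.
rewrite (eq_bigr (fun cs => 1 *: (c cs *: Wcols V cs))) => [|cs _]; last by rewrite scale1r.
exact: (lincomb_closed A0 AL).
Qed.

End Reduction.

(** * Independence modulo lower order *)

Section Independence.
Variables (K : numFieldType) (N : nat).
Local Notation Var := ('I_N.+1 * nat)%type.
Variable V : polyAlg Var K.
Implicit Types (P Q : V) (m : {cmonom Var}) (cs : seq Var) (alpha : 'I_N.+1 -> seq nat).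

Lemma der_low n i P : low n P -> der (i, n) P = 0.
Proof.
move=> lP; apply: supported_der0 => m /lP h; apply/eqP; rewrite eqn0Ngt.
by apply/negP => /h /=; rewrite ltnn.
Qed.

(** In row [n] a column of positive exponent is zero or has order below [n]. *)
Lemma der_dcolumn i n i' (a : nat) :
  der (i, n) (dcolumn V i' a n) = ((i', a) == (i, 0%N))%:R.
Proof.
rewrite dcolumn_ffact derZ /dX -[mon _]mulr1 derXM der1 mulr0 addr0 scalerA.
rewrite !xpair_eqE; case: eqP => _ /=; last by rewrite mulr0 scale0r.
case: a => [|a]; first by rewrite subn0 eqxx mulr1 ffactn0 scale1r.
case: n => [|n]; first by rewrite ffact0n mul0r scale0r.
by rewrite (_ : (n.+1 - a.+1 == n.+1)%N = false) ?mulr0 ?scale0r //; apply/eqP; lia.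
Qed.

Lemma Wcols_size d cs : size cs = d -> Wcols V cs =
  \det (\matrix_(j < d, l < d)
    dcolumn V (nth (ord0, 0%N) cs l).1 (nth (ord0, 0%N) cs l).2 j).
Proof. by move=> <-. Qed.

(** Expand along the last row: the cofactors use the rows above, have order below [n] and are
    constants for this derivation. *)
Lemma der_Wcols n cs i : size cs = n.+1 -> uniq cs ->
  exists b : bool, der (i, n) (Wcols V cs) =
    if (i, 0%N) \in cs then (-1) ^+ b *: Wcols V (rem (i, 0%N) cs) else 0.
Proof.
move=> sc uc; set x0 : Var := (ord0, 0%N).
pose M := \matrix_(j < n.+1, l < n.+1) dcolumn V (nth x0 cs l).1 (nth x0 cs l).2 j.
rewrite (Wcols_size sc) -/x0 -/M.
have lowcof l : low n (cofactor M ord_max l).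
  rewrite /cofactor -signr_odd mulr_sign.
  have h : low n (\det (row' ord_max (col' l M))).
    apply: low_det => j k; rewrite !mxE; apply: dcolumn_low.
    by rewrite lift_max.
  by case: ifP => _ //; rewrite -scaleN1r; apply: supportedZ.
have E (l : 'I_n.+1) : der (i, n) (M ord_max l * cofactor M ord_max l) =
    (nth x0 cs l == (i, 0%N))%:R * cofactor M ord_max l.
  rewrite derM (der_low i (lowcof l)) mulr0 addr0 mxE /=.
  by rewrite der_dcolumn -surjective_pairing.
exists (odd (n + index (i, 0%N) cs)).
rewrite (expand_det_row _ ord_max) der_sum (eq_bigr _ (fun l _ => E l)).
case: ifP => [ic|/negbT nic]; last first.
  rewrite big1 // => l _; case: eqP => [e|_]; last by rewrite mul0r.
  by rewrite -e mem_nth ?sc in nic.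
have lt : (index (i, 0%N) cs < n.+1)%N by rewrite -sc index_mem.
rewrite (bigD1 (Ordinal lt)) //= nth_index // eqxx mul1r big1 ?addr0; last first.
  move=> l; rewrite -val_eqE /= => nl; case: eqP => [e|_]; last by rewrite mul0r.
  by case/eqP: nl; rewrite -e index_uniq ?sc.
rewrite /cofactor /= -signr_odd mulr_sign scaler_sign.
rewrite (@Wcols_size n); last by rewrite size_rem // sc.
have -> : row' ord_max (col' (Ordinal lt) M) =
    \matrix_(j < n, l < n) dcolumn V (nth x0 (rem (i, 0%N) cs) l).1 (nth x0 (rem (i, 0%N) cs) l).2 j.
  apply/matrixP => j l; rewrite !mxE lift_max /= remE.
  rewrite nth_cat size_take sc lt /bump; case: leqP => h.
    by rewrite nth_drop add1n addSn subnKC.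
  by rewrite nth_take.
by case: ifP.
Qed.

Lemma rem_columns alpha f : uniq (columns alpha) ->
  head 0%N (alpha f) = 0%N -> (0 < size (alpha f))%N ->
  rem (f, 0%N) (columns alpha) =
    columns (fun i => if i == f then behead (alpha f) else alpha i).
Proof.
move=> u hf sf; have [s1 [s2 [es h1 h2]]] := enum_split f.
rewrite rem_filter //; move: u.
have cE gam : columns gam = cols_on (enum 'I_N.+1) gam by [].
rewrite !cE es !cols_on_cat !cols_on_cons eqxx.
case: (alpha f) hf sf => //= a t -> _; rewrite cat_uniq /= !filter_cat /= eqxx /=.
move=> /and3P [_ /norP [n1 _] /andP [n2 _]].
have flt s : (f, 0%N) \notin s -> [seq y <- s | predC1 (f, 0%N) y] = s.
  move=> ns; apply/all_filterP/allP => y ys /=.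
  by apply: contraNneq ns => <-.
rewrite !flt //; congr (_ ++ (_ ++ _)); apply: eq_cols_on => i; rewrite ?h1 ?h2 => lt.
  by rewrite ifN // -val_eqE neq_ltn lt.
by rewrite ifN // -val_eqE neq_ltn lt orbT.
Qed.

Lemma stdcols_uniq d cs : stdcols d cs -> uniq cs.
Proof.
move=> [alpha [std _] ->]; apply: columns_uniq => i.
have [s0|s0] := posnP (size (alpha i)); first by rewrite (size0nil s0).
by have [sa _] := std i s0; apply: sorted_uniq sa; [exact: ltn_trans|exact: ltnn].
Qed.

Definition barcols d cs : Prop := exists2 alpha, Sigma_bar d alpha & cs = columns alpha.

Lemma Sigma_bar_std d alpha : Sigma_bar d alpha -> is_std d alpha.
Proof. by case=> h1 h2 _; split. Qed.

Lemma barcols_std d cs : barcols d cs -> stdcols d cs.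
Proof. by move=> [alpha /Sigma_bar_std sa ->]; exists alpha. Qed.

(** Removing a column lowers the partial sizes from [f] on by one; [zero_last] provides exactly this
    margin. *)
Lemma behead_std n alpha f : is_std n.+1 alpha -> top_zero alpha f -> zero_last alpha f ->
  is_std n (fun i => if i == f then behead (alpha f) else alpha i).
Proof.
move=> [std sd] [sf hf nz] [l1 l2]; set beta := fun i => _.
have szf : size (alpha f) = (size (beta f)).+1.
  by rewrite /beta eqxx size_behead prednK.
have szl l : l != f -> size (alpha l) = size (beta l) by rewrite /beta => /negbTE ->.
have psz i := partial_size_sub i szf szl.
split; last by apply: succn_inj; rewrite -(sum_size_sub szf szl).
move=> i; have := psz i; have [->|nif] := eqVneq i f.
  have -> : beta f = behead (alpha f) by rewrite /beta eqxx.
  rewrite leqnn add1n => pf; rewrite size_behead => s1.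
  have [st _] := std f sf; have := l1 _; rewrite pf /= => la.
  case: (alpha f) st la s1 => //= a t st la s1; split; first exact: path_sorted st.
  by case: t s1 la {st} => //= b t _; apply; rewrite ltnS.
have -> : beta i = alpha i by rewrite /beta (negbTE nif).
move=> pi si; have [st la] := std i si; split=> //.
move: pi; case: (ltngtP i f) => [lt|gt|/val_inj e]; last by rewrite e eqxx in nif.
  by rewrite add0n => <-.
by have := l2 i gt si => + pi; rewrite pi add1n.
Qed.

Lemma barcols_top n cs : barcols n.+1 cs -> exists f,
  [/\ (f, 0%N) \in cs, forall i : 'I_N.+1, (f < i)%N -> (i, 0%N) \notin cs
    & stdcols n (rem (f, 0%N) cs)].
Proof.
move=> [alpha ba ->]; have sa := Sigma_bar_std ba.
have [f tf] := top_zero_exists sa (ltn0Sn n).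
have zl := (Sigma_barP sa tf).2 ba; have [sf hf nz] := tf.
have sc : stdcols n.+1 (columns alpha) by exists alpha.
exists f; split.
- by rewrite mem_columns sorted_mem0 ?sf ?hf //; apply: (sa.1 f sf).1.
- by move=> i fi; rewrite mem_columns; apply: nz.
- rewrite (rem_columns (stdcols_uniq sc)) //.
  by exists (fun i => if i == f then behead (alpha f) else alpha i); first exact: behead_std.
Qed.

(** Standard column lists are sorted for [lexlt], so their multisets determine them. *)
Lemma rem_stdcols_inj d d' cs cs' x : stdcols d cs -> stdcols d' cs' -> x \in cs -> x \in cs' ->
  rem x cs = rem x cs' -> cs = cs'.
Proof.
move=> sc sc' xc xc' e.
have so c e' : stdcols e' c -> sorted (@lexlt N) c.
  by move=> [alpha /std_staircase [] h _ ->].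
have asym : antisymmetric (@lexlt N).
  move=> [i a] [j b]; rewrite /lexlt /= => /andP [/orP [ij|/andP [/eqP <- ab]] ji].
    by case/orP: ji => [|/andP [/eqP e1]]; [rewrite ltnNge ltnW|rewrite e1 ltnn in ij].
  by move: ji; rewrite ltnn eqxx /= ltnNge ltnW.
apply: (sorted_eq (@lexlt_trans N) asym (so _ _ sc) (so _ _ sc')).
by rewrite (perm_trans (perm_to_rem xc)) // e perm_sym perm_to_rem.
Qed.

Lemma std_independent_map d (J : eqType) (S : seq J) (c : J -> K) (g : J -> seq Var) :
  uniq S -> {in S &, injective g} -> (forall j, j \in S -> stdcols d (g j)) ->
  \sum_(j <- S) c j *: Wcols V (g j) = 0 -> forall j, j \in S -> c j = 0.
Proof.
move=> uS gi hg s0 j jS.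
(* A coefficient function on column lists; by injectivity of [g] the sum has one term on the
   image. *)
pose c' t := \sum_(j <- S | g j == t) c j.
have c'E i : i \in S -> c' (g i) = c i.
  move=> iS; rewrite /c' big_mkcond (bigD1_seq i) //= eqxx big1_seq ?addr0 //.
  move=> l /andP [li lS]; case: eqP => // e; case/eqP: li; exact: gi.
rewrite -(c'E j jS); apply: (@std_independent _ _ d V d [seq g i | i <- S]) => //.
- by rewrite map_inj_in_uniq.
- by move=> cs /mapP [i iS ->]; apply: hg.
- rewrite big_map big_seq -[RHS]s0 [RHS]big_seq; apply: eq_bigr => i iS.
  by rewrite c'E.
- exact: map_f.
Qed.

(* Only the columns (i, 0) contain a variable of order n; deriving by the one
   with the largest letter leaves standard minors. *)
Theorem bar_independent n (S : seq (seq Var)) (c : seq Var -> K) : uniq S ->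
  (forall cs, cs \in S -> barcols n.+1 cs) ->
  low n (\sum_(cs <- S) c cs *: Wcols V cs) -> forall cs, cs \in S -> c cs = 0.
Proof.
move=> uS hS lS cs0 cs0S; apply/eqP; apply: contraT => c0.
pose Z i := has (fun cs => (c cs != 0) && ((i, 0%N) \in cs)) S.
have [f0 [f0c _ _]] := barcols_top (hS _ cs0S).
have Zf0 : Z f0 by apply/hasP; exists cs0; rewrite // c0 f0c.
case: (arg_maxnP (P := Z) (fun i => nat_of_ord i) Zf0) => i Zi imax.
have [cs1 cs1S /andP [c1 i1]] := hasP Zi.
pose T := [seq cs <- S | (c cs != 0) && ((i, 0%N) \in cs)].
have TS cs : cs \in T -> [/\ cs \in S, c cs != 0 & (i, 0%N) \in cs].
  by rewrite mem_filter => /andP [/andP [-> ->] ->].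
(* By maximality of [i] over all the lists with a nonzero coefficient, [i] is also the largest
   letter with exponent 0 of each list of [T]. *)
have stdT cs : cs \in T -> stdcols n (rem (i, 0%N) cs).
  move=> /TS [csS cn ics]; have [f [fc fmax sr]] := barcols_top (hS _ csS).
  suff -> : i = f by [].
  apply/val_inj/eqP; rewrite eqn_leq; apply/andP; split.
    by rewrite leqNgt; apply: contraL ics => /fmax.
  by apply: imax; apply/hasP; exists cs; rewrite // cn fc.
have der0E := der_low i lS.
(* [der_Wcols] gives one sign per list; a choice turns them into a function. *)
pose b cs := if pselect (size cs = n.+1 /\ uniq cs) is left h then
  sval (cid (der_Wcols i h.1 h.2)) else false.
have bE cs : cs \in S -> der (i, n) (Wcols V cs) =
    if (i, 0%N) \in cs then (-1) ^+ b cs *: Wcols V (rem (i, 0%N) cs) else 0.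
  move=> csS; rewrite /b; case: pselect => [h|nh].
    by case: cid.
  have sc := barcols_std (hS _ csS).
  by case: nh; split; [apply: stdcols_size sc|apply: stdcols_uniq sc].
have cs1T : cs1 \in T by rewrite mem_filter c1 i1.
have : (-1) ^+ b cs1 * c cs1 = 0.
  apply: (@std_independent_map n _ T (fun cs => (-1) ^+ b cs * c cs) (rem (i, 0%N))) => //.
  - exact: filter_uniq.
  - move=> cs cs' /TS [csS _ ics] /TS [csS' _ ics'].
    exact: (rem_stdcols_inj (barcols_std (hS _ csS)) (barcols_std (hS _ csS'))).
  - rewrite -[RHS]der0E der_sum big_filter big_mkcond /=.
    apply: eq_big_seq => cs csS; rewrite derZ bE //.
    have [->|cn] := eqVneq (c cs) 0; first by rewrite scale0r.
    by case: (_ \in cs); rewrite /= ?scaler0 // scalerA mulrC.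
by move/eqP; rewrite mulf_eq0 signr_eq0 (negbTE c1).
Qed.

Lemma bar_not_low n cs : barcols n.+1 cs -> ~ low n (Wcols V cs).
Proof.
move=> bc lW; have := @bar_independent n [:: cs] (fun=> 1) isT.
have h : forall cs', cs' \in [:: cs] -> barcols n.+1 cs' by move=> cs'; rewrite inE => /eqP ->.
move=> /(_ h); rewrite big_seq1 scale1r => /(_ lW cs (mem_head _ _)) /eqP.
by rewrite oner_eq0.
Qed.

Lemma Wcols_bar_inj n cs cs' : barcols n.+1 cs -> barcols n.+1 cs' ->
  Wcols V cs = Wcols V cs' -> cs = cs'.
Proof.
move=> bc bc' e; apply/eqP; apply: contraT => ne.
have := @bar_independent n [:: cs; cs'] (fun t => if t == cs then 1 else -1).
rewrite /= inE ne => /(_ isT).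
have h : forall t, t \in [:: cs; cs'] -> barcols n.+1 t by move=> t; rewrite !inE => /orP [] /eqP ->.
move=> /(_ h); rewrite !big_cons big_nil eqxx (eq_sym cs') (negbTE ne) e scale1r scaleN1r addr0 subrr.
move=> /(_ (supported0 _) cs (mem_head _ _)) /eqP; by rewrite eqxx oner_eq0.
Qed.

(** Satisfied by the minors, since a minor of degree d has order below d, and stable under products
    because the degrees add up. *)
Definition graded_low n m : Prop := (mdeg m <= n.+1)%N -> ordlt (mdeg m) m.

(* With graded_low, this makes a subalgebra: a product of two factors of positive
   degree contributes no monomial of order n in degree n + 1. *)
Definition top_part n (B : seq Var -> Prop) P : Prop :=
  supported (graded_low n) P /\
  exists2 L : V, colspan B L & forall m, mdeg m = n.+1 -> ~ ordlt n m -> coef m P = coef m L.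

Lemma cone_low n : ordlt n (@cone Var).
Proof. by move=> x; rewrite coneE. Qed.

Lemma top_part_linear n B c P Q : top_part n B P -> top_part n B Q -> top_part n B (c *: P + Q).
Proof.
move=> [gP [L hL eL]] [gQ [L' hL' eL']]; split; first exact: supported_linear.
exists (c *: L + L'); first exact: colspan_linear.
by move=> m dm om; rewrite !coef_linear eL // eL'.
Qed.

Lemma top_part1 n B : top_part n B (1 : V).
Proof.
split; first by rewrite -mon_one; apply: supported_mon => _; apply: cone_low.
exists 0; first exact: colspan0.
move=> m dm _; rewrite coefm0 -mon_one coef_mon; case: (cone =P m) => // e.
by rewrite -e mdeg_cone in dm.
Qed.

Lemma graded_low_mul n m1 m2 : graded_low n m1 -> graded_low n m2 -> graded_low n (cmul m1 m2).
Proof.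
move=> g1 g2; rewrite /graded_low mdeg_cmul => dm x; rewrite cmulE addn_gt0.
by case/orP => [/g1|/g2] => /(_ ltac:(lia)); lia.
Qed.

Lemma top_part_mul n B P Q : top_part n B P -> top_part n B Q -> top_part n B (P * Q).
Proof.
move=> [gP [L hL eL]] [gQ [L' hL' eL']]; split.
  by apply: (supportedM _ gP gQ) => m1 m2; apply: graded_low_mul.
have colspanZ c M : colspan B M -> colspan B (c *: M).
  by move=> hM; rewrite -[c *: M]addr0; apply: colspan_linear => //; apply: colspan0.
(* Write P = p + P1 and Q = q + Q1 without constant terms in P1 and Q1. In degree n + 1, P1 Q1 has
   factors of degree at most [n], hence order below [n]; only p Q and q P1 contribute. *)
exists (coef cone P *: L' + coef cone Q *: L).
  by apply: colspan_linear => //; apply: colspanZ.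
move=> m dm om; set p := coef cone P; set q := coef cone Q.
pose P1 := P - p *: 1; pose Q1 := Q - q *: 1.
have PE : P = p *: 1 + P1 by rewrite addrC subrK.
have QE : Q = q *: 1 + Q1 by rewrite addrC subrK.
have m1 : m != cone by apply: contra_eqN dm => /eqP ->; rewrite mdeg_cone.
have c1 u (M : V) : coef u (M - coef cone M *: 1) = if u == cone then 0 else coef u M.
  rewrite addrC -scaleNr coef_linear -mon_one coef_mon eq_sym.
  by case: eqP => [->|_]; rewrite ?mulr1 ?addNr ?mulr0 ?add0r.
have cPQ : coef m (P1 * Q1) = 0.
  apply/eqP; apply: contraT => /coefmM [u1 [u2 [h1 h2 mE]]]; case: om.
  have [u1n cu1] : u1 != cone /\ coef u1 P != 0.
    by move: h1; rewrite /P1 c1; case: (u1 =P cone); rewrite ?eqxx.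
  have [u2n cu2] : u2 != cone /\ coef u2 Q != 0.
    by move: h2; rewrite /Q1 c1; case: (u2 =P cone); rewrite ?eqxx.
  have d1 : (0 < mdeg u1)%N.
    by rewrite lt0n; apply: contra u1n => /eqP /mdeg_eq0_cone ->.
  have d2 : (0 < mdeg u2)%N.
    by rewrite lt0n; apply: contra u2n => /eqP /mdeg_eq0_cone ->.
  rewrite mE mdeg_cmul in dm; rewrite mE; apply: ordlt_cmul.
    by apply: (@ordltW _ (mdeg u1)); [|apply: gP]; lia.
  by apply: (@ordltW _ (mdeg u2)); [|apply: gQ]; lia.
have -> : P * Q = p *: Q + (q *: P1 + P1 * Q1).
  rewrite {1}PE mulrDl -scalerAl mul1r; congr (_ + _).
  by rewrite {1}QE mulrDr -scalerAr mulr1.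
rewrite coef_linear coefmD cPQ addr0 coefmZ c1 (negbTE m1) coef_linear coefmZ.
by rewrite eL // eL'.
Qed.

Lemma Wcols_top_part n B d cs : barcols d.+1 cs -> (d = n -> B cs) -> top_part n B (Wcols V cs).
Proof.
move=> bc hB; have sc := stdcols_size (barcols_std bc).
have hom : homdeg d.+1 (Wcols V cs) by rewrite -sc; apply: Wcols_hom.
have lw : low d.+1 (Wcols V cs) by rewrite -sc; apply: Wcols_low.
split; first by move=> m cm _; rewrite (hom _ cm); apply: lw.
have [dn|nd] := eqVneq d n.
  by exists (Wcols V cs); first by apply: colspan_W; apply: hB.
exists 0; first exact: colspan0.
move=> m dm _; rewrite coefm0; apply/eqP; apply: contraT => /hom.
by rewrite dm => -[] /eqP; rewrite eq_sym (negbTE nd).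
Qed.

(** Otherwise subtracting [L] from the minor leaves order below [n], a relation forbidden by
    [bar_independent]. *)
Theorem Wcols_not_top_part n cs (B : seq Var -> Prop) : barcols n.+1 cs ->
  (forall cs', B cs' -> barcols n.+1 cs') -> ~ B cs -> ~ top_part n B (Wcols V cs).
Proof.
move=> bc hB nB [_ [L [S [c [uS hS ->]]] eL]].
have csS : cs \notin S by apply/negP => /hS.
have hS' t : t \in cs :: S -> barcols n.+1 t.
  by rewrite inE => /orP [/eqP ->|/hS /hB].
have uS' : uniq (cs :: S) by rewrite /= csS.
have := @bar_independent n (cs :: S) (fun t => if t == cs then -1 else c t) uS' hS'.
rewrite big_cons eqxx (eq_big_seq (fun t => c t *: Wcols V t)); last first.
  by move=> t tS /=; case: eqP => // e; rewrite -e tS in csS.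
move: eL; set M := \sum_(t <- S) _ => eL.
have hom (t : seq Var) : barcols n.+1 t -> homdeg n.+1 (Wcols V t).
  by move=> /barcols_std /stdcols_size <-; apply: Wcols_hom.
have homM' : homdeg n.+1 M.
  rewrite /M big_seq; apply: supported_sum => t tS; apply: supportedZ.
  exact/hom/hB/hS.
have lowD : low n (-1 *: Wcols V cs + M).
  move=> m cm; apply: contrapT => om; case/eqP: cm.
  have dm : coef m (Wcols V cs) != 0 \/ coef m M != 0 -> mdeg m = n.+1.
    by case=> [/(hom _ bc)|/homM'].
  rewrite coef_linear; have [e|ne] := eqVneq (coef m (Wcols V cs)) 0.
    rewrite e mulr0 add0r; apply/eqP; apply: contraT => h.
    have md := dm (or_intror h); by rewrite -(eL m md om) e eqxx in h.
  by rewrite (eL m) ?mulN1r ?addNr //; apply: dm; left.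
move=> /(_ lowD cs (mem_head _ _)) /eqP; by rewrite eqxx oppr_eq0 oner_eq0.
Qed.

End Independence.

(** * Counting *)

Section Words.
Variable N : nat.
Local Notation Var := ('I_N.+1 * nat)%type.
Implicit Types (i f l : 'I_N.+1) (u v : seq 'I_N.+1) (alpha : 'I_N.+1 -> seq nat).

(* [ranks u i] lists the positions of the letter [i] in the subword of the
   letters [<= i] of [u]; it turns words into standard sequences bijectively. *)
Fixpoint ranks u : 'I_N.+1 -> seq nat :=
  if u is f :: u' then fun i =>
    if (i < f)%N then ranks u' i
    else if i == f then 0%N :: map S (ranks u' f) else map S (ranks u' i)
  else fun=> [::].

Definition bar_word u : bool := if u is f :: u' then nilp u' || (last f u' < f)%N else false.

Lemma ranks_lt f u i : (i < f)%N -> ranks (f :: u) i = ranks u i.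
Proof. by move=> /= ->. Qed.

Lemma ranks_eq f u : ranks (f :: u) f = 0%N :: map S (ranks u f).
Proof. by rewrite /= ltnn eqxx. Qed.

Lemma ranks_gt f u i : (f < i)%N -> ranks (f :: u) i = map S (ranks u i).
Proof. by move=> /= fi; rewrite ltnNge ltnW // -val_eqE /= gtn_eqF. Qed.

Lemma size_ranks u i : size (ranks u i) = count_mem i u.
Proof.
elim: u i => // f u IH i; case: (ltngtP i f) => [lt|gt|/val_inj ->].
- by rewrite ranks_lt // IH /= -val_eqE /= gtn_eqF.
- by rewrite ranks_gt // size_map IH /= -val_eqE /= ltn_eqF.
- by rewrite ranks_eq /= size_map IH eqxx.
Qed.

Lemma partial_size_ranks u i : partial_size (ranks u) i = count (fun j : 'I_N.+1 => j <= i)%N u.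
Proof. by rewrite -sum_count; apply: eq_bigr => j _; rewrite size_ranks. Qed.

Lemma last_map_succ (t : seq nat) : (0 < size t)%N -> last 0%N (map S t) = (last 0%N t).+1.
Proof. by case: t => //= a t _; rewrite last_map. Qed.

Lemma ranks_std u : is_std (size u) (ranks u).
Proof.
split; last first.
  under eq_bigr do rewrite size_ranks.
  by rewrite (sum_count predT) count_predT.
move=> i; rewrite partial_size_ranks; elim: u i => // f u IH i.
have smap (t : seq nat) : sorted ltn (map S t) = sorted ltn t by rewrite sorted_map.
case: (ltngtP i f) => [lt|gt|/val_inj ->].
- by rewrite ranks_lt // => /IH; rewrite /= [(f <= i)%N]leqNgt lt.
- rewrite ranks_gt // size_map => si; have [so la] := IH i si.
  by rewrite smap last_map_succ //= (ltnW gt) add1n ltnS.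
- rewrite ranks_eq /= => _; rewrite leqnn add1n ltnS; have := IH f.
  case: (ranks u f) => [|a t] //= /(_ isT) [so la].
  by rewrite last_map path_map.
Qed.

Lemma ranks_rcons u l i : ranks (rcons u l) i =
  if i == l then rcons (ranks u i) (count (fun j : 'I_N.+1 => j <= i)%N u) else ranks u i.
Proof.
elim: u i => [|f u IH] i.
  case: (ltngtP i l) => [lt|gt|/val_inj ->]; last by rewrite eqxx ranks_eq.
    by rewrite /= lt; case: eqP => // e; rewrite e ltnn in lt.
  by rewrite ranks_gt //=; case: eqP => // e; rewrite e ltnn in gt.
rewrite rcons_cons; case: (ltngtP i f) => [lt|gt|/val_inj ->].
- by rewrite !ranks_lt // IH /= leqNgt lt.
- by rewrite !ranks_gt // IH /= (ltnW gt) add1n; case: eqP => // _; rewrite map_rcons.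
- by rewrite !ranks_eq IH /= leqnn add1n; case: eqP => // _; rewrite map_rcons.
Qed.

Lemma top_zero_ranks f u : top_zero (ranks (f :: u)) f.
Proof.
split=> [||j fj]; rewrite ?ranks_eq ?ranks_gt //.
by apply/negP => /mapP [].
Qed.

(** The last exponent of a letter j reaches its maximum exactly when j comes last among the letters
    at most j. The last letter [l] of the word always does, so it must be below [f]; in that case no
    letter from [f] on does. *)
Lemma zero_last_ranks f u : zero_last (ranks (f :: u)) f <-> bar_word (f :: u).
Proof.
case/lastP: u => [|u l].
  split=> // _; split=> [|j fj]; first by rewrite ranks_eq.
  by rewrite ranks_gt.
have -> : bar_word (f :: rcons u l) = (l < f)%N.
  by rewrite /= last_rcons; case: u.
rewrite -rcons_cons; have ps i : partial_size (ranks (rcons (f :: u) l)) i =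
    (count (fun j : 'I_N.+1 => j <= i)%N (f :: u) + (l <= i))%N.
  by rewrite partial_size_ranks -cats1 count_cat /= addn0.
split=> [[z1 z2]|lf].
  rewrite ltnNge leq_eqVlt; apply/negP => /orP [/eqP/val_inj e|fl].
    move: z1; rewrite ps ranks_rcons e eqxx last_rcons size_rcons leqnn addn1 [_.-1]/=.
    by rewrite size_ranks /= eqxx ltnn => /(_ isT).
  have := z2 l fl; rewrite ps ranks_rcons eqxx last_rcons size_rcons leqnn addn1 /=.
  by move=> /(_ isT); rewrite ltnn.
have le (j : 'I_N.+1) : (f <= j)%N -> (0 < size (ranks (rcons (f :: u) l) j))%N ->
    (last 0%N (ranks (rcons (f :: u) l) j) < (partial_size (ranks (rcons (f :: u) l)) j).-1)%N.
  move=> fj; have lj := leq_trans lf fj; rewrite ps ranks_rcons.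
  rewrite ifN; last by rewrite -val_eqE /= gtn_eqF.
  rewrite (ltnW lj) addn1 -partial_size_ranks.
  by move=> sj; have [_ ->] := (ranks_std (f :: u)).1 j sj.
split=> [s1|j fj]; first by apply: le => //; apply: ltnW.
by apply: le; apply: ltnW.
Qed.

Lemma ranks_bar u : (0 < size u)%N -> Sigma_bar (size u) (ranks u) <-> bar_word u.
Proof.
case: u => // f u _; have h := Sigma_barP (ranks_std (f :: u)) (top_zero_ranks f u).
by rewrite -h zero_last_ranks.
Qed.

(** The first letter is recovered as the largest one carrying the exponent 0. *)
Lemma ranks_inj u v : size u = size v -> ranks u =1 ranks v -> u = v.
Proof.
elim: u v => [|f u IH] [|g v] // [suv] e.
have fg : f = g.
  have [sf hf nf] := top_zero_ranks f u; have [sg hg ng] := top_zero_ranks g v.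
  have mem0 (t : seq nat) : (0 < size t)%N -> head 0%N t = 0%N -> 0%N \in t.
    by case: t => //= a t _ ->; apply: mem_head.
  apply/val_inj/eqP; case: ltngtP => // h.
    by have := nf g h; rewrite e mem0.
  by have := ng f h; rewrite -e mem0.
subst g; congr cons; apply: IH => // i; have := e i.
case: (ltngtP i f) => [lt|gt|/val_inj ->].
- by rewrite !ranks_lt.
- by rewrite !ranks_gt // => /(inj_map succn_inj).
- by rewrite !ranks_eq => -[] /(inj_map succn_inj).
Qed.

Lemma std_columns_inj d d' alpha beta : is_std d alpha -> is_std d' beta ->
  columns alpha = columns beta -> alpha =1 beta.
Proof.
have so e gam i : is_std e gam -> sorted ltn (gam i).
  move=> [std _]; have [s0|s0] := posnP (size (gam i)); first by rewrite (size0nil s0).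
  exact: (std i s0).1.
move=> sa sb eab i; apply: (irr_sorted_eq ltn_trans ltnn); rewrite ?(so _ _ _ sa) ?(so _ _ _ sb) //.
by move=> a; rewrite -!mem_columns eab.
Qed.

(** Inverse of the step of [ranks] that puts the letter [f] in front. *)
Definition peel alpha f : 'I_N.+1 -> seq nat := fun i =>
  if (i < f)%N then alpha i
  else if i == f then map predn (behead (alpha f)) else map predn (alpha i).

Lemma peel_std n alpha f : is_std n.+1 alpha -> top_zero alpha f -> is_std n (peel alpha f).
Proof.
move=> [std sd] [sf hf nz].
have szf : size (alpha f) = (size (peel alpha f f)).+1.
  by rewrite /peel ltnn eqxx size_map size_behead prednK.
have szl l : l != f -> size (alpha l) = size (peel alpha f l).
  by rewrite /peel => /negbTE ->; case: ifP; rewrite ?size_map.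
have psz i := partial_size_sub i szf szl.
split; last by apply: succn_inj; rewrite -(sum_size_sub szf szl).
have pred_last (t : seq nat) (p : nat) : (0 < size t)%N -> 0%N \notin t ->
    (last 0%N t < 1 + p)%N -> (last 0%N (map predn t) < p)%N.
  move=> st nt; have -> : last 0%N (map predn t) = (last 0%N t).-1.
    exact: (last_map predn t 0%N).
  have : last 0%N t != 0%N.
    by apply: contraNneq nt => <-; case: (t) st => //= a s _; apply: mem_last.
  by lia.
move=> i; have := psz i; case: (ltngtP i f) => [lt|gt|/val_inj ->] pi.
- have -> : peel alpha f i = alpha i by rewrite /peel lt.
  by rewrite add0n in pi; rewrite -pi; apply: std.
- have -> : peel alpha f i = map predn (alpha i).
    by rewrite /peel ltnNge ltnW //= ifN // -val_eqE /= gtn_eqF.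
  rewrite size_map => si; have [st la] := std i si; have nzi := nz i gt.
  by split; [apply: sorted_pred|apply: pred_last; rewrite -?pi].
- have -> : peel alpha f f = map predn (behead (alpha f)).
    by rewrite /peel ltnn eqxx.
  rewrite size_map => sb; have [st la] := std f sf.
  case: (alpha f) hf sb st la => //= a t -> sb st; rewrite pi => la.
  have nt : 0%N \notin t.
    by apply/negP => /(allP (order_path_min ltn_trans st)).
  split; first by apply: sorted_pred => //; apply: path_sorted st.
  by apply: pred_last => //; case: (t) sb la.
Qed.

Lemma peel_ranks n alpha f u : is_std n.+1 alpha -> top_zero alpha f ->
  peel alpha f =1 ranks u -> alpha =1 ranks (f :: u).
Proof.
move=> [std sd] [sf hf nz] e i; have := e i; rewrite /peel.
have predK (t : seq nat) : 0%N \notin t -> map S (map predn t) = t.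
  move=> nt; rewrite -map_comp -[RHS]map_id; apply/eq_in_map => x xt /=.
  by case: x xt nt => //= ->.
case: (ltngtP i f) => [lt|gt|/val_inj ->].
- by rewrite ranks_lt.
- rewrite ranks_gt // ifN; last by rewrite -val_eqE /= gtn_eqF.
  by move=> <-; rewrite predK // nz.
- rewrite eqxx ranks_eq => <-; have [st _] := std f sf.
  case: (alpha f) sf hf st => //= a t _ -> st; rewrite predK //.
  by apply/negP => /(allP (order_path_min ltn_trans st)).
Qed.

Lemma std_ranks d alpha : is_std d alpha -> exists2 u, size u = d & alpha =1 ranks u.
Proof.
elim: d alpha => [|d IH] alpha sa.
  exists [::] => // i; case: sa => _ /eqP; rewrite sum_nat_eq0 => /forall_inP /(_ i isT).
  by move/eqP/size0nil.
have [f tf] := top_zero_exists sa (ltn0Sn d).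
have [u su e] := IH _ (peel_std sa tf); exists (f :: u); first by rewrite /= su.
exact: peel_ranks sa tf e.
Qed.

Definition bar_words d : {set d.-tuple 'I_N.+1} := [set u : d.-tuple _ | bar_word u].

Lemma barcols_words d cs : (0 < d)%N ->
  barcols d cs <-> exists2 u, u \in bar_words d & cs = columns (ranks u).
Proof.
move=> d0; split=> [[alpha ba ->]|[u + ->]]; last first.
  rewrite inE => bu; exists (ranks u) => //.
  by rewrite -{1}(size_tuple u) ranks_bar ?size_tuple.
have [u /eqP su e] := std_ranks (Sigma_bar_std ba).
have ee : alpha = ranks (Tuple su) by apply: funext.
exists (Tuple su); last by rewrite ee.
rewrite inE; apply: (ranks_bar _).1; first by rewrite size_tuple.
by rewrite size_tuple -ee.
Qed.

Lemma columns_ranks_inj d (u v : d.-tuple 'I_N.+1) :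
  columns (ranks u) = columns (ranks v) -> u = v.
Proof.
move=> /(std_columns_inj (ranks_std u) (ranks_std v)) e.
by apply/val_inj/ranks_inj; rewrite ?size_tuple.
Qed.

Lemma card_bar_words1 : #|bar_words 1| = N.+1.
Proof.
rewrite -[RHS]expn1 -[X in (X ^ 1)%N]card_ord -card_tuple -cardsT; congr #|pred_of_set _|.
by apply/setP => u; rewrite !inE; case/tupleP: u => f u; rewrite tuple0.
Qed.

(** Such a word is a first letter, a smaller last letter and [n] free letters between them. *)
Lemma card_bar_words n : #|bar_words n.+2| = ((N * N.+1) %/ 2 * N.+1 ^ n)%N.
Proof.
have -> : ((N * N.+1) %/ 2)%N = #|[set p : 'I_N.+1 * 'I_N.+1 | p.2 < p.1]%N|.
  rewrite mulnC divn2 -[LHS]/((N.+1 * N.+1.-1)./2) -bin2 -bin2_sum big_mkord.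
  rewrite -sum1_card (eq_bigl (fun p : 'I_N.+1 * 'I_N.+1 => true && (p.2 < p.1)%N)); last first.
    by move=> p; rewrite inE.
  rewrite -(pair_big_dep xpredT (fun f l : 'I_N.+1 => (l < f)%N) (fun _ _ => 1%N)) /=.
  apply: eq_bigr => f _; rewrite sum1_card -[LHS]card_ord.
  have lef : (f <= N.+1)%N by apply: ltnW.
  have injw : injective (widen_ord lef) by move=> a b /(congr1 val) /= /val_inj.
  rewrite -(card_imset _ injw); apply: eq_card => l.
  apply/imsetP/idP => [[j _ ->]|lf]; first by case: j.
  by exists (Ordinal lf) => //; apply: val_inj.
rewrite -[X in (X ^ n)%N]card_ord -card_tuple -cardsT -cardsX.
pose F (p : ('I_N.+1 * 'I_N.+1) * n.-tuple 'I_N.+1) : n.+2.-tuple 'I_N.+1 :=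
  [tuple of p.1.1 :: rcons p.2 p.1.2].
have injF : injective F.
  move=> [[f l] t] [[f' l'] t'] /(congr1 val) /= [->] /rcons_inj [+ ->].
  by move/val_inj => ->.
rewrite -(card_imset _ injF); apply: eq_card => u; rewrite inE.
apply/idP/imsetP => [|[[[f l] t] + ->]]; last first.
  by rewrite !inE andbT /= last_rcons => ->; rewrite orbT.
case: u => [[|f s] //= su]; case/lastP: s su => [|t l] // su.
rewrite last_rcons => lf; have {}lf : (l < f)%N by case: (t) lf.
have st : size t == n by move: su; rewrite /= size_rcons.
by exists ((f, l), Tuple st); [rewrite !inE andbT|apply: val_inj].
Qed.

End Words.

Lemma card_image_finset (T : finType) (U : Type) (D : {set T}) (F : T -> U) :
  {in D &, injective F} -> (((fun x => F x) @` [set x | x \in D]) #= `I_#|D|)%classic%card.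
Proof.
move=> injF; have -> : (F @` [set x | x \in D] = (F \o enum_val) @` [set: 'I_#|D|])%classic.
  apply/seteqP; split=> [_ [x /= xD <-]|_ [i _ <-]] /=.
    by exists (enum_rank_in xD x) => //=; rewrite enum_rankK_in.
  by exists (enum_val i) => //; apply: enum_valP.
apply: (card_eq_trans (inj_card_eq _)); last by rewrite card_eq_sym; apply: card_II.
by move=> i j _ _ /= /injF e; apply: enum_val_inj; apply: e; apply: enum_valP.
Qed.

(** * The algebra of differentially homogeneous polynomials *)

Section InvariantAlgebra.
Variables (K : numFieldType) (N : nat).
Local Notation Var := ('I_N.+1 * nat)%type.
Variable V : polyAlg Var K.
Implicit Types (P Q : V) (m : {cmonom Var}) (cs : seq Var).

Lemma fps_unit_geo (c : K) : fps_unit (geo c).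
Proof.
(* The inverse series is 1 - c T. *)
exists (fun n => if n is n'.+1 then (if n' is 0%N then - c else 0) else 1).
apply: funext => -[|n]; rewrite /fps_mul /fps_one /geo.
  by rewrite big_ord1 expr0 mulr1.
rewrite !big_ord_recr /= subnn mulr1 subSn // subnn big1 => [|i _]; last first.
  have : (1 < n.+1 - i)%N by have := ltn_ord i; lia.
  by case: (n.+1 - i)%N => [|[|d]] //; rewrite mulr0.
by rewrite add0r mulrN -exprSr addNr.
Qed.

Definition fps_const (c : K) : nat -> K := fun n => if n is 0%N then c else 0.

Lemma fps_unit_const (c : K) : c != 0 -> fps_unit (fps_const c).
Proof.
move=> c0; exists (fps_const c^-1); apply: funext => -[|n]; rewrite /fps_mul /fps_one.
  by rewrite big_ord1 /= mulfV.
rewrite big1 // => -[[|i] lt] _ /=; last by rewrite mul0r.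
by rewrite mulr0.
Qed.

Lemma coef_dact_const c m P : coef m (dact (fps_const c) P) = c ^+ mdeg m * coef m P.
Proof.
have var x : dact_var V (fps_const c) x = c *: mon (cvar x).
  case: x => i j; rewrite /dact_var big_ord_recr /= subnn binn mul1r mulr1n big1 ?add0r //.
  move=> l _; have : (j - l != 0)%N by rewrite -lt0n subn_gt0.
  by case: (j - l)%N => // d _; rewrite /= mul0rn mulr0 scale0r.
have E m' : dact (fps_const c) (mon m' : V) = c ^+ mdeg m' *: mon m'.
  rewrite /dact aev_mon; elim/cmonom_ind: m' => [|x m' IH].
    by rewrite mon_eval_one mdeg_cone scale1r mon_one.
  rewrite mon_eval_mul mon_eval_var IH var mdeg_cmul mdeg_cvar mon_mul.
  by rewrite -scalerAl -scalerAr scalerA exprS.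
elim/malg_lin_ind: P => [|a m' P IH]; first by rewrite /dact aev0 !coefm0 mulr0.
rewrite dactD dactZ E !coefmD !coefmZ IH coef_mon mulrDr; congr (_ + _).
by rewrite mulrCA; case: eqP => [->|_] //; rewrite !mulr0.
Qed.

Definition dhom d P : Prop := forall a, fps_unit a -> dact a P = a 0%N ^+ d *: P.

(** The constant unit 2 multiplies a monomial by 2 to the power of its degree, and these powers are
    distinct in characteristic 0. *)
Lemma dhom_homdeg d P : dhom d P -> homdeg d P.
Proof.
move=> h m cm; have := h _ (fps_unit_const (_ : 2 != 0 :> K)) => /(_ _)/(congr1 (coef m)).
rewrite pnatr_eq0 => /(_ isT); rewrite coef_dact_const coefmZ => /(mulIf cm).
by apply: ieexprIn; rewrite ?ltr0n ?pnatr_eq1.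
Qed.

Lemma dhom_geo c d P : dhom d P -> dact (geo c) P = P.
Proof. by move=> /(_ _ (fps_unit_geo c)); rewrite /geo expr0 expr1n scale1r. Qed.

Lemma dhom0 d : dhom d 0.
Proof. by move=> a _; rewrite /dact aev0 scaler0. Qed.

Lemma dhomD d P Q : dhom d P -> dhom d Q -> dhom d (P + Q).
Proof. by move=> hP hQ a ua; rewrite dactD hP // hQ // scalerDr. Qed.

Lemma dhomZ d c P : dhom d P -> dhom d (c *: P).
Proof. by move=> hP a ua; rewrite dactZ hP // !scalerA mulrC. Qed.

Lemma dhomM d e P Q : dhom d P -> dhom e Q -> dhom (d + e) (P * Q).
Proof.
by move=> hP hQ a ua; rewrite dactM hP // hQ // -scalerAl -scalerAr scalerA exprD.
Qed.

Lemma dhom1 : dhom 0 1.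
Proof. by move=> a _; rewrite dact1 scale1r. Qed.

Lemma dhom_Wcols cs : dhom (size cs) (Wcols V cs).
Proof. by move=> a _; apply: dact_Wcols. Qed.

Definition vdiff P : Prop := exists n (p : nat -> V),
  (forall d, dhom d (p d)) /\ P = \sum_(d < n) p d.

Lemma vdiff_dhom d P : dhom d P -> vdiff P.
Proof.
move=> h; exists d.+1, (fun e => if e == d then P else 0); split=> [e|].
  by case: eqP => [->//|_]; apply: dhom0.
rewrite big_ord_recr /= eqxx big1 ?add0r // => i _.
by rewrite ltn_eqF.
Qed.

Lemma vdiffD P Q : vdiff P -> vdiff Q -> vdiff (P + Q).
Proof.
move=> [n [p [hp ->]]] [n' [q [hq ->]]]; exists (n + n')%N.
exists (fun d => (if (d < n)%N then p d else 0) + (if (d < n')%N then q d else 0)); split.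
  by move=> d; apply: dhomD; case: ifP => // _; apply: dhom0.
rewrite big_split /= -!big_mkcond; congr (_ + _).
  by rewrite -big_ord_widen ?leq_addr.
by rewrite -big_ord_widen ?leq_addl.
Qed.

Lemma vdiff_linear c P Q : vdiff P -> vdiff Q -> vdiff (c *: P + Q).
Proof.
move=> [n [p [hp ->]]]; apply: vdiffD; exists n, (fun d => c *: p d).
by split=> [d|]; [apply: dhomZ|rewrite scaler_sumr].
Qed.

Lemma vdiffM P Q : vdiff P -> vdiff Q -> vdiff (P * Q).
Proof.
move=> [n [p [hp ->]]] [n' [q [hq ->]]]; rewrite mulr_suml.
have v0 : vdiff 0 by apply: (vdiff_dhom (dhom0 0)).
apply: big_ind => [//|P' Q'|d _]; first exact: vdiffD.
rewrite mulr_sumr; apply: big_ind => [//|P' Q'|e _]; first exact: vdiffD.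
exact: vdiff_dhom (dhomM (hp d) (hq e)).
Qed.

Lemma vdiff1 : vdiff 1.
Proof. exact: vdiff_dhom dhom1. Qed.

Definition gens k P : Prop := exists d cs,
  [/\ (1 <= d <= k.+1)%N, barcols d cs & P = Wcols V cs].

Lemma gens_vdiff k P : gens k P -> vdiff P.
Proof. by move=> [d [cs [_ _ ->]]]; apply: vdiff_dhom (@dhom_Wcols cs). Qed.

Lemma gens_low k P : gens k P -> low k.+1 P.
Proof.
move=> [d [cs [/andP [_ dk] bc ->]]].
by apply: lowW dk _; rewrite -(stdcols_size (barcols_std bc)); apply: Wcols_low.
Qed.

Lemma barcols1 (i : 'I_N.+1) : barcols 1 [:: (i, 0%N)].
Proof.
have -> : [:: (i, 0%N)] = columns (ranks [:: i]).
  have := mem_columns (ranks [:: i]) i 0; rewrite ranks_eq mem_head.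
  have := size_columns (ranks [:: i]); rewrite (ranks_std [:: i]).2.
  by case: columns => [|x [|]] //= _; rewrite inE => /eqP ->.
by exists (ranks [:: i]) => //; apply/ranks_bar.
Qed.

Lemma Wcols1 (i : 'I_N.+1) : Wcols V [:: (i, 0%N)] = dX V i 0.
Proof. by rewrite /Wcols det_mx11 mxE /dcolumn /= ffactn0. Qed.

Theorem gens_generate (A : V -> Prop) k P :
  A 1 -> (forall c P Q, A P -> A Q -> A (c *: P + Q)) ->
  (forall P Q, A P -> A Q -> A (P * Q)) ->
  (forall Q, gens k Q -> A Q) -> vdiff P -> low k.+1 P -> A P.
Proof.
move=> A1 AL AM AG [n [p [hp eP]]] lP.
have A0 : A 0 by have := AL (-1) _ _ A1 A1; rewrite scaleN1r addNr.
(* The components have distinct degrees, so none of their monomials cancels in [P]. *)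
have lp (d : 'I_n) : low k.+1 (p d).
  move=> m cm; apply: lP; rewrite eP coefm_sum (bigD1 d) //= big1 ?addr0 // => e ed.
  apply/eqP; apply: contraNT ed => /(dhom_homdeg (hp e)).
  by rewrite (dhom_homdeg (hp d) cm) => /val_inj ->.
have AX i : A (dX V i 0).
  by apply: AG; exists 1%N, [:: (i, 0%N)]; split=> //; [apply: barcols1|rewrite Wcols1].
rewrite eP; apply: big_ind => [//|Q Q' hQ hQ'|d _].
  by rewrite -[Q]scale1r; apply: AL.
apply: (invariant_in_algebra A1 AL AM _ (lp d)) => [e alpha ek sa|c]; last exact: dhom_geo (hp d).
apply: (std_in_algebra A1 AL AM _ AX ek sa) => e' beta ek' ba.
by apply: AG; exists e', (columns beta); split=> //; exists beta.
Qed.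

(** The separating subalgebra is [top_part] at the degree of [g], where [B] admits all the column
    lists of that degree but that of [g]; generators of other degrees have a zero top part. *)
Theorem gens_minimal k (S : V -> Prop) g : (forall P, S P -> gens k P) -> gens k g -> ~ S g ->
  exists A : V -> Prop, [/\ A 1, forall c P Q, A P -> A Q -> A (c *: P + Q),
    forall P Q, A P -> A Q -> A (P * Q), forall P, S P -> A P & ~ A g].
Proof.
move=> SG [[|n] [cs [// _ bc ge]]] nS; pose B t := barcols n.+1 t /\ t <> cs.
exists (@top_part _ _ V n B); split.
- exact: top_part1.
- by move=> c P Q; apply: top_part_linear.
- by move=> P Q; apply: top_part_mul.
- move=> P SP; have [[|d] [t [// _ bt Pe]]] := SG P SP; rewrite Pe.
  apply: (@Wcols_top_part _ _ V n B d t bt) => dn; split; first by rewrite -dn.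
  by move=> tc; apply: nS; rewrite ge -tc -Pe.
- by rewrite ge; apply: Wcols_not_top_part => // [t [//]|[]].
Qed.

End InvariantAlgebra.

(** * Transfer to the concrete algebra of differential polynomials *)

Section Concrete.
Variables (R : realType) (N : nat).
Local Notation Var := ('I_N.+1 * nat)%type.
Local Notation VV := (malg_polyAlg Var R[i]).

Lemma X_dX i j : @X R N i j = dX VV i j.
Proof. by rewrite /X /dX /= mmon.unlock cvar.unlock. Qed.

Lemma column_dcolumn i a j : @column R N i a j = dcolumn VV i a j.
Proof. by rewrite /column /dcolumn; case: ifP => _; [rewrite X_dX|]. Qed.

Lemma Wsubs_Wcols d alpha : size (columns alpha) = d -> @Wsubs R N d alpha = Wcols VV (columns alpha).
Proof.
move=> sz; apply: etrans (esym (Wcols_size VV sz)).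
congr determinant; apply/matrixP => j l; rewrite !mxE; exact: column_dcolumn.
Qed.

Lemma subalg_closedP (A : set (diffpoly R N)) :
  GRing.subalg_closed [in A] <->
  [/\ A 1, forall c P Q, A P -> A Q -> A (c *: P + Q) & forall P Q, A P -> A Q -> A (P * Q)].
Proof.
split=> [[h1 h2 h3]|[h1 h2 h3]].
  split; first exact: set_mem h1.
    by move=> c P Q hP hQ; apply: set_mem; apply: h2; apply: mem_set.
  by move=> P Q hP hQ; apply: set_mem; apply: h3; apply: mem_set.
split; first exact: mem_set h1.
  by move=> c P Q /set_mem hP /set_mem hQ; apply: mem_set; apply: h2.
by move=> P Q /set_mem hP /set_mem hQ; apply: mem_set; apply: h3.
Qed.

Lemma iter_fps_deriv s (a : nat -> R[i]) n : iter s (@fps_deriv _) a n = a (n + s)%N *+ (n + s) ^_ s.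
Proof.
elim: s n => [|s IH] n; first by rewrite addn0 ffactn0.
rewrite iterS /fps_deriv IH addSnnS -mulrnA; congr (_ *+ _).
by rewrite ffactnSr addnS subSn ?leq_addl // addnK.
Qed.

Lemma act_dact a (P : diffpoly R N) : act a P = dact (V := VV) a P.
Proof.
have var x : @act_var R N a x.1 x.2 = dact_var VV a x.
  rewrite /act_var /dact_var; apply: eq_bigr => j _; rewrite X_dX /fps_at0 iter_fps_deriv.
  by rewrite add0n ffactnn.
have ev (m : {cmonom Var}) :
    \prod_(x <- finsupp m) @act_var R N a x.1 x.2 ^+ m x = mon_eval (dact_var VV a) m.
  by apply: eq_bigr => x _; rewrite var.
rewrite /act /mmap /dact /aev; apply: eq_bigr => m _; rewrite ev.
transitivity (mcoef m P *: mon_eval (dact_var VV a) m : diffpoly R N); last by reflexivity.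
by rewrite -mul_malgC mcoef.unlock; reflexivity.
Qed.

Lemma malg_supp (m : {cmonom Var}) (P : diffpoly R N) :
  (m \in msupp P) = (@coef _ _ VV m P != 0).
Proof. exact: (@supp_mem _ _ VV m P). Qed.

Lemma homog_homdeg d (P : diffpoly R N) : homog R N d P <-> homdeg (V := VV) d P.
Proof. by split=> h m; [rewrite -malg_supp; apply: h|rewrite malg_supp; apply: h]. Qed.

Lemma diff_homog_dhom d (P : diffpoly R N) : diff_homog R N d P <-> dhom (V := VV) d P.
Proof. by split=> h a /h; rewrite -?act_dact // act_dact. Qed.

Lemma Vdiff_vdiff (P : diffpoly R N) : Vdiff R N P <-> vdiff (V := VV) P.
Proof.
by split=> -[n [p [hp eP]]]; exists n, p; split=> // d; apply/diff_homog_dhom.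
Qed.

Lemma order_le_low k (P : diffpoly R N) : order_le R N k P <-> low (V := VV) k.+1 P.
Proof.
split=> [h|h].
  apply: (h [set Q : diffpoly R N | low (V := VV) k.+1 Q]%classic); split.
    apply/subalg_closedP; split; first exact: (@low1 _ _ VV).
      by move=> c Q Q'; apply: supported_linear.
    by move=> Q Q'; apply: lowM.
  by move=> _ [i [j [jk ->]]]; rewrite X_dX; apply: low_dX.
move=> A [/subalg_closedP [A1 AL AM] AX].
have A0 : A 0 by have := AL (-1) _ _ A1 A1; rewrite scaleN1r addNr.
have AZ : forall c Q, A Q -> A (c *: Q) by move=> c Q AQ; rewrite -[c *: Q]addr0; apply: AL.
have Am (m : {cmonom Var}) : ordlt k.+1 m -> A (@mon _ _ VV m).
  elim/cmonom_ind: m => [|[i j] m IH] om; first by rewrite mon_one.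
  rewrite mon_mul; apply: AM.
    apply: AX; exists i, j; split; last by rewrite X_dX.
    by rewrite -ltnS; apply: (om (i, j)); rewrite cmulE cvarE eqxx.
  by apply: IH => x mx; apply: om; rewrite cmulE ltn_addl.
rewrite (@supp_sum _ _ VV P).
apply: (@lincomb_closed _ _ VV A A0 AL) => m; rewrite supp_mem => /h; exact: Am.
Qed.

Lemma constants_low (P : diffpoly R N) : constants R N P -> low (V := VV) 0 P.
Proof.
move=> [c _ <-]; have -> : malgC c = c *: (1 : diffpoly R N) by rewrite -mul_malgC mulr1.
by apply: supportedZ; exact: (@low1 _ _ VV 0).
Qed.

Lemma G_Wcols d (P : diffpoly R N) :
  G R N d P <-> exists2 cs, barcols d cs & P = Wcols VV cs.
Proof.
have sz alpha : Sigma_bar d alpha -> size (columns alpha) = d.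
  by move=> /Sigma_bar_std [_ sd]; rewrite size_columns.
split=> [[alpha ba <-]|[_ [alpha ba ->] ->]].
  by exists (columns alpha); [exists alpha|apply: Wsubs_Wcols; apply: sz].
by exists alpha => //; apply: Wsubs_Wcols; apply: sz.
Qed.

Lemma generators_gens k (P : diffpoly R N) : generators R N k P <-> gens (V := VV) k P.
Proof.
split=> [[d dk /G_Wcols [cs bc Pe]]|[d [cs [dk bc Pe]]]]; first by exists d, cs.
by exists d => //; apply/G_Wcols; exists cs.
Qed.

Lemma subalg_genP (S : set (diffpoly R N)) P : subalg_gen S P <->
  forall A : diffpoly R N -> Prop, A 1 -> (forall c P Q, A P -> A Q -> A (c *: P + Q)) ->
    (forall P Q, A P -> A Q -> A (P * Q)) -> (forall Q, S Q -> A Q) -> A P.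
Proof.
split=> [h A A1 AL AM AS|h A [/subalg_closedP [A1 AL AM] AS]]; last exact: h.
by apply: (h A); split=> //; apply/subalg_closedP.
Qed.

Lemma generators_Vdiff k : subalg_gen (generators R N k) = Vdiff_order_le R N k.
Proof.
apply/seteqP; split=> P.
  move/subalg_genP; apply.
  - by split; [apply/Vdiff_vdiff; apply: vdiff1|apply/order_le_low; apply: low1].
  - move=> c Q Q' [/Vdiff_vdiff vQ /order_le_low lQ] [/Vdiff_vdiff vQ' /order_le_low lQ'].
    split; [apply/Vdiff_vdiff; exact: vdiff_linear|apply/order_le_low; exact: supported_linear].
  - move=> Q Q' [/Vdiff_vdiff vQ /order_le_low lQ] [/Vdiff_vdiff vQ' /order_le_low lQ'].
    by split; [apply/Vdiff_vdiff; apply: vdiffM|apply/order_le_low; apply: lowM].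
  - move=> Q /generators_gens gQ.
    by split; [apply/Vdiff_vdiff; apply: gens_vdiff gQ|apply/order_le_low; apply: gens_low].
move=> [/Vdiff_vdiff vP /order_le_low lP]; apply/subalg_genP => A A1 AL AM AG.
apply: (@gens_generate _ _ VV A k P A1 AL AM _ vP lP) => Q /generators_gens; exact: AG.
Qed.

Lemma generators_minimal k (S : set (diffpoly R N)) :
  (S `<` generators R N k)%classic -> subalg_gen S <> Vdiff_order_le R N k.
Proof.
move=> [SG nGS] e; apply: nGS => g gg; apply: contrapT => nSg.
have SG' P : S P -> gens (V := VV) k P by move=> /SG /generators_gens.
have [A [A1 AL AM AS nAg]] := @gens_minimal _ _ VV k S g SG' ((generators_gens k g).1 gg) nSg.
apply: nAg; have : subalg_gen S g.
  by rewrite e -generators_Vdiff; apply/subalg_genP => A' _ _ _; apply.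
by move/subalg_genP; apply.
Qed.

Lemma card_G n : (G R N n.+1 #= `I_#|bar_words N n.+1|)%card.
Proof.
have -> : G R N n.+1 = ((fun u : n.+1.-tuple 'I_N.+1 => Wcols VV (columns (ranks u))) @`
    [set u | u \in bar_words N n.+1])%classic.
  apply/seteqP; split=> [P /G_Wcols [cs /barcols_words [//|u bu ->] ->]|_ [u bu <-]].
    by exists u.
  by apply/G_Wcols; exists (columns (ranks u)) => //; apply/barcols_words => //; exists u.
apply: card_image_finset => u v bu bv e; apply: columns_ranks_inj.
apply: (@Wcols_bar_inj _ _ VV n _ _ _ _ e); first by apply/barcols_words => //; exists u.
by apply/barcols_words => //; exists v.
Qed.

Lemma generators_finite k : finite_set (generators R N k).
Proof.
apply: bigcup_finite.
  by apply: sub_finite_set (finite_II k.+2) => d /= /andP [_ dk].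
move=> [|d] // _; apply/finite_setP; exists #|bar_words N d.+1|; exact: card_G.
Qed.

Lemma G_homog d : (G R N d `<=` homog R N d)%classic.
Proof.
move=> P /G_Wcols [cs bc ->]; apply/homog_homdeg.
by rewrite -{1}(stdcols_size (barcols_std bc)); apply: Wcols_hom.
Qed.

Lemma G_order n : (G R N n.+1 `<=` order_eq R N n)%classic.
Proof.
move=> P /G_Wcols [cs bc Pe]; split.
  apply/order_le_low; rewrite Pe -(stdcols_size (barcols_std bc)); exact: Wcols_low.
have := bar_not_low (V := VV) bc; rewrite -Pe.
(* In the case n = 0 the excluded polynomials are the constants, which are those of [low 0]. *)
by case: n bc => [|n] bc nl => [/constants_low|/order_le_low].
Qed.

End Concrete.

Local Open Scope classical_set_scope.
Local Open Scope card_scope.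

Theorem theorem0p0p1 (R : realType) (N k : nat) (hN : (1 <= N)%N) :
  [/\ finite_set (generators R N k),
      subalg_gen (generators R N k) = Vdiff_order_le R N k,
      [/\ G R N 1 #= `I_(N.+1),
          G R N 1 `<=` homog R N 1
        & G R N 1 `<=` order_eq R N 0],
      (forall i : nat, (2 <= i <= k.+1)%N ->
        [/\ G R N i #= `I_((N * N.+1) %/ 2 * N.+1 ^ (i - 2)),
            G R N i `<=` homog R N i
          & G R N i `<=` order_eq R N i.-1])
    & forall S : set (diffpoly R N),
        S `<` generators R N k -> subalg_gen S <> Vdiff_order_le R N k].
Proof.
split; [exact: generators_finite|exact: generators_Vdiff| | |exact: generators_minimal].
  by split; [have := card_G R N 0; rewrite card_bar_words1|apply: G_homog|apply: G_order].
move=> [|[|n]] // _; split; [|exact: G_homog|exact: G_order].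
by have := card_G R N n.+1; rewrite card_bar_words subn2.
Qed.
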